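(* Let $G=\mathrm{G}_2(4){:}2$ and let $\mathcal{P}$ be the conjugacy class of $4095$ central involutions of $G$ (class $2A$). Let $\mathcal{L}$ be the set of all three-element subsets $\{x,y,xy\}$ of $\mathcal{P}$, where $x,y\in\mathcal{P}$ are distinct commuting involutions satisfying $[G:N_G(\langle x,y\rangle)]\in\{1365,13650\}$. Then the point-line geometry $\mathcal{G}=(\mathcal{P},\mathcal{L})$ is a near octagon of order $(2,10)$ whose full automorphism group is isomorphic to $\mathrm{G}_2(4){:}2$. The set $S^*$ of lines $\{x,y,xy\}\in\mathcal{L}$ with $[G:N_G(\langle x,y\rangle)]=1365$ is a line spread of $\mathcal{G}$. Moreover, $\mathcal{G}$ contains precisely $416$ full subgeometries isomorphic to the Hall-Janko near octagon.
   Context: A central involution of a finite group is an involution whose centralizer contains a Sylow $2$-subgroup. A near $2d$-gon is a partial linear space whose collinearity graph is connected of diameter $d$ and such that for every point $x$ and line $L$ there is a unique point on $L$ nearest to $x$ (distances in the collinearity graph). It has order $(s,t)$ if every line has $s+1$ points and every point lies on $t+1$ lines; a near octagon is a near $8$-gon. A line spread is a set of pairwise disjoint lines covering all points. A subgeometry $(\mathcal{P}_1,\mathcal{L}_1)$ with $\mathcal{P}_1\subseteq\mathcal{P}$, $\mathcal{L}_1\subseteq\mathcal{L}$ is full if every line of $\mathcal{L}_1$ has all its points in $\mathcal{P}_1$. The Hall-Janko near octagon $\mathsf{HJ}$ is the geometry whose points are the $315$ central involutions of the Hall-Janko group $\mathrm{J}_2$ and whose lines are the triples $\{x,y,xy\}$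 with $x,y$ distinct commuting such involutions; it is the unique regular near octagon with parameters $(s,t;t_2,t_3)=(2,4;0,3)$. *)

(* Defs.v *)
From HB Require Import structures.
From mathcomp Require Import all_boot all_order all_algebra all_fingroup all_solvable.

Set Implicit Arguments.
Unset Strict Implicit.
Unset Printing Implicit Defensive.

Import GRing.Theory.

Section Geometry.

Variable T : finType.

(* The point set and the line set; a line is identified with its set of points
   and incidence is membership. *)
Definition geometry := ({set T} * {set {set T}})%type.

Implicit Types (g h : geometry) (x y : T) (l : {set T}).

Definition points g : {set T} := g.1.
Definition lines g : {set {set T}} := g.2.

Definition collinear g : rel T :=
  [rel x y | (x != y) && [exists l in lines g, (x \in l) && (y \in l)]].

Definition partial_linear_space g : Prop :=
  [/\ {in lines g, forall l, l \subset points g},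
      {in lines g, forall l, 1 < #|l|} &
      {in points g &, forall x y, x != y ->
         #|[set l in lines g | (x \in l) && (y \in l)]| <= 1}].

Definition walk g (n : nat) x y : bool :=
  [exists p : n.-tuple T, path (collinear g) x p && (last x p == y)].

(* A shortest walk has length less than #|T|; the value is #|T| exactly when
   there is no walk from x to y. *)
Definition distance g x y : nat :=
  find (fun n => walk g n x y) (iota 0 #|T|).

Definition connected g : Prop :=
  {in points g &, forall x y, connect (collinear g) x y}.

Definition has_diameter g (d : nat) : Prop :=
  {in points g &, forall x y, distance g x y <= d} /\
  exists x y, [/\ x \in points g, y \in points g & distance g x y = d].

Definition nearest g x l y : Prop :=
  y \in l /\ {in l, forall z, distance g x y <= distance g x z}.

(* near_polygon d is the notion of a near 2d-gon. *)
Definition near_polygon (d : nat) g : Prop :=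
  [/\ partial_linear_space g,
      connected g,
      has_diameter g d &
      forall x l, x \in points g -> l \in lines g -> exists! y, nearest g x l y].

Definition near_octagon g : Prop := near_polygon 4 g.

Definition has_order (s t : nat) g : Prop :=
  {in lines g, forall l, #|l| = s.+1} /\
  {in points g, forall x, #|[set l in lines g | x \in l]| = t.+1}.

Definition line_spread g (S : {set {set T}}) : Prop :=
  [/\ S \subset lines g, trivIset S & cover S = points g].

(* Automorphisms are the permutations of the point set that preserve the line
   set, extended by the identity outside the point set. *)
Definition geom_aut_set g : {set {perm T}} :=
  [set s : {perm T} | perm_on (points g) s &&
     ([set [set s x | x in l] | l : {set T} in lines g] == lines g)].

Lemma geom_aut_group_set g : group_set (geom_aut_set g).
Proof.
apply/group_setP; split=> [|s t].
  rewrite inE perm_on1; apply/eqP; rewrite -[RHS]imset_id.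
  apply: eq_imset => l; rewrite -[RHS]imset_id; apply: eq_imset => x.
  by rewrite perm1.
rewrite !inE => /andP[ons /eqP Ls] /andP[ont /eqP Lt].
rewrite perm_onM //=; apply/eqP; rewrite -[RHS]Lt -{2}Ls -imset_comp.
apply: eq_imset => l /=; rewrite -imset_comp; apply: eq_imset => x /=.
by rewrite permM.
Qed.

Canonical geom_aut g : {group {perm T}} := Group (geom_aut_group_set g).

Definition full_subgeometry g h : bool :=
  [&& points h \subset points g, lines h \subset lines g
    & [forall l in lines h, l \subset points h]].

End Geometry.

Definition geom_isomorphic (T U : finType) (g : geometry T) (h : geometry U) :
    bool :=
  [exists f : {ffun T -> U},
    [&& [forall x in points g, forall y in points g, (f x == f y) ==> (x == y)],
        [set f x | x in points g] == points h
      & [set [set f x | x in l] | l : {set T} in lines g] == lines h]].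

Section Involutions.

Local Open Scope group_scope.

Variable gT : finGroupType.
Implicit Types (G : {set gT}) (x y : gT).

Definition central_involution G x : bool :=
  [&& x \in G, #[x] == 2%N
    & [exists S : {group gT}, (S \in 'Syl_2(G)) && (S \subset 'C_G[x])]].

Definition central_involutions G : {set gT} :=
  [set x | central_involution G x].

Definition triple x y : {set gT} := [set x; y; x * y].

(* The index is constant on the triple: any two of its distinct elements
   generate the same subgroup. *)
Definition involution_lines G (P : {set gT}) (idx : seq nat) : {set {set gT}} :=
  [set triple x y | x in P, y in P &
     [&& x != y, x * y == y * x, x * y \in P
       & #|G : 'N_G(<<[set x; y]>>)| \in idx]].

End Involutions.

Section Octonions.

Local Open Scope ring_scope.

Variable F : finFieldType.

(* Zorn's vector-matrix model of the split octonion algebra over F: the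
   quadruple (a, u, v, b) stands for the matrix with diagonal entries a and b
   in F and off-diagonal entries u (upper right) and v (lower left) in F^3. *)
Definition octonion := (F^o * 'rV[F]_3 * 'rV[F]_3 * F^o)%type.

Definition dotv (u v : 'rV[F]_3) : F := \sum_(i < 3) u 0 i * v 0 i.

(* Indices are added modulo 3. *)
Definition crossv (u v : 'rV[F]_3) : 'rV[F]_3 :=
  \row_(i < 3) (u 0 (i + 1) * v 0 (i + 2) - u 0 (i + 2) * v 0 (i + 1)).

Definition omul (x y : octonion) : octonion :=
  let: (a, u, v, b) := x in let: (a', u', v', b') := y in
  (a * a' + dotv u v',
   a *: u' + b' *: u - crossv v v',
   a' *: v + b *: v' + crossv u u',
   b * b' + dotv v u').

(* The sigma-semilinear automorphisms of the octonion algebra.  Bijectivity of f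
   forces sigma to be an automorphism of the field F. *)
Definition semilinear_oaut (sigma : {ffun F -> F}) (f : {perm octonion}) : bool :=
  [&& [forall x : octonion, forall y : octonion, f (x + y) == f x + f y],
      [forall a : F, forall x : octonion, f (a *: x) == sigma a *: f x]
    & [forall x : octonion, forall y : octonion,
         f (omul x y) == omul (f x) (f y)]].

(* The linear automorphisms of the octonion algebra over F = F_q form the group
   G_2(q), so the semilinear ones form its extension by the field automorphisms
   Gal(F_q / F_p).  For q = 4 the latter group has order 2 and the extension
   is G_2(4):2. *)
Definition G2_semilinear_set : {set {perm octonion}} :=
  [set f | [exists sigma : {ffun F -> F}, semilinear_oaut sigma f]].

Lemma G2_semilinear_group_set : group_set G2_semilinear_set.
Proof.
apply/group_setP; split=> [|f g].
  rewrite inE; apply/existsP; exists [ffun a => a]; apply/and3P; split.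
  - by apply/'forall_forallP => x y; rewrite !perm1.
  - by apply/'forall_forallP => a x; rewrite !perm1 ffunE.
  - by apply/'forall_forallP => x y; rewrite !perm1.
rewrite !inE => /existsP[s /and3P[fD fZ fM]] /existsP[t /and3P[gD gZ gM]].
apply/existsP; exists [ffun a => t (s a)]; apply/and3P; split.
- apply/'forall_forallP => x y; rewrite !permM.
  by rewrite (eqP ('forall_forallP fD x y)) (eqP ('forall_forallP gD _ _)).
- apply/'forall_forallP => a x; rewrite !permM ffunE.
  by rewrite (eqP ('forall_forallP fZ a x)) (eqP ('forall_forallP gZ _ _)).
- apply/'forall_forallP => x y; rewrite !permM.
  by rewrite (eqP ('forall_forallP fM x y)) (eqP ('forall_forallP gM _ _)).
Qed.

Canonical G2_semilinear : {group {perm octonion}} :=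
  Group G2_semilinear_group_set.

End Octonions.

Section HallJanko.

Local Open Scope group_scope.

(* [:: x; y1; ...; yk] stands for the cycle x -> y1 -> ... -> yk -> x on the
   points 1, ..., 100, the point i being encoded as the ordinal i - 1. *)
Definition cycle_perm (c : seq nat) : 'S_100 :=
  \prod_(y <- behead c) tperm (inord (head 1%N c).-1) (inord y.-1).

(* The standard generators (in the sense of the ATLAS of Group Representations)
   of J_2 in its rank 3 action on the 100 vertices of the Hall-Janko graph:
   J2_a is in class 2B, J2_b is in class 3B, J2_a * J2_b has order 7 and
   J2_a * J2_b * J2_a * J2_b * J2_b has order 12. *)
Definition J2_a : 'S_100 := \prod_(c <-
  [:: [:: 1; 84]; [:: 2; 20]; [:: 3; 48]; [:: 4; 56]; [:: 5; 82]; [:: 6; 67];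
      [:: 7; 55]; [:: 8; 41]; [:: 9; 35]; [:: 10; 40]; [:: 11; 78];
      [:: 12; 100]; [:: 13; 49]; [:: 14; 37]; [:: 15; 94]; [:: 16; 76];
      [:: 17; 19]; [:: 18; 44]; [:: 21; 34]; [:: 22; 85]; [:: 23; 92];
      [:: 24; 57]; [:: 25; 75]; [:: 26; 28]; [:: 27; 64]; [:: 29; 90];
      [:: 30; 97]; [:: 31; 38]; [:: 32; 68]; [:: 33; 69]; [:: 36; 53];
      [:: 39; 61]; [:: 42; 73]; [:: 43; 91]; [:: 45; 86]; [:: 46; 81];
      [:: 47; 89]; [:: 50; 93]; [:: 51; 96]; [:: 52; 72]; [:: 54; 74];
      [:: 58; 99]; [:: 59; 95]; [:: 60; 63]; [:: 62; 83]; [:: 65; 70];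
      [:: 66; 88]; [:: 71; 87]; [:: 77; 98]; [:: 79; 80]]%N) cycle_perm c.

Definition J2_b : 'S_100 := \prod_(c <-
  [:: [:: 1; 80; 22]; [:: 2; 9; 11]; [:: 3; 53; 87]; [:: 4; 23; 78];
      [:: 5; 51; 18]; [:: 6; 37; 24]; [:: 8; 27; 60]; [:: 10; 62; 47];
      [:: 12; 65; 31]; [:: 13; 64; 19]; [:: 14; 61; 52]; [:: 15; 98; 25];
      [:: 16; 73; 32]; [:: 17; 39; 33]; [:: 20; 97; 58]; [:: 21; 96; 67];
      [:: 26; 93; 99]; [:: 28; 57; 35]; [:: 29; 71; 55]; [:: 30; 69; 45];
      [:: 34; 86; 82]; [:: 38; 59; 94]; [:: 40; 43; 91]; [:: 42; 68; 44];
      [:: 46; 85; 89]; [:: 48; 76; 90]; [:: 49; 92; 77]; [:: 50; 66; 88];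
      [:: 54; 95; 56]; [:: 63; 74; 72]; [:: 70; 81; 75]; [:: 79; 100; 83]]%N) cycle_perm c.

Definition J2 : {group 'S_100} := <<[set J2_a; J2_b]>>%G.

Definition HJ : geometry 'S_100 :=
  let P := central_involutions J2 in
  (P, [set triple x y | x in P, y in P & (x != y) && (x * y == y * x)]).

End HallJanko.

(* Main.v *)
(* The points are identified with the root elements x |-> x + a (b x) of G_2(4), where (a, b)
   spans a totally null plane with zero multiplication: a^2 = b^2 = a b = b a = 0.  A root element
   is stored as the reduced basis of its plane, so that the 4095 points, their lines and their
   distances from one point become finite tables over the field of four elements, checked by
   computation; the action of G transports what is checked at one point to all points.

   Central involutions.  If K is a 2-subgroup of G such that z is the only involution of C_G(K),
   then every central involution is conjugate to z, since by Sylow one of its conjugates centralizes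
   a group containing K.

   Automorphisms.  G is transitive on pairs at distance 4, and the stabilizer of such a pair acts
   as A_5 on five distinguished neighbours of its second point; an automorphism that fixes the
   pair and three of these neighbours fixes every point, because points are successively
   determined by their distances to points already known to be fixed.

   Hall-Janko subgeometries.  One of them is the class of an explicit subgroup of G generated by
   images of the generators of J_2.  Any embedding of HJ is isometric: a pair at distance 3 cannot
   be brought closer since points at distance 2 have at most three common neighbours, and a pair
   at distance 4 cannot since the lines of HJ through a point x would all be near to one point at
   distance 3 of x, while at most 64 points share a given set of near lines and HJ has 160 points
   at distance 3.  The lines of HJ through x are recovered from x and one point of HJ at distance 4
   of x, so a pair at distance 4 lies in exactly one copy, and 4095 * 2048 = 416 * (315 * 64). *)

From Stdlib Require Import Ring.
Require Import Defs.
From HB Require Import structures.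
From mathcomp Require Import all_boot all_order all_algebra all_fingroup all_solvable finfield.

Set Implicit Arguments.
Unset Strict Implicit.
Unset Printing Implicit Defensive.

(** * The field of four elements and its split octonions *)

(** No subgroup structure of G_2(4), not even the order of G, is computed. Orbits enumerated from
    explicit elements replace it: a stabilizer chain along four basis octonions shows that [kapf],
    two root elements and the Frobenius map generate G, so that tables need to be checked against
    four generators only. The normalizer indices come from counting: with 4095 points and three
    points on a triple, an index is 1365 times the number of conjugates of the triple through one
    point, and this number is 1, 10 or at least 20. The searches that produce the tables are not
    trusted. A search is only shown to return elements with some invariant, such as conjugacy to a
    given element; all other properties of its output are checked by evaluation. G enters through a
    faithful action on octonions over the concrete type [f4] that realizes all semilinear
    automorphisms; the given field of order four serves only to supply this action. Likewise no map
    from J_2 to G is shown to be well defined: a subgroup of the product of the two groups is used,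
    and conjugates of an involution are followed in both coordinates at once. *)

Inductive f4 := q0 | q1 | qw | qv.

Definition fadd a b := match a, b with
  | q0, x | x, q0 => x
  | q1, q1 | qw, qw | qv, qv => q0
  | q1, qw | qw, q1 => qv
  | q1, qv | qv, q1 => qw
  | qw, qv | qv, qw => q1
  end.

Definition fmul a b := match a, b with
  | q0, _ | _, q0 => q0
  | q1, x | x, q1 => x
  | qw, qw => qv
  | qv, qv => qw
  | qw, qv | qv, qw => q1
  end.

Definition ffrob a := match a with qw => qv | qv => qw | x => x end.

Definition feqb a b := match a, b with
  | q0, q0 | q1, q1 | qw, qw | qv, qv => true
  | _, _ => false
  end.

Inductive oct := Oct (a u1 u2 u3 v1 v2 v3 b : f4).

Definition oadd x y :=
  let: Oct a u1 u2 u3 v1 v2 v3 b := x in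
  let: Oct a' u1' u2' u3' v1' v2' v3' b' := y in
  Oct (fadd a a') (fadd u1 u1') (fadd u2 u2') (fadd u3 u3')
      (fadd v1 v1') (fadd v2 v2') (fadd v3 v3') (fadd b b').

Definition oscale k x :=
  let: Oct a u1 u2 u3 v1 v2 v3 b := x in
  Oct (fmul k a) (fmul k u1) (fmul k u2) (fmul k u3)
      (fmul k v1) (fmul k v2) (fmul k v3) (fmul k b).

Definition det2 a b c d := fadd (fmul a d) (fmul b c).

Definition dot3 a b c x y z := fadd (fmul a x) (fadd (fmul b y) (fmul c z)).

Definition omul8 x y :=
  let: Oct a u1 u2 u3 v1 v2 v3 b := x in
  let: Oct a' u1' u2' u3' v1' v2' v3' b' := y in
  Oct (fadd (fmul a a') (dot3 u1 u2 u3 v1' v2' v3'))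
      (fadd (fadd (fmul a u1') (fmul b' u1)) (det2 v2 v3 v2' v3'))
      (fadd (fadd (fmul a u2') (fmul b' u2)) (det2 v3 v1 v3' v1'))
      (fadd (fadd (fmul a u3') (fmul b' u3)) (det2 v1 v2 v1' v2'))
      (fadd (fadd (fmul a' v1) (fmul b v1')) (det2 u2 u3 u2' u3'))
      (fadd (fadd (fmul a' v2) (fmul b v2')) (det2 u3 u1 u3' u1'))
      (fadd (fadd (fmul a' v3) (fmul b v3')) (det2 u1 u2 u1' u2'))
      (fadd (fmul b b') (dot3 v1 v2 v3 u1' u2' u3')).

(* Coefficients in bool make [ring] aware of the characteristic. *)
Lemma f4_ring_theory : ring_theory q0 q1 fadd fmul fadd id (@eq f4).
Proof. by split; do ?case. Qed.

Lemma f4_ring_morph :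
  ring_morph q0 q1 fadd fmul fadd id (@eq f4)
    false true xorb andb xorb id Bool.eqb (fun b : bool => if b then q1 else q0).
Proof. by split => //; do ?case. Qed.

Ltac f4cst t := match t with q0 => false | q1 => true | _ => InitialRing.NotConstant end.

Add Ring f4_ring : f4_ring_theory
  (morphism f4_ring_morph, constants [f4cst]).

Lemma oaltl x y : omul8 x (omul8 x y) = omul8 (omul8 x x) y.
Proof.
case: x => a1 a2 a3 a4 a5 a6 a7 a8; case: y => b1 b2 b3 b4 b5 b6 b7 b8.
rewrite /omul8 /oadd /oscale /dot3 /det2; congr Oct; ring.
Qed.

Lemma feqbP : Equality.axiom feqb.
Proof. by do 2![case]; constructor. Qed.
HB.instance Definition _ := hasDecEq.Build f4 feqbP.

Definition oeqb x y :=
  let: Oct a u1 u2 u3 v1 v2 v3 b := x in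
  let: Oct a' u1' u2' u3' v1' v2' v3' b' := y in
  feqb u1 u1' && (feqb u2 u2' && (feqb u3 u3' && (feqb v1 v1' &&
  (feqb v2 v2' && (feqb v3 v3' && (feqb a a' && feqb b b')))))).

Lemma oeqbP : Equality.axiom oeqb.
Proof.
move=> [a1 a2 a3 a4 a5 a6 a7 a8] [b1 b2 b3 b4 b5 b6 b7 b8].
apply: (iffP idP) => [|[-> -> -> -> -> -> -> ->]]; last first.
  by rewrite /oeqb !(introT (feqbP _ _) (erefl _)).
by rewrite /oeqb; do 7![case/andP => /feqbP->]; move/feqbP->.
Qed.
HB.instance Definition _ := hasDecEq.Build oct oeqbP.

Inductive lab := Lab (a b : oct).

Definition leqb l m :=
  let: Lab a b := l in let: Lab a' b' := m in oeqb a a' && oeqb b b'.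

Lemma leqbP : Equality.axiom leqb.
Proof.
move=> [a b] [c d]; apply: (iffP andP) => [[/oeqbP-> /oeqbP->] //|[-> ->]].
by split; apply/oeqbP.
Qed.
HB.instance Definition _ := hasDecEq.Build lab leqbP.

Definition okey x :=
  let: Oct a u1 u2 u3 v1 v2 v3 b := x in [:: u1; u2; u3; v1; v2; v3; a; b].

Lemma okey_inj : injective okey.
Proof. by move=> [????????] [????????] [-> -> -> -> -> -> -> ->]. Qed.

Definition lkey l := let: Lab a b := l in okey a ++ okey b.

Lemma lkey_inj : injective lkey.
Proof.
move=> [a b] [c d] /eqP; rewrite eqseq_cat; last by case: a; case: c.
by case/andP=> /eqP/okey_inj-> /eqP/okey_inj->.
Qed.

Definition ozero := Oct q0 q0 q0 q0 q0 q0 q0 q0.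
Definition oone := Oct q1 q0 q0 q0 q0 q0 q0 q1.

Ltac octring := rewrite /oone /ozero /omul8 /oadd /oscale /dot3 /det2;
  congr Oct; ring.

Lemma oaddA : associative oadd.
Proof. by move=> [????????] [????????] [????????]; octring. Qed.
Lemma oaddC : commutative oadd.
Proof. by move=> [????????] [????????]; octring. Qed.
Lemma oadd0 x : oadd x ozero = x.
Proof. by case: x => ????????; octring. Qed.
Lemma oaddxx x : oadd x x = ozero.
Proof. by case: x => ????????; octring. Qed.
Lemma oaddK x y : oadd (oadd x y) y = x.
Proof. by rewrite -oaddA oaddxx oadd0. Qed.
Lemma oaddI x : injective (oadd x).
Proof. by move=> y z; rewrite ![oadd x _]oaddC => e; rewrite -(oaddK y x) e oaddK. Qed.
Lemma omulDl x y z : omul8 (oadd x y) z = oadd (omul8 x z) (omul8 y z).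
Proof. by case: x => ????????; case: y => ????????; case: z => ????????; octring. Qed.
Lemma omulDr x y z : omul8 x (oadd y z) = oadd (omul8 x y) (omul8 x z).
Proof. by case: x => ????????; case: y => ????????; case: z => ????????; octring. Qed.
Lemma omulZl k x y : omul8 (oscale k x) y = oscale k (omul8 x y).
Proof. by case: x => ????????; case: y => ????????; octring. Qed.
Lemma omulZr k x y : omul8 x (oscale k y) = oscale k (omul8 x y).
Proof. by case: x => ????????; case: y => ????????; octring. Qed.
Lemma oscaleD k x y : oscale k (oadd x y) = oadd (oscale k x) (oscale k y).
Proof. by case: x => ????????; case: y => ????????; octring. Qed.
Lemma oscaleA k l x : oscale k (oscale l x) = oscale (fmul k l) x.
Proof. by case: x => ????????; octring. Qed.
Lemma oscale1 x : oscale q1 x = x.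
Proof. by case: x => ????????; octring. Qed.
Lemma oscale0 x : oscale q0 x = ozero.
Proof. by case: x => ????????; octring. Qed.
Lemma oscaleDl k l x : oscale (fadd k l) x = oadd (oscale k x) (oscale l x).
Proof. by case: x => ????????; octring. Qed.
Lemma omul1 x : omul8 x oone = x.
Proof. by case: x => ????????; octring. Qed.
Lemma mul1o x : omul8 oone x = x.
Proof. by case: x => ????????; octring. Qed.
Lemma omul0 x : omul8 x ozero = ozero.
Proof. by case: x => ????????; octring. Qed.
Lemma mul0o x : omul8 ozero x = ozero.
Proof. by case: x => ????????; octring. Qed.

(** Polarisation of [oaltl]: replace the left factor by a sum and compare the mixed terms. It makes
    a(bx) alternating in a null pair (a, b). *)
Lemma oaltl_lin x y z : oadd (omul8 x (omul8 y z)) (omul8 y (omul8 x z)) =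
  omul8 (oadd (omul8 x y) (omul8 y x)) z.
Proof. by case: x => ????????; case: y => ????????; case: z => ????????; octring. Qed.

Definition obasis : seq oct :=
  [:: Oct q1 q0 q0 q0 q0 q0 q0 q0; Oct q0 q1 q0 q0 q0 q0 q0 q0;
      Oct q0 q0 q1 q0 q0 q0 q0 q0; Oct q0 q0 q0 q1 q0 q0 q0 q0;
      Oct q0 q0 q0 q0 q1 q0 q0 q0; Oct q0 q0 q0 q0 q0 q1 q0 q0;
      Oct q0 q0 q0 q0 q0 q0 q1 q0; Oct q0 q0 q0 q0 q0 q0 q0 q1].

(** A basis over the prime field: semilinear maps are only additive in general, so identities
    between them are tested on 16 octonions instead of 8. *)
Definition basis16 : seq oct := obasis ++ [seq oscale qw x | x <- obasis].

Lemma oct_ind_add (P : oct -> Prop) :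
  P ozero -> (forall x y, P x -> P y -> P (oadd x y)) ->
  (forall x, x \in basis16 -> P x) -> forall x, P x.
Proof.
move=> P0 PD Pb.
have Pe k e : e \in obasis -> P (oscale k e).
  move=> eb; have P1: P e by apply: Pb; rewrite mem_cat eb.
  have Pw: P (oscale qw e) by apply: Pb; rewrite mem_cat (map_f (oscale qw) eb) orbT.
  case: k => //; rewrite ?oscale0 ?oscale1 //.
  by rewrite (oscaleDl q1 qw) oscale1; apply: PD.
move=> [a1 a2 a3 a4 a5 a6 a7 a8].
pose e i := nth ozero obasis i.
have -> : Oct a1 a2 a3 a4 a5 a6 a7 a8 =
  oadd (oscale a1 (e 0)) (oadd (oscale a2 (e 1)) (oadd (oscale a3 (e 2))
  (oadd (oscale a4 (e 3)) (oadd (oscale a5 (e 4)) (oadd (oscale a6 (e 5))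
  (oadd (oscale a7 (e 6)) (oscale a8 (e 7)))))))).
  by rewrite /e /=; congr Oct; ring.
by do 7![apply: (PD); first by apply: (Pe); rewrite /e mem_nth]; apply: Pe; rewrite /e mem_nth.
Qed.

Definition oadditive (f : oct -> oct) := forall x y, f (oadd x y) = oadd (f x) (f y).
Definition omorphic (f : oct -> oct) := forall x y, f (omul8 x y) = omul8 (f x) (f y).
Definition twist (s : bool) (k : f4) := if s then ffrob k else k.
Definition semi (f : oct -> oct) :=
  [/\ oadditive f, exists s, forall k x, f (oscale k x) = oscale (twist s k) (f x)
    & omorphic f].

Lemma oadditive0 f : oadditive f -> f ozero = ozero.
Proof. by move=> fD; rewrite -(oaddxx ozero) fD oaddxx. Qed.

Definition agree (f h : oct -> oct) := all (fun e => oeqb (f e) (h e)) basis16.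

Lemma agreeP f h : oadditive f -> oadditive h -> reflect (f =1 h) (agree f h).
Proof.
move=> fD hD; apply: (iffP allP) => [fh|fh x _]; last exact/oeqbP.
apply: oct_ind_add => [|x y fx fy|x /fh/oeqbP //]; first by rewrite !oadditive0.
by rewrite fD hD fx fy.
Qed.

Definition mulcheck (f : oct -> oct) :=
  all (fun x => all (fun y => oeqb (f (omul8 x y)) (omul8 (f x) (f y))) basis16) basis16.

Lemma mulcheckP f : oadditive f -> mulcheck f -> omorphic f.
Proof.
move=> fD /allP fM x y; move: x.
apply: oct_ind_add => [|x x' IH IH'|x xb]; first by rewrite !mul0o oadditive0 // mul0o.
  by rewrite omulDl !fD IH IH' omulDl.
move: y; apply: oct_ind_add => [|y y' IH IH'|y yb].
- by rewrite !omul0 oadditive0 // omul0.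
- by rewrite omulDr !fD IH IH' omulDr.
by have /allP/(_ _ yb)/oeqbP := fM _ xb.
Qed.

Definition uvs x :=
  let: Oct _ u1 u2 u3 v1 v2 v3 _ := x in [:: u1; u2; u3; v1; v2; v3].

Fixpoint first_pair (ks ls : seq f4) : f4 * f4 :=
  match ks, ls with
  | q0 :: ks', q0 :: ls' => first_pair ks' ls'
  | k :: _, l :: _ => (k, l)
  | _, _ => (q0, q0)
  end.

Fixpoint first_nz (ks ls : seq f4) : f4 * f4 :=
  match ks, ls with
  | _ :: ks', q0 :: ls' => first_nz ks' ls'
  | k :: _, l :: _ => (k, l)
  | _, _ => (q0, q0)
  end.

(** * Root elements *)

(* Inversion in f4 is the Frobenius map. *)
Definition canon_fst (ap bp : f4) (a b : oct) : lab :=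
  Lab (oscale (ffrob ap) a) (oadd (oscale ap b) (oscale bp a)).

Definition canon_snd (l : lab) : lab :=
  let: Lab a b := l in
  let: (aq, bq) := first_nz (uvs a) (uvs b) in
  Lab (oadd a (oscale (fmul aq (ffrob bq)) b)) b.

(** Row reduction by row operations of determinant 1. For a null pair the map x -> a(bx) depends
    only on the exterior product of a and b, so the second pivot is left unscaled and records a
    scalar: a plane carries three labels, one for each nonzero scalar, and they will form a spread
    line. Pivots are sought among the six off-diagonal coordinates, which determine a null
    octonion. *)
Definition canon (l : lab) : lab :=
  let: Lab a b := l in
  match first_pair (uvs a) (uvs b) with
  | (q0, q0) => l
  | (q0, bp) => canon_snd (canon_fst bp q0 b a)
  | (ap, bp) => canon_snd (canon_fst ap bp a b)
  end.

Definition lact (f : oct -> oct) (l : lab) : lab :=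
  let: Lab a b := l in canon (Lab (f a) (f b)).

Definition epsf (l : lab) (x : oct) : oct :=
  let: Lab a b := l in oadd x (omul8 a (omul8 b x)).

Definition null_pair (l : lab) : bool :=
  let: Lab a b := l in
  [&& omul8 a a == ozero, omul8 b b == ozero, omul8 a b == ozero & omul8 b a == ozero].

Lemma epsf_additive l : oadditive (epsf l).
Proof.
case: l => a b x y /=; rewrite !omulDr.
by rewrite -!oaddA; congr oadd; rewrite oaddC -!oaddA; congr oadd; rewrite oaddC.
Qed.

Lemma epsfD l x y : epsf l (oadd x y) = oadd (epsf l x) (epsf l y).
Proof. exact: epsf_additive. Qed.

Lemma epsf_linear l k x : epsf l (oscale k x) = oscale k (epsf l x).
Proof. by case: l => a b; rewrite /= !omulZr oscaleD. Qed.

Definition same_eps l m := null_pair l -> null_pair m /\ epsf m =1 epsf l.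

Lemma same_eps_trans m l n : same_eps l m -> same_eps m n -> same_eps l n.
Proof. by move=> lm mn sl; have [sm em] := lm sl; have [? en] := mn sm; split=> // x; rewrite en. Qed.

(** By [oaltl_lin], a(bx) + b(ax) = (ab + ba)x = 0, and signs do not matter in characteristic 2. *)
Lemma same_eps_swap a b : same_eps (Lab a b) (Lab b a).
Proof.
move=> /and4P[aa bb ab ba]; split=> [|x]; first by apply/and4P.
rewrite /=; congr oadd; have := oaltl_lin a b x.
rewrite (eqP ab) (eqP ba) oaddxx mul0o => e.
by rewrite -[LHS]oadd0 -[X in oadd _ X]e [X in oadd _ X]oaddC oaddA oaddxx oaddC oadd0.
Qed.

Arguments same_eps_swap : clear implicits.

Lemma same_eps_shear k a b : same_eps (Lab a b) (Lab a (oadd b (oscale k a))).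
Proof.
move=> /and4P[aa bb ab ba]; split=> [|x].
  apply/and4P; split=> //; rewrite ?(omulDl, omulDr) ?(omulZl, omulZr) ?(eqP aa) ?(eqP ab)
    ?(eqP ba) ?(eqP bb) //; by rewrite /oadd /oscale; case: k.
rewrite /=; congr oadd.
rewrite omulDl omulZl omulDr omulZr oaltl (eqP aa) mul0o.
by case: (omul8 a _) => ????????; rewrite /oadd /oscale /=; congr Oct; ring.
Qed.

Arguments same_eps_shear : clear implicits.

Lemma same_eps_shearl k a b : same_eps (Lab a b) (Lab (oadd a (oscale k b)) b).
Proof.
apply: same_eps_trans (same_eps_swap a b) _.
exact: same_eps_trans (same_eps_shear k b a) (same_eps_swap _ _).
Qed.

Arguments same_eps_shearl : clear implicits.

Lemma same_eps_scale k a b : k != q0 ->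
  same_eps (Lab a b) (Lab (oscale (ffrob k) a) (oscale k b)).
Proof.
move=> k0 /and4P[aa bb ab ba]; split=> [|x].
  apply/and4P; split; rewrite !(omulZl, omulZr) ?(eqP aa) ?(eqP ab) ?(eqP ba) ?(eqP bb);
    by case: k {k0}.
rewrite /= !(omulZl, omulZr) oscaleA.
have -> : fmul (ffrob k) k = q1 by case: k k0.
by rewrite oscale1.
Qed.

Arguments same_eps_scale k a b : clear implicits.

Lemma same_eps_fst ap bp a b : ap != q0 -> same_eps (Lab a b) (canon_fst ap bp a b).
Proof.
move=> ap0; apply: same_eps_trans (same_eps_shear (fmul bp (ffrob ap)) a b) _.
have := same_eps_scale ap a (oadd b (oscale (fmul bp (ffrob ap)) a)) ap0.
rewrite oscaleD oscaleA.
by have -> : fmul ap (fmul bp (ffrob ap)) = bp by case: ap ap0 => //; case: bp.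
Qed.

Arguments same_eps_fst : clear implicits.

Lemma same_eps_snd l : same_eps l (canon_snd l).
Proof. by case: l => a b /=; case: first_nz => aq bq; apply: same_eps_shearl. Qed.

Arguments same_eps_snd : clear implicits.

Lemma same_eps_canon l : same_eps l (canon l).
Proof.
case: l => a b; rewrite /canon; case: first_pair => ap bp.
have big c : c != q0 -> same_eps (Lab a b) (canon_snd (canon_fst c bp a b)).
  by move=> c0; apply: same_eps_trans (same_eps_fst c bp a b c0) (same_eps_snd _).
have small c : c != q0 -> same_eps (Lab a b) (canon_snd (canon_fst c q0 b a)).
  move=> c0; apply: same_eps_trans (same_eps_swap a b) _.
  exact: same_eps_trans (same_eps_fst c q0 b a c0) (same_eps_snd _).
by case: ap; try exact: big; case: bp {big}; try exact: small.
Qed.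

Lemma null_pair_semi f a b : semi f -> null_pair (Lab a b) -> null_pair (Lab (f a) (f b)).
Proof.
move=> [fD _ fM] /and4P[aa bb ab ba]; have f0 := oadditive0 fD.
by apply/and4P; rewrite -!fM (eqP aa) (eqP bb) (eqP ab) (eqP ba) f0.
Qed.

Lemma lact_null_pair f l : semi f -> null_pair l -> null_pair (lact f l).
Proof. by case: l => a b sf /(null_pair_semi sf)/same_eps_canon[]. Qed.

(** Since f(a(bx)) = f(a)(f(b)f(x)), an automorphism conjugates the root element of [l] into that of
    the moved label. Conjugation in the group thus becomes an operation on labels. *)
Lemma epsf_lact f l x : semi f -> null_pair l -> epsf (lact f l) (f x) = f (epsf l x).
Proof.
case: l => a b sf /(null_pair_semi sf)/same_eps_canon[_ ->].
by case: sf => fD _ fM; rewrite /= fD !fM.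
Qed.

Definition ofrob x :=
  let: Oct a u1 u2 u3 v1 v2 v3 b := x in
  Oct (ffrob a) (ffrob u1) (ffrob u2) (ffrob u3)
      (ffrob v1) (ffrob v2) (ffrob v3) (ffrob b).

Definition linf (e1 e2 e3 e4 e5 e6 e7 e8 : oct) (x : oct) :=
  let: Oct a1 a2 a3 a4 a5 a6 a7 a8 := x in
  oadd (oscale a1 e1) (oadd (oscale a2 e2) (oadd (oscale a3 e3) (oadd (oscale a4 e4)
    (oadd (oscale a5 e5) (oadd (oscale a6 e6) (oadd (oscale a7 e7) (oscale a8 e8))))))).

Lemma linf_additive e1 e2 e3 e4 e5 e6 e7 e8 : oadditive (linf e1 e2 e3 e4 e5 e6 e7 e8).
Proof.
move=> [a1 a2 a3 a4 a5 a6 a7 a8] [b1 b2 b3 b4 b5 b6 b7 b8].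
case: e1 e2 e3 e4 e5 e6 e7 e8 => ???????? [????????] [????????] [????????] [????????]
  [????????] [????????] [????????].
by rewrite /linf /oadd /oscale; congr Oct; ring.
Qed.

Lemma linf_linear e1 e2 e3 e4 e5 e6 e7 e8 k x :
  linf e1 e2 e3 e4 e5 e6 e7 e8 (oscale k x) = oscale k (linf e1 e2 e3 e4 e5 e6 e7 e8 x).
Proof. by case: x => ????????; rewrite /linf !oscaleD !oscaleA. Qed.

Lemma ofrob_semi : semi ofrob.
Proof.
have fD k l : ffrob (fadd k l) = fadd (ffrob k) (ffrob l) by case: k l => [] [].
have fM k l : ffrob (fmul k l) = fmul (ffrob k) (ffrob l) by case: k l => [] [].
split; last 1 first.
- by move=> [????????] [????????]; rewrite /= /det2 /dot3 !(fD, fM).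
- by move=> [????????] [????????]; rewrite /= !fD.
by exists true => k [????????]; rewrite /= !fM.
Qed.

Lemma linear_semi f : oadditive f -> (forall k x, f (oscale k x) = oscale k (f x)) ->
  mulcheck f -> semi f.
Proof. by move=> fD fZ fM; split=> //; [exists false | apply: mulcheckP]. Qed.

(** The end of the stabilizer chain: a semilinear map that fixes the eight basis octonions is
    determined by its field automorphism. *)
Lemma semi_basis f : semi f -> {in obasis, forall e, f e = e} ->
  f =1 id \/ f =1 ofrob.
Proof.
case=> fD [s fZ] _ fb.
have fE x : f x = if s then ofrob x else x.
  pose e i := nth ozero obasis i.
  have fe i : i < 8 -> f (e i) = e i by move=> i8; apply: fb; rewrite mem_nth.
  case: x => a1 a2 a3 a4 a5 a6 a7 a8.
  have E b1 b2 b3 b4 b5 b6 b7 b8 : Oct b1 b2 b3 b4 b5 b6 b7 b8 =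
    oadd (oscale b1 (e 0)) (oadd (oscale b2 (e 1)) (oadd (oscale b3 (e 2))
    (oadd (oscale b4 (e 3)) (oadd (oscale b5 (e 4)) (oadd (oscale b6 (e 5))
    (oadd (oscale b7 (e 6)) (oscale b8 (e 7)))))))).
    by rewrite /e /=; congr Oct; ring.
  rewrite {1}E !fD !fZ !fe //; case: s {fZ} => /=; rewrite /e /=; congr Oct; ring.
by case: s {fZ} fE; [right | left].
Qed.

Lemma null_pair_comm a b y : null_pair (Lab a b) ->
  omul8 a (omul8 b y) = omul8 b (omul8 a y).
Proof.
move=> sl; have [_ /(_ y) /= e] := same_eps_swap a b sl.
by apply: (@oaddI y); rewrite -e.
Qed.

(** With N the map x -> a(bx), the square of 1 + N is 1 + N^2 in characteristic 2, and N^2 = 0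
    because the two left multiplications commute and square to 0. *)
Lemma epsf_invol l : null_pair l -> cancel (epsf l) (epsf l).
Proof.
case: l => a b sl x; have /and4P[aa bb ab ba] := sl; rewrite /= !omulDr.
rewrite [omul8 b (omul8 a _)]null_pair_comm; last by rewrite /= aa bb ab ba.
rewrite (oaltl b) (eqP bb) mul0o !omul0 oadd0.
by rewrite -oaddA oaddxx oadd0.
Qed.

(** * Tables of the 4095 points *)

Inductive trie (A : Type) := Tip | Node (v : option A) (t0 t1 t2 t3 : trie A).
Arguments Tip {A}.

Fixpoint tfind A (k : seq f4) (t : trie A) {struct t} : option A :=
  match t with
  | Tip => None
  | Node v t0 t1 t2 t3 =>
    match k with
    | [::] => v
    | q0 :: k' => tfind k' t0
    | q1 :: k' => tfind k' t1
    | qw :: k' => tfind k' t2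
    | qv :: k' => tfind k' t3
    end
  end.

Fixpoint tadd A (k : seq f4) (a : A) (t : trie A) : trie A :=
  match k, t with
  | [::], Tip => Node (Some a) Tip Tip Tip Tip
  | [::], Node _ t0 t1 t2 t3 => Node (Some a) t0 t1 t2 t3
  | q0 :: k', Tip => Node None (tadd k' a Tip) Tip Tip Tip
  | q1 :: k', Tip => Node None Tip (tadd k' a Tip) Tip Tip
  | qw :: k', Tip => Node None Tip Tip (tadd k' a Tip) Tip
  | qv :: k', Tip => Node None Tip Tip Tip (tadd k' a Tip)
  | q0 :: k', Node v t0 t1 t2 t3 => Node v (tadd k' a t0) t1 t2 t3
  | q1 :: k', Node v t0 t1 t2 t3 => Node v t0 (tadd k' a t1) t2 t3
  | qw :: k', Node v t0 t1 t2 t3 => Node v t0 t1 (tadd k' a t2) t3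
  | qv :: k', Node v t0 t1 t2 t3 => Node v t0 t1 t2 (tadd k' a t3)
  end.

Fixpoint telems A (t : trie A) : seq A :=
  match t with
  | Tip => [::]
  | Node v t0 t1 t2 t3 =>
    (if v is Some a then cons a else id)
      (telems t0 ++ (telems t1 ++ (telems t2 ++ telems t3)))
  end.

Fixpoint tall A (p : seq f4 -> A -> bool) (t : trie A) : bool :=
  match t with
  | Tip => true
  | Node v t0 t1 t2 t3 =>
    [&& if v is Some a then p [::] a else true,
        tall (fun k => p (q0 :: k)) t0, tall (fun k => p (q1 :: k)) t1,
        tall (fun k => p (qw :: k)) t2 & tall (fun k => p (qv :: k)) t3]
  end.

Lemma trie_comparable (A : eqType) : comparable (trie A).
Proof.
move=> t u; rewrite /decidable; decide equality; exact: eq_comparable.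
Qed.
HB.instance Definition _ (A : eqType) := hasDecEq.Build (trie A) (compareP (@trie_comparable A)).

Lemma tfind_tadd A (k k' : seq f4) (a : A) t :
  tfind k (tadd k' a t) = if k == k' then Some a else tfind k t.
Proof.
elim: k' k t => [|c' k' IH] [|c k] [|v t0 t1 t2 t3] //; rewrite ?eqseq_cons;
  by [case: c | case: c' | case: c' c => [] [] //=; rewrite IH].
Qed.

Lemma tallP A (p : seq f4 -> A -> bool) t k a :
  tall p t -> tfind k t = Some a -> p k a.
Proof.
elim: t p k => [|v t0 IH0 t1 IH1 t2 IH2 t3 IH3] p k //= /and5P[pv p0 p1 p2 p3].
case: k => [|[] k] //=; first by move=> vE; rewrite vE in pv.
- exact: (IH0 (fun k => p (q0 :: k))).
- exact: (IH1 (fun k => p (q1 :: k))).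
- exact: (IH2 (fun k => p (qw :: k))).
- exact: (IH3 (fun k => p (qv :: k))).
Qed.

Lemma mem_telems (A : eqType) (t : trie A) k a : tfind k t = Some a -> a \in telems t.
Proof.
elim: t k => [|v t0 IH0 t1 IH1 t2 IH2 t3 IH3] k //=.
have sub b s : b \in s -> b \in (if v is Some c then cons c else id) s.
  by case: v => //= c; rewrite inE => ->; rewrite orbT.
case: k => [|[] k] /=; first by move=> ->; rewrite inE eqxx.
all: by [move/IH0 => ?; apply: sub; rewrite !mem_cat; apply/or4P; constructor |
  move/IH1 => ?; apply: sub; rewrite !mem_cat; apply/or4P; constructor |
  move/IH2 => ?; apply: sub; rewrite !mem_cat; apply/or4P; constructor |
  move/IH3 => ?; apply: sub; rewrite !mem_cat; apply/or4P; constructor].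
Qed.

Lemma telemsP (A : eqType) (t : trie A) a :
  a \in telems t -> exists k, tfind k t = Some a.
Proof.
elim: t => [|v t0 IH0 t1 IH1 t2 IH2 t3 IH3] //= at_.
have : (v == Some a) || (a \in telems t0 ++ (telems t1 ++ (telems t2 ++ telems t3))).
  by case: v at_ => [b|] /=; rewrite ?inE ?orbF // => /orP[/eqP->|->]; rewrite ?eqxx ?orbT.
case/orP=> [/eqP->|]; first by exists [::].
rewrite !mem_cat => /or4P[/IH0|/IH1|/IH2|/IH3] [k kE].
- by exists (q0 :: k).
- by exists (q1 :: k).
- by exists (qw :: k).
- by exists (qv :: k).
Qed.

(** Insertion in a trie avoids the quadratic number of comparisons that [uniq] would make on
    thousands of keys. *)
Fixpoint nodup_keys (ks : seq (seq f4)) (seen : trie unit) : bool :=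
  if ks is k :: ks' then
    if tfind k seen is Some _ then false else nodup_keys ks' (tadd k tt seen)
  else true.

Lemma nodup_keysP ks : nodup_keys ks Tip -> uniq ks.
Proof.
suff H seen : nodup_keys ks seen ->
    uniq ks /\ {in ks, forall k, tfind k seen = None} by case/H.
elim: ks seen => //= k ks IH seen.
case kN: (tfind k seen) => //= /IH[-> H]; split.
  rewrite andbT; apply/negP=> /H; by rewrite tfind_tadd eqxx.
move=> k'; rewrite inE => /predU1P[-> //|/H]; rewrite tfind_tadd.
by case: (k' == k).
Qed.

Section Reach.

Variables (S : Type) (key : S -> seq f4) (fs : seq (S -> S)).

Definition reach_add (acc : seq S * trie S) (s : S) :=
  if tfind (key s) acc.2 is Some _ then acc else (s :: acc.1, tadd (key s) s acc.2).

Definition reach_step (acc : seq S * trie S) (s : S) :=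
  foldl (fun acc (f : S -> S) => reach_add acc (f s)) acc fs.

Fixpoint reach_loop (fuel : nat) (frontier : seq S) (seen : trie S) : trie S :=
  if fuel is n.+1 then
    match foldl reach_step ([::], seen) frontier with
    | ([::], sn) => sn
    | (fr, sn) => reach_loop n fr sn
    end
  else seen.

(** Breadth-first enumeration of an orbit. Exhaustiveness is not claimed: where a full orbit
    matters, the presence of the required elements is checked on the result, so the fuel may be any
    number that is large enough. *)
Definition reach (fuel : nat) (s : S) := reach_loop fuel [:: s] (tadd (key s) s Tip).

Variable R : S -> Prop.
Hypothesis R_step : forall s, R s -> foldr (fun f P => R (f s) /\ P) True fs.

Let inv (t : trie S) := forall k s, tfind k t = Some s -> R s /\ key s = k.
Let allR (l : seq S) := foldr (fun s P => R s /\ P) True l.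

Lemma reach_addP acc s : R s -> allR acc.1 /\ inv acc.2 ->
  allR (reach_add acc s).1 /\ inv (reach_add acc s).2.
Proof.
move=> Rs [aR it]; rewrite /reach_add; case: tfind => [_ //|] /=; split=> // k s'.
by rewrite tfind_tadd; case: eqP => [-> [<-]|_ /it].
Qed.

Lemma reach_stepP acc s : R s -> allR acc.1 /\ inv acc.2 ->
  allR (reach_step acc s).1 /\ inv (reach_step acc s).2.
Proof.
move=> Rs; have := R_step Rs; rewrite /reach_step.
elim: fs acc => //= f fs' IH acc [Rfs Rl] H; apply: IH => //; exact: reach_addP.
Qed.

Lemma reach_loopP n fr seen : allR fr -> inv seen -> inv (reach_loop n fr seen).
Proof.
elim: n fr seen => //= n IH fr seen Rfr iseen.
have : allR (foldl reach_step ([::], seen) fr).1 /\ inv (foldl reach_step ([::], seen) fr).2.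
  have : allR ([::] : seq S, seen).1 /\ inv ([::] : seq S, seen).2 by [].
  elim: fr ([::], seen) Rfr => //= s fr IHf acc [Rs Rl] H.
  by apply: IHf => //; apply: reach_stepP.
by case: foldl => [[|s l] sn] /= [Rl isn] //; apply: IH.
Qed.

(** Invariance of [R] under the steps is a conjunction folded over [fs], since functions have no
    decidable equality and membership in [fs] cannot be expressed with [\in]. *)
Lemma reachP n s0 k s : R s0 -> tfind k (reach n s0) = Some s -> R s /\ key s = k.
Proof.
move=> R0; apply: reach_loopP => // k' s'; rewrite tfind_tadd.
by case: eqP => [-> [<-]|].
Qed.

End Reach.

(** * Null octonions and the construction of the tables *)

Definition all4 (p : f4 -> bool) := [&& p q0, p q1, p qw & p qv].

Lemma all4P p : all4 p -> forall x, p x.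
Proof. by case/and4P=> ? ? ? ? []. Qed.

(** In an octonion of square 0 both diagonal entries are the square root of u.v, and taking square
    roots is the Frobenius map because squaring has order 2 on [f4]. This leaves six free
    coordinates, hence 4^6 octonions to run through. *)
Definition nul u1 u2 u3 v1 v2 v3 :=
  let s := ffrob (dot3 u1 u2 u3 v1 v2 v3) in Oct s u1 u2 u3 v1 v2 v3 s.

Definition all_null (p : oct -> bool) :=
  all4 (fun a => all4 (fun b => all4 (fun c => all4 (fun d => all4 (fun e => all4 (fun f =>
    p (nul a b c d e f))))))).

Lemma nullE x : omul8 x x = ozero ->
  exists u1 u2 u3 v1 v2 v3, x = nul u1 u2 u3 v1 v2 v3.
Proof.
case: x => a u1 u2 u3 v1 v2 v3 b [e1 _ _ _ _ _ _ e2].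
exists u1, u2, u3, v1, v2, v3; rewrite /nul.
have sq c d : fadd (fmul c c) d = q0 -> c = ffrob d by case: c d => [] [].
rewrite -(sq _ _ e1); suff -> : b = a by [].
rewrite (sq _ _ e1); apply: sq; rewrite -e2; rewrite /dot3; ring.
Qed.

Lemma all_nullP p : all_null p -> forall x, omul8 x x = ozero -> p x.
Proof.
move=> H x /nullE[u1 [u2 [u3 [v1 [v2 [v3 ->]]]]]].
exact: (all4P (all4P (all4P (all4P (all4P (all4P H u1) u2) u3) v1) v2) v3).
Qed.

Definition f4s := [:: q0; q1; qw; qv].

Definition nulls : seq oct :=
  flatten [seq flatten [seq flatten [seq flatten [seq flatten [seq [seq nul a b c d e f
   | f <- f4s] | e <- f4s] | d <- f4s] | c <- f4s] | b <- f4s] | a <- f4s].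

(* The lines through [p /\ q] in the quad on the point [p] of the hexagon. *)
Definition pencil_search (p q : oct) : seq (lab * lab) :=
  let c := head ozero
    [seq c <- nulls | oeqb (omul8 p c) ozero && oeqb (omul8 q c) p] in
  let l t := canon (Lab p (oadd c (oscale t q))) in
  let pr t t' := [:: (l t, l t'); (l t', l t)] in
  pr q0 q1 ++ pr qw qv.

Definition nbrs_search (l : lab) : seq (lab * lab) :=
  let: Lab a b := l in
  let s t := canon (Lab a (oscale t b)) in
  [:: (s qw, s qv); (s qv, s qw)] ++ pencil_search b a ++
  flatten [seq pencil_search (oadd a (oscale t b)) b | t <- f4s].

Definition u1 := Oct q0 q1 q0 q0 q0 q0 q0 q0.
Definition u2 := Oct q0 q0 q1 q0 q0 q0 q0 q0.
Definition u3 := Oct q0 q0 q0 q1 q0 q0 q0 q0.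
Definition v1 := Oct q0 q0 q0 q0 q1 q0 q0 q0.
Definition v2 := Oct q0 q0 q0 q0 q0 q1 q0 q0.
Definition v3 := Oct q0 q0 q0 q0 q0 q0 q1 q0.

Definition x0 := Lab u1 v3.
(** Chosen so that [kapf] and this root element act transitively on the labels and on the nonzero
    null octonions, as [pts_reached_check] and [null_reached_check] confirm. *)
Definition les :=
  Lab (Oct qw q1 q0 q0 qv q0 q0 qw) (Oct q0 q0 q1 q0 q0 q0 qv q0).
Definition kapf x :=
  let: Oct a u1 u2 u3 v1 v2 v3 b := x in Oct b v3 v1 v2 u3 u1 u2 a.

Definition gens2 := [:: kapf; epsf les].

(* An entry lists, for the point with label [l], the pairs [(m, n)] such that
   [{l, m, n}] is a line; the spread line comes first.  The last component is
   the distance from [x0]. *)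
Inductive entry := Ent (l : lab) (nb : seq (lab * lab)) (d : nat).

Definition eself e := let: Ent l _ _ := e in l.
Definition enbrs e := let: Ent _ nb _ := e in nb.
Definition edist e := let: Ent _ _ d := e in d.

Definition entry_eqb e e' :=
  [&& eself e == eself e', enbrs e == enbrs e' & edist e == edist e'].
Lemma entry_eqbP : Equality.axiom entry_eqb.
Proof.
move=> [l nb d] [l' nb' d']; apply: (iffP and3P) => [[/= /eqP-> /eqP-> /eqP->]|[-> -> ->]] //.
Qed.
HB.instance Definition _ := hasDecEq.Build entry entry_eqbP.

(** The neighbours are searched for at [x0] alone and carried along the orbit by the generators. The
    distance 0 is a placeholder. *)
Definition T_search : trie entry :=
  let e0 := Ent x0 (nbrs_search x0) 0 in
  reach (fun e => lkey (eself e))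
    [seq (fun e => Ent (lact f (eself e))
      [seq (lact f m.1, lact f m.2) | m <- enbrs e] 0) | f <- gens2] 100 e0.

Definition nbrs_in (t : trie entry) (l : lab) :=
  if tfind (lkey l) t is Some e then enbrs e else [::].

Fixpoint layers (t : trie entry) (fuel d : nat) (frontier : seq lab)
    (seen : trie nat) : trie nat :=
  if fuel is n.+1 then
    let step acc l := foldl (fun (acc : seq lab * trie nat) (m : lab * lab) =>
       if tfind (lkey m.1) acc.2 is Some _ then acc
       else (m.1 :: acc.1, tadd (lkey m.1) d acc.2)) acc (nbrs_in t l) in
    let: (fr, sn) := foldl step ([::], seen) frontier in
    if fr is [::] then sn else layers t n d.+1 fr sn
  else seen.

Definition dist_search (t : trie entry) (l : lab) : trie nat :=
  layers t 9 1 [:: l] (tadd (lkey l) 0 Tip).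

(** A literal table, evaluated once. The default distance 9 exceeds the diameter, so a label missed
    by the distance search would make [dist0_check] fail. *)
Definition T : trie entry :=
  Eval vm_compute in
  let t := T_search in
  let dt := dist_search t x0 in
  foldl (fun t' e =>
     let l := eself e in
     tadd (lkey l) (Ent l (enbrs e) (odflt 9 (tfind (lkey l) dt))) t')
    Tip (telems t).

Definition pts : seq entry := telems T.
Definition nbrsT (l : lab) : seq (lab * lab) := nbrs_in T l.
Definition dist0 (l : lab) : nat := if tfind (lkey l) T is Some e then edist e else 9.
Definition inX (l : lab) : bool := if tfind (lkey l) T is Some _ then true else false.

Ltac compute_bool := vm_cast_no_check (erefl true).

Fixpoint keqb (k k' : seq f4) : bool :=
  match k, k' with
  | [::], [::] => true
  | c :: k, c' :: k' => feqb c c' && keqb k k'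
  | _, _ => false
  end.

Lemma keqbP k k' : keqb k k' -> k = k'.
Proof. by elim: k k' => [|c k IH] [|c' k'] //= /andP[/feqbP-> /IH->]. Qed.

Definition isome A (o : option A) := if o is Some _ then true else false.

(** * Certificates for the group and the near octagon *)

Lemma T_keys : tall (fun k e => keqb k (lkey (eself e))) T.
Proof. compute_bool. Qed.

Lemma size_pts : size pts = 4095.
Proof. apply/eqP; compute_bool. Qed.

(** Two labels might define the same root element. Comparing the images of six null octonions rules
    this out. *)
Definition sig (l : lab) : seq f4 :=
  uvs (epsf l u1) ++ (uvs (epsf l u2) ++ (uvs (epsf l u3) ++
  (uvs (epsf l v1) ++ (uvs (epsf l v2) ++ uvs (epsf l v3))))).

Lemma nodup_sig : nodup_keys [seq sig (eself e) | e <- pts] Tip.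
Proof. compute_bool. Qed.

Definition peqb (m n : lab * lab) := leqb m.1 n.1 && leqb m.2 n.2.

Definition act_table (f : oct -> oct) : trie lab :=
  foldl (fun t e => let l := eself e in tadd (lkey l) (lact f l) t) Tip pts.

(** A line through a point is listed as two ordered pairs: [take 2] gives the spread line and
    [drop 2] the ten other lines. The two kinds are tested separately because their normalizer
    indices differ. *)
Definition preserves_nbrs (f : oct -> oct) : bool :=
  let tb := act_table f in
  let img l := tfind (lkey l) tb in
  all (fun e =>
    if img (eself e) is Some l' then
      if tfind (lkey l') T is Some e' then
        let ok nb' m := if img m.1 is Some m1 then if img m.2 is Some m2 then
                          has (peqb (m1, m2)) nb' else false else false in
        all (ok (take 2 (enbrs e'))) (take 2 (enbrs e)) &&
        all (ok (drop 2 (enbrs e'))) (drop 2 (enbrs e))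
      else false
    else false) pts.

Lemma kapf_nbrs : preserves_nbrs kapf. Proof. compute_bool. Qed.
Lemma les_nbrs : preserves_nbrs (epsf les). Proof. compute_bool. Qed.
Lemma x0_nbrs : preserves_nbrs (epsf x0). Proof. compute_bool. Qed.
Lemma ofrob_nbrs : preserves_nbrs ofrob. Proof. compute_bool. Qed.

Lemma mulcheck_kapf : mulcheck kapf. Proof. compute_bool. Qed.
Lemma mulcheck_les : mulcheck (epsf les). Proof. compute_bool. Qed.
Lemma mulcheck_x0 : mulcheck (epsf x0). Proof. compute_bool. Qed.

Definition x0_orbit := reach lkey [seq lact f | f <- gens2] 100 x0.

(** The [let] has the orbit computed once instead of once per entry. The form recurs in later
    certificates, and equations such as [x0_orbitE] keep the orbit accessible once it is opaque. *)
Lemma pts_reached_check :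
  (let r := x0_orbit in all (fun e => isome (tfind (lkey (eself e)) r)) pts) = true.
Proof. compute_bool. Qed.

Lemma x0_orbitE : x0_orbit = reach lkey [seq lact f | f <- gens2] 100 x0.
Proof. by rewrite /x0_orbit. Qed.

Opaque T pts x0_orbit.

Lemma pts_reached e : e \in pts -> isome (tfind (lkey (eself e)) x0_orbit).
Proof. by move: e; apply/allP/pts_reached_check. Qed.

Definition u1_orbit := reach okey gens2 100 u1.

Lemma null_reached_check :
  (let r := u1_orbit in all_null (fun x => oeqb x ozero || isome (tfind (okey x) r))) = true.
Proof. compute_bool. Qed.

Lemma u1_orbitE : u1_orbit = reach okey gens2 100 u1.
Proof. by rewrite /u1_orbit. Qed.

Opaque u1_orbit.

Lemma null_reached x : omul8 x x = ozero -> x != ozero -> isome (tfind (okey x) u1_orbit).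
Proof.
move=> x2 /eqP xn; have := all_nullP null_reached_check x2.
by case: oeqbP => [/xn []|_]; exact.
Qed.

(** Root elements for a stabilizer chain along [u1], [v1], [u2], [u3]: those of [sls1] fix [u1],
    those of [sls2] also [v1], those of [sls3] also [u2]. The other four basis octonions are
    products of these. *)
Definition sl1 := Lab u2 (oscale qw v3).
Definition sl2 := Lab u3 v2.
Definition sl3 := Lab (oadd u1 v2) (Oct q1 q0 q0 q1 q0 q0 q1 q1).
Definition sl4 := Lab u2 v3.

Definition fixes (ws : seq oct) (ls : seq lab) :=
  all (fun l => all (fun w => oeqb (epsf l w) w) ws) ls.

Definition sls1 := [:: sl1; sl2; sl3; sl4].
Definition sls2 := [:: sl1; sl2; sl4].
Definition sls3 := [:: sl1; sl4].

Lemma sls1_pts : all inX sls1. Proof. compute_bool. Qed.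
Lemma sls2_pts : all inX sls2. Proof. compute_bool. Qed.
Lemma sls3_pts : all inX sls3. Proof. compute_bool. Qed.
Lemma sls1_fix : fixes [:: u1] sls1. Proof. compute_bool. Qed.
Lemma sls2_fix : fixes [:: v1; u1] sls2. Proof. compute_bool. Qed.
Lemma sls3_fix : fixes [:: u2; v1; u1] sls3. Proof. compute_bool. Qed.

Definition v1_orbit := reach okey [seq epsf l | l <- sls1] 100 v1.
Definition u2_orbit := reach okey [seq epsf l | l <- sls2] 100 u2.
Definition u3_orbit := reach okey [seq epsf l | l <- sls3] 100 u3.
Definition u1v1 := omul8 u1 v1.

(** The images of [v1] under the stabilizer of [u1] are null and satisfy u1 x + x u1 = 1; the
    solutions turn out to form one orbit. *)
Lemma v1_reached_check :
  (let r := v1_orbit in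
  all_null (fun x => oeqb (oadd (omul8 u1 x) (omul8 x u1)) oone ==>
                     isome (tfind (okey x) r))) = true.
Proof. compute_bool. Qed.

Lemma v1_orbitE : v1_orbit = reach okey [seq epsf l | l <- sls1] 100 v1.
Proof. by rewrite /v1_orbit. Qed.

Opaque v1_orbit.

Lemma v1_reached x : omul8 x x = ozero -> oadd (omul8 u1 x) (omul8 x u1) = oone ->
  isome (tfind (okey x) v1_orbit).
Proof. by move=> x2 /oeqbP x1; have /implyP/(_ x1) := all_nullP v1_reached_check x2. Qed.

(** For the idempotent e = u1 v1, fixed at this stage, ex = x and xe = 0 say that x lies in the
    upper right block. *)
Lemma u2_reached_check :
  (let r := u2_orbit in let e := u1v1 in
  all_null (fun x => [&& oeqb (omul8 e x) x, oeqb (omul8 x e) ozero,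
                      oeqb (oadd (omul8 v1 x) (omul8 x v1)) ozero & ~~ oeqb x ozero] ==>
                     isome (tfind (okey x) r))) = true.
Proof. compute_bool. Qed.

Lemma u2_orbitE : u2_orbit = reach okey [seq epsf l | l <- sls2] 100 u2.
Proof. by rewrite /u2_orbit. Qed.

Opaque u2_orbit.

Lemma u2_reached x : omul8 x x = ozero -> omul8 u1v1 x = x -> omul8 x u1v1 = ozero ->
  oadd (omul8 v1 x) (omul8 x v1) = ozero -> x != ozero -> isome (tfind (okey x) u2_orbit).
Proof.
move=> x2 /oeqbP e1 /oeqbP e2 /oeqbP e3 x_neq0.
have /implyP-> // := all_nullP u2_reached_check x2.
by apply/and4P; split=> //; apply/oeqbP; apply/eqP.
Qed.

Lemma u3_reached_check :
  (let r := u3_orbit in let e := u1v1 in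
  all_null (fun x => [&& oeqb (omul8 e x) x, oeqb (omul8 x e) ozero & oeqb (omul8 u2 x) v1] ==>
                     isome (tfind (okey x) r))) = true.
Proof. compute_bool. Qed.

Lemma u3_orbitE : u3_orbit = reach okey [seq epsf l | l <- sls3] 100 u3.
Proof. by rewrite /u3_orbit. Qed.

Opaque u3_orbit.

Lemma u3_reached x : omul8 x x = ozero -> omul8 u1v1 x = x -> omul8 x u1v1 = ozero ->
  omul8 u2 x = v1 -> isome (tfind (okey x) u3_orbit).
Proof.
move=> x2 /oeqbP e1 /oeqbP e2 /oeqbP e3.
have /implyP-> // := all_nullP u3_reached_check x2.
by apply/and3P.
Qed.

Lemma x0_products :
  all (fun m => agree (fun x => epsf m.1 (epsf x0 x)) (epsf m.2)) (nbrsT x0).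
Proof. compute_bool. Qed.

Definition commute_with (f h : oct -> oct) := agree (fun x => f (h x)) (fun x => h (f x)).

Definition has_fst (l : lab) (nb : seq (lab * lab)) := has (fun m => leqb m.1 l) nb.

(* The line joining two collinear points is unique, and collinearity is symmetric. *)
Lemma lines_check : all (fun e =>
  [&& eqn (size (enbrs e)) 22,
      nodup_keys (lkey (eself e) :: [seq lkey m.1 | m <- enbrs e]) Tip,
      all (fun m => has (peqb (m.2, m.1)) (take 2 (enbrs e)) &&
                    has (peqb (eself e, m.2)) (take 2 (nbrsT m.1))) (take 2 (enbrs e)) &
      all (fun m => has (peqb (m.2, m.1)) (drop 2 (enbrs e)) &&
                    has (peqb (eself e, m.2)) (drop 2 (nbrsT m.1))) (drop 2 (enbrs e))]) pts.
Proof. compute_bool. Qed.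

(** The distances from a point to the three points of a line are k, k + 1, k + 1 in some order. *)
Definition near3 (d d1 d2 : nat) :=
  [|| eqn d1 d.+1 && eqn d2 d.+1, eqn d d1.+1 && eqn d2 d | eqn d d2.+1 && eqn d1 d].

(** A certificate for distances: a function that changes by at most 1 between collinear points,
    vanishes only at [b] and can be lowered by 1 at every other point is the distance from [b]. *)
Definition potential (D : lab -> nat) (b : lab) :=
  eqn (D b) 0 && all (fun e =>
   let l := eself e in let d := D l in
   [&& all (fun m => near3 d (D m.1) (D m.2)) (enbrs e),
       leq d 4 &
       if d is 0 then leqb l b else has (fun m => eqn d (D m.1).+1) (enbrs e)]) pts.

Lemma dist0_check : potential dist0 x0.
Proof. compute_bool. Qed.

(* The stabilizer of [x0]: [h1], [h2], [h3] generate a group A_5 that also fixes [x1]. *)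
Definition e1 := Oct q1 q0 q0 q0 q0 q0 q0 q0.
Definition e8 := Oct q0 q0 q0 q0 q0 q0 q0 q1.
Definition h1 := linf e8 v3 v2 v1 u3 u2 u1 e1.
Definition h2 := linf e8 (oscale qw v3) (oscale qw v2) (oscale qw v1)
  (oscale qv u3) (oscale qv u2) (oscale qv u1) e1.
Definition h3 := linf (oadd e1 v2) u1 (Oct q1 q0 q1 q0 q0 q1 q0 q1) u3
  (oadd u3 v1) v2 (oadd u1 v3) (oadd v2 e8).
Definition x1 := Lab u3 (oscale qw v1).
Definition lq := Lab u1 (oscale qw v2).
Definition A5gens := [:: h1; h2; h3].
Definition stabx0 := [:: h1; h2; h3; ofrob; epsf lq].

Lemma A5gens_check : [&& mulcheck h1, mulcheck h2, mulcheck h3,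
  agree (fun x => h1 (h1 x)) id, agree (fun x => h2 (h2 x)) id & agree (fun x => h3 (h3 x)) id].
Proof. compute_bool. Qed.

Lemma stabx0_fix : inX lq && all (fun f => leqb (lact f x0) x0) stabx0.
Proof. compute_bool. Qed.

Lemma A5gens_fix : all (fun f => leqb (lact f x1) x1) A5gens.
Proof. compute_bool. Qed.

Definition x1_orbit := reach lkey [seq lact f | f <- stabx0] 100 x1.
Definition m20 := Lab u1 v2.
Definition m20_orbit := reach lkey [seq lact f | f <- stabx0] 100 m20.
Definition lq_orbit := reach lkey [seq lact f | f <- stabx0] 100 lq.

Lemma x1_reached_check :
  (let r := x1_orbit in all (fun e => eqn (edist e) 4 ==> isome (tfind (lkey (eself e)) r)) pts)
  = true.
Proof. compute_bool. Qed.

Lemma m20_reached_check :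
  (let r := m20_orbit in all (fun m => isome (tfind (lkey m.1) r)) (drop 2 (nbrsT x0))) = true.
Proof. compute_bool. Qed.

(** The root elements that commute with [x0] without being collinear with it lie in one orbit of 40
    elements under its centralizer. This size forces a normalizer index of at least 1365 * 20,
    beyond the two prescribed ones. *)
Lemma commuting_check :
  (let r := lq_orbit in all (fun e => let l := eself e in
     commute_with (epsf x0) (epsf l) ==>
       [|| leqb l x0, has_fst l (nbrsT x0) | isome (tfind (lkey l) r)]) pts) = true.
Proof. compute_bool. Qed.

Lemma lq_orbit_size :
  (let s := telems lq_orbit in
   eqn (size s) 40 && nodup_keys [seq sig l | l <- s] Tip) = true.
Proof. compute_bool. Qed.

(* Involutions commuting with [x0], pencil by pencil. *)
Definition Klist : seq lab := Eval vm_compute in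
  let pencil p := [seq canon (Lab p c) | c <- nulls & oeqb (omul8 p c) ozero
     && ~~ isome (tfind (okey c) (foldl (fun t x => tadd (okey x) tt t) Tip
                    [seq oscale k p | k <- f4s]))] in
  undup (flatten [seq pencil p | p <- u1 :: [seq oadd v3 (oscale k u1) | k <- f4s]]).

(** Each new involution permutes by conjugation those listed before it, hence normalizes the 2-group
    they generate; adjoining it gives a 2-group again. *)
Fixpoint chain_check (prefix rest : seq lab) : bool :=
  if rest is l :: rest' then
    all (fun m => has (leqb (lact (epsf l) m)) prefix) prefix &&
    chain_check (l :: prefix) rest'
  else true.

Lemma Klist_check : [&& all inX Klist, chain_check [::] Klist,
  all (fun m => has (leqb (lact ofrob m)) Klist) Klist &
  all (fun m => has (leqb (lact (epsf sl4) m)) Klist) Klist].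
Proof. compute_bool. Qed.

Lemma Klist_chain : chain_check [::] Klist.
Proof. by case/and4P: Klist_check. Qed.

Lemma Klist_ofrob l : l \in Klist -> lact ofrob l \in Klist.
Proof. by case/and4P: Klist_check => _ _ /allP H _ /H /hasP[n nK /leqbP->]. Qed.

Lemma Klist_sl4 l : l \in Klist -> lact (epsf sl4) l \in Klist.
Proof. by case/and4P: Klist_check => _ _ _ /allP H /H /hasP[n nK /leqbP->]. Qed.

Opaque Klist chain_check.

(* The linear map commuting with [epsf (u1, v2)] and [epsf (u1, v3)] and sending [v1] to [w],
   if there is one. *)
Definition lin_of (w : oct) : oct -> oct :=
  let D b x := omul8 u1 (omul8 b x) in
  let w2 := D v2 w in let w3 := D v3 w in
  let w1' := omul8 w2 w3 in let w2' := omul8 w3 w in let w3' := omul8 w w2 in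
  linf (omul8 w1' w) w1' w2' w3' w w2 w3 (omul8 w w1').

Definition lk := canon (Lab (oadd u1 (oscale qv v3)) (nul q1 qw q0 q0 q1 qw)).

Definition lin_unital (w : oct) := oeqb (oadd (lin_of w e1) (lin_of w e8)) oone.

(** An element of G commuting with the root elements of ([u1], [v2]), [x0] and [lq] is determined by
    the image of [v1], so a centralizer is found by running through all null octonions. The nested
    conditionals skip the costlier tests for most candidates. *)
Lemma lin_of_central_check :
  all_null (fun w => if oeqb (ofrob w) w then if oeqb (epsf sl4 w) w then
     if lin_unital w then if commute_with (lin_of w) (epsf lk) then
       oeqb w v1 || oeqb w (epsf x0 v1)
     else true else true else true else true).
Proof. compute_bool. Qed.

Lemma lin_of_central w : omul8 w w = ozero -> ofrob w = w -> epsf sl4 w = w ->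
  lin_unital w -> commute_with (lin_of w) (epsf lk) -> w = v1 \/ w = epsf x0 v1.
Proof.
move=> w2 /oeqbP e1 /oeqbP e2 e3 e4; have := all_nullP lin_of_central_check w2.
by rewrite e1 e2 e3 e4 => /orP[] /oeqbP; [left | right].
Qed.

Lemma Klist_mem : all (fun m => has (leqb m) Klist)
  [:: Lab u1 v2; x0; Lab u1 (oscale qw v2); lk].
Proof. compute_bool. Qed.

Lemma Klist_memP l : l \in [:: Lab u1 v2; x0; Lab u1 (oscale qw v2); lk] -> l \in Klist.
Proof. by move/(allP Klist_mem)/hasP => [k kK /leqbP->]. Qed.

(** Commuting with these as well leaves [v1] as the only possible image of [v1], which makes the
    action on the points faithful. *)
Definition flist := [:: sl4; les; sl1; sl2; sl3; x0].

Lemma lin_of_trivial_check :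
  all inX flist &&
  all_null (fun w => if lin_unital w then
     if all (fun l => commute_with (lin_of w) (epsf l)) flist then oeqb w v1 else true
  else true).
Proof. compute_bool. Qed.

Lemma lin_of_trivial w : omul8 w w = ozero -> lin_unital w ->
  {in flist, forall l, commute_with (lin_of w) (epsf l)} -> w = v1.
Proof.
move=> w2 e1 /allP e2; have /andP[_ H] := lin_of_trivial_check.
by have := all_nullP H w2; rewrite e1 e2 => /oeqbP.
Qed.

Lemma flist_pts : all inX flist. Proof. by case/andP: lin_of_trivial_check. Qed.

Lemma Klist_fix : [&& leqb (lact ofrob sl4) sl4, oeqb (ofrob v1) v1, oeqb (epsf sl4 v1) v1 &
  all (fun l => commute_with (epsf x0) (epsf l)) [:: Lab u1 v2; Lab u1 (oscale qw v2)]].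
Proof. compute_bool. Qed.

Lemma x1_orbitE : x1_orbit = reach lkey [seq lact f | f <- stabx0] 100 x1.
Proof. by rewrite /x1_orbit. Qed.
Lemma m20_orbitE : m20_orbit = reach lkey [seq lact f | f <- stabx0] 100 m20.
Proof. by rewrite /m20_orbit. Qed.
Lemma lq_orbitE : lq_orbit = reach lkey [seq lact f | f <- stabx0] 100 lq.
Proof. by rewrite /lq_orbit. Qed.

Opaque T pts lin_of x1_orbit m20_orbit lq_orbit.

Lemma x1_reached e : e \in pts -> edist e = 4 -> isome (tfind (lkey (eself e)) x1_orbit).
Proof. by move=> ep e4; have /implyP-> := allP x1_reached_check e ep; rewrite // e4. Qed.

Lemma m20_reached m : m \in drop 2 (nbrsT x0) -> isome (tfind (lkey m.1) m20_orbit).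
Proof. by move: m; apply/allP/m20_reached_check. Qed.

Lemma commuting_reached e : e \in pts -> commute_with (epsf x0) (epsf (eself e)) ->
  [|| eself e == x0, has_fst (eself e) (nbrsT x0) | isome (tfind (lkey (eself e)) lq_orbit)].
Proof.
by move=> ep ee; have /implyP/(_ ee) := allP commuting_check e ep.
Qed.

Opaque T pts.

(** * Certificates for rigidity *)

(* Five neighbours of [x1] on which the stabilizer of [x0] and [x1] acts as A_5. *)
Definition N5 : seq lab := Eval vm_compute in
  [seq m.1 | m <- nbrsT x1 & eqn (dist0 m.1) 3 &&
     eqn (count (fun k => eqn (dist0 k.1) 2) (nbrsT m.1)) 3].

Definition n1 := Eval vm_compute in nth x0 N5 0.
Definition n2 := Eval vm_compute in nth x0 N5 1.
Definition n3 := Eval vm_compute in nth x0 N5 2.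

Lemma N5_check : all (fun m => (eqn (dist0 m.1) 3 &&
     eqn (count (fun k => eqn (dist0 k.1) 2) (nbrsT m.1)) 3) ==> has (leqb m.1) N5) (nbrsT x1)
  && all (fun m => has_fst m (nbrsT x1) &&  eqn (dist0 m) 3 &&
      eqn (count (fun k => eqn (dist0 k.1) 2) (nbrsT m)) 3) [:: n1; n2; n3].
Proof. compute_bool. Qed.

Definition lkey3 (t : lab * lab * lab) := lkey t.1.1 ++ (lkey t.1.2 ++ lkey t.2).
Definition lact3 f (t : lab * lab * lab) := (lact f t.1.1, lact f t.1.2, lact f t.2).

Definition triple_orbit := reach lkey3 [seq lact3 f | f <- A5gens] 100 (n1, n2, n3).

(** A_5 is transitive on the ordered triples of distinct elements among five, so an automorphism can
    be corrected to fix three chosen neighbours. *)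
Lemma triple_orbit_check :
  (let r := triple_orbit in
   all (fun a => all (fun b => all (fun c =>
     [|| leqb a b, leqb a c, leqb b c | isome (tfind (lkey3 (a, b, c)) r)]) N5) N5) N5) = true.
Proof. compute_bool. Qed.

Lemma triple_orbitE :
  triple_orbit = reach lkey3 [seq lact3 f | f <- A5gens] 100 (n1, n2, n3).
Proof. by rewrite /triple_orbit. Qed.

Definition tab x := dist_search T x.
Definition tab1 := tab x1.
Definition tab2 := tab n1.
Definition tab3 := tab n2.
Definition tab4 := tab n3.

Definition dtab (t : trie nat) (l : lab) : nat := odflt 9 (tfind (lkey l) t).

Lemma tab1_check : (let t := tab1 in potential (dtab t) x1) = true.
Proof. compute_bool. Qed.
Lemma tab2_check : (let t := tab2 in potential (dtab t) n1) = true.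
Proof. compute_bool. Qed.
Lemma tab3_check : (let t := tab3 in potential (dtab t) n2) = true.
Proof. compute_bool. Qed.
Lemma tab4_check : (let t := tab4 in potential (dtab t) n3) = true.
Proof. compute_bool. Qed.

(** Distances 0 and 4 share a code. Confusing profiles is harmless: it only makes fewer neighbours
    distinguishable. *)
Definition code4 (d : nat) : f4 :=
  match d with 1 => q1 | 2 => qw | 3 => qv | _ => q0 end.

Definition profile (ts : seq (lab -> nat)) (l : lab) : seq f4 := [seq code4 (t l) | t <- ts].

(** A conditional rather than [&&], since call-by-value evaluation computes both arguments of
    [andb]. *)
Fixpoint eqf (s t : seq f4) : bool :=
  match s, t with
  | a :: s', b :: t' => if feqb a b then eqf s' t' else false
  | [::], [::] => true
  | _, _ => false
  end.

Definition rigid_nbrs (ts : seq (lab -> nat)) (l : lab) : seq lab :=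
  let nb := [seq (m.1, profile ts m.1) | m <- nbrsT l] in
  [seq m.1 | m <- nb & all (fun m' => if eqf m.2 m'.2 then leqb m.1 m'.1 else true) nb].

Definition rigid_table ts := foldl (fun t e =>
  tadd (lkey (eself e)) (rigid_nbrs ts (eself e)) t) Tip pts.

(** The constant maps put the base points into the closure; the others adjoin the neighbours singled
    out by their profiles, at most 22 of them. Past the end of the list [nth] returns [l] itself, so
    every step sends fixed points to fixed points. *)
Definition rigid_steps (t : trie (seq lab)) (base : seq lab) : seq (lab -> lab) :=
  [seq (fun=> b) | b <- base] ++
  [seq (fun l => nth l (odflt [::] (tfind (lkey l) t)) i) | i <- iota 0 22].

Definition base5 := [:: x0; x1; n1; n2; n3].
Definition ts5 := [:: dist0; dtab tab1; dtab tab2; dtab tab3; dtab tab4].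
Definition rigid5 := rigid_table ts5.
Definition closure5 := let t := rigid5 in reach lkey (rigid_steps t base5) 100 x0.
(** A point at distance 4 already shown to be fixed by the first closure. Its distances form a sixth
    table, with which the second closure reaches all points. *)
Definition n4 := Eval vm_compute in
  let r := closure5 in
  eself (nth (Ent x0 [::] 0) [seq e <- pts | isome (tfind (lkey (eself e)) r) && eqn (edist e) 4] 2).
Lemma n4_closure : isome (tfind (lkey n4) closure5).
Proof. compute_bool. Qed.

Definition tab5 := tab n4.
Lemma tab5_check : (let t := tab5 in potential (dtab t) n4) = true.
Proof. compute_bool. Qed.
Definition ts6 := rcons ts5 (dtab tab5).
Definition rigid6 := rigid_table ts6.
Definition closure6 := let t := rigid6 in reach lkey (rigid_steps t (rcons base5 n4)) 100 x0.
Lemma closure6_check :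
  (let r := closure6 in all (fun e => isome (tfind (lkey (eself e)) r)) pts) = true.
Proof. compute_bool. Qed.

Lemma closure5E : closure5 = reach lkey (rigid_steps (rigid_table ts5) base5) 100 x0.
Proof. by rewrite /closure5 /rigid5. Qed.
Lemma closure6E :
  closure6 = reach lkey (rigid_steps (rigid_table ts6) (rcons base5 n4)) 100 x0.
Proof. by rewrite /closure6 /rigid6. Qed.
Lemma tabs_check : [/\ potential (dtab tab1) x1, potential (dtab tab2) n1,
  potential (dtab tab3) n2, potential (dtab tab4) n3 & potential (dtab tab5) n4].
Proof.
by split; [exact: tab1_check | exact: tab2_check | exact: tab3_check | exact: tab4_check |
  exact: tab5_check].
Qed.
Lemma base_pts : all inX (rcons base5 n4).
Proof. compute_bool. Qed.

Lemma rigid_nbrsP ts l m : m \in rigid_nbrs ts l ->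
  {in nbrsT l, forall k, profile ts m = profile ts k.1 -> m = k.1} /\
  exists2 k, k \in nbrsT l & m = k.1.
Proof.
have eqfP s t : s = t -> eqf s t by move=> ->; elim: t => //= a t; case: a.
case/mapP=> k; rewrite mem_filter => /andP[/allP A /mapP[k1 k1l kE]] ->.
split=> [k' k'l e|]; last by exists k1; rewrite ?kE.
have /A /= := map_f (fun m => (m.1, profile ts m.1)) k'l.
by rewrite eqfP => [/leqbP //|]; rewrite -e kE.
Qed.

Lemma tabulateP (E : eqType) (A : Type) (key : E -> seq f4) (v : E -> A) es k a :
  tfind k (foldl (fun t e => tadd (key e) (v e) t) Tip es) = Some a ->
  exists2 e, e \in es & k = key e /\ a = v e.
Proof.
have: tfind k (Tip : trie A) = Some a -> exists2 e, e \in es & k = key e /\ a = v e by [].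
have: {subset es <= es} by [].
elim: {1 4}es Tip => //= e s IH t sub Ht.
apply: IH => [m ms|]; first by apply: sub; rewrite inE ms orbT.
rewrite tfind_tadd; case: eqP => [-> [<-]|_ /Ht //].
by exists e; first by apply: sub; rewrite mem_head.
Qed.

Lemma rigid_tableP ts k s : tfind k (rigid_table ts) = Some s ->
  exists2 e, e \in pts & k = lkey (eself e) /\ s = rigid_nbrs ts (eself e).
Proof. exact: tabulateP. Qed.

Lemma size_lkey l : size (lkey l) = 16.
Proof. by case: l => [[????????] [????????]]. Qed.

Lemma lkey3_inj : injective lkey3.
Proof.
move=> [[a b] c] [[a' b'] c'] /eqP; rewrite /lkey3 /=.
rewrite !eqseq_cat ?size_lkey // => /and3P[/eqP e1 /eqP e2 /eqP e3].
by rewrite (lkey_inj e1) (lkey_inj e2) (lkey_inj e3).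
Qed.

Opaque triple_orbit.

Lemma triple_orbit_reached a b c : a \in N5 -> b \in N5 -> c \in N5 ->
  a != b -> a != c -> b != c -> isome (tfind (lkey3 (a, b, c)) triple_orbit).
Proof.
move=> aN bN cN /negbTE ab /negbTE ac /negbTE bc.
have := allP (allP (allP triple_orbit_check a aN) b bN) c cN.
by rewrite -[leqb a b]/(a == b) -[leqb a c]/(a == c) -[leqb b c]/(b == c) ab ac bc.
Qed.

Opaque closure5 closure6 tab rigid5 rigid6 tab1 tab2 tab3 tab4 tab5.

Opaque T pts.

(** * The Hall-Janko group on 100 points *)

(* The 100 points are encoded by words of length 4 over [f4], and a permutation of the points
   by the trie of its values. *)
Definition codes : seq (seq f4) :=
  Eval vm_compute in take 100 [seq a :: s | a <- f4s, s <- [seq b :: t | b <- f4s,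
    t <- [seq c :: u | c <- f4s, u <- [seq [:: d] | d <- f4s]]]].

Definition ptab := trie (seq f4).
Definition papp (t : ptab) (c : seq f4) := odflt [::] (tfind c t).
Definition ctab (F : seq f4 -> seq f4) : ptab := foldl (fun t c => tadd c (F c) t) Tip codes.
Definition tcomp (t u : ptab) := ctab (fun c => papp u (papp t c)).
Definition tconj (t d d' : ptab) := ctab (fun c => papp d (papp t (papp d' c))).
Definition teqb (t u : ptab) := all (fun c => eqf (papp t c) (papp u c)) codes.
Definition tcommb (t u : ptab) := all (fun c => eqf (papp t (papp u c)) (papp u (papp t c))) codes.
Definition idtab := ctab id.

(** Reads the cycles off the bodies of [J2_a] and [J2_b], so that the tables are built from the same
    data. *)
Ltac bigop_range t :=
  let u := eval cbv delta [J2_a J2_b] in t in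
  match u with context [@bigop.body _ _ _ ?r _] => exact r end.
Definition a_cycles : seq (seq nat) := ltac:(bigop_range J2_a).
Definition b_cycles : seq (seq nat) := ltac:(bigop_range J2_b).

Definition swapn (u v x : nat) := if eqn x u then v else if eqn x v then u else x.
Definition cycle_eval (c : seq nat) x := foldl (fun x y => swapn (head 1 c).-1 y.-1 x) x (behead c).
Definition cycles_eval cs x := foldl (fun x c => cycle_eval c x) x cs.

Definition tA := ctab (fun c => nth [::] codes (cycles_eval a_cycles (find (eqf c) codes))).
Definition tB := ctab (fun c => nth [::] codes (cycles_eval b_cycles (find (eqf c) codes))).
Definition tBV := tcomp tB tB.
(** The sixth power of the word [abab^2], an involution because the word has order 12. *)
Definition tz :=
  let w := tcomp tA (tcomp tB (tcomp tA tBV)) in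
  let w3 := tcomp w (tcomp w w) in tcomp w3 w3.

(** The images in G of the generators of J_2, written as products of root elements; such products
    lie in G without further checking. *)
Definition J2_a_labs := [:: Lab (Oct q1 q1 q0 q0 q1 qw q0 q1) (Oct q0 q0 q0 q1 q0 q1 q0 q0);
  Lab (Oct qv q1 q0 qv q1 q0 q1 qv) (Oct q1 q0 q1 qv qv q1 q0 q1);
  Lab (Oct qv q1 q0 q0 qw qv qw qv) (Oct qw q0 q0 qv q1 qv q1 qw);
  Lab (Oct qw q1 q0 qv qv qv q0 qw) (Oct qv q0 qw q0 qw q1 q1 qv)].
Definition J2_b_labs := [:: Lab (Oct q0 q1 q0 q1 qv qv qv q0) (Oct qv q0 qw qw q0 q1 q0 qv);
  Lab (Oct qw q1 q0 qv q1 q0 qv qw) (Oct q1 q0 q1 qv q1 qw q1 q1)].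

Definition lab_prod (ls : seq lab) (x : oct) := foldl (fun x l => epsf l x) x ls.

Definition hata := lab_prod J2_a_labs.
Definition hatb := lab_prod J2_b_labs.
Definition stepa (p : ptab * lab) := (tconj p.1 tA tA, lact hata p.2).
Definition stepb (p : ptab * lab) := (tconj p.1 tB tBV, lact hatb p.2).
Definition hj_steps := [:: stepa; stepb].
(** Keyed by the label alone although both coordinates move. By [hj_closed] the permutation attached
    to a label does not depend on the path leading to it, so the orbit is the graph of a map from
    labels to conjugates of the involution. *)
Definition hj_reach := reach (fun p : ptab * lab => lkey p.2) hj_steps 100 (tz, x0).
Definition in_hj l := isome (tfind (lkey l) hj_reach).
Definition sub_nbrs (S : lab -> bool) (nb : seq (lab * lab)) :=
  [seq m <- nb | if S m.1 then S m.2 else false].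
Lemma mem_sub_nbrs S nb m : (m \in sub_nbrs S nb) = [&& m \in nb, S m.1 & S m.2].
Proof. by rewrite mem_filter andbC. Qed.
Definition hj_nbrs l := sub_nbrs in_hj (nbrsT l).

Definition cycles_ok (cs : seq (seq nat)) := all (fun c => all (fun y => leq y.-1 99) c) cs.

Lemma J2_gens_check : [&& cycles_ok a_cycles, cycles_ok b_cycles,
  teqb (tcomp tA tA) idtab & teqb (tcomp tB tBV) idtab].
Proof. compute_bool. Qed.

Lemma hj_size : (let s := telems hj_reach in
  eqn (size s) 315 && nodup_keys [seq lkey p.2 | p <- s] Tip) = true.
Proof. compute_bool. Qed.

Definition step_ok (r : trie (ptab * lab)) (f : ptab * lab -> ptab * lab) p :=
  let q := f p in if tfind (lkey q.2) r is Some q' then teqb q'.1 q.1 else false.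

Lemma hj_closed :
  (let r := hj_reach in all (fun p => all (fun f => step_ok r f p) hj_steps) (telems r)) = true.
Proof. compute_bool. Qed.

(* Only [z] itself pairs with [x0], and commuting with [z] corresponds to collinearity with [x0]. *)
Lemma hj_commute : (let r := hj_reach in let t := tz in let nb := hj_nbrs x0 in
  all (fun p => [&& inX p.2,
     Bool.eqb (teqb p.1 t) (leqb p.2 x0) &
     (if leqb p.2 x0 || has_fst p.2 nb then tcommb p.1 t else ~~ tcommb p.1 t)]) (telems r)) = true.
Proof. compute_bool. Qed.

Definition hj_tab l := if tfind (lkey l) hj_reach is Some p then p.1 else Tip.

Lemma tz_check : [&& ~~ teqb tz idtab & teqb (tcomp tz tz) idtab].
Proof. compute_bool. Qed.

Lemma hj_product : (let t := tz in let nb := hj_nbrs x0 in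
  all (fun m => teqb (tcomp t (hj_tab m.1)) (hj_tab m.2)) nb) = true.
Proof. compute_bool. Qed.

(* The 36-valent Hall-Janko graph, as an orbit of pairs. *)
Definition pair_steps : seq (seq f4 * seq f4 -> seq f4 * seq f4) :=
  [seq (fun p => (papp t p.1, papp t p.2)) | t <- [:: tA; tB]].
Definition hj_edges := reach (fun p => p.1 ++ p.2) pair_steps 100 (nth [::] codes 0, nth [::] codes 4).
Definition edge (c d : seq f4) := isome (tfind (c ++ d) hj_edges).

(** In the centralizer computation J_2 enters only as a group of automorphisms of this graph, which
    prunes the search for permutations commuting with [qtabs]. *)
Lemma edge_check : (let e := edge in all (fun c => all (fun d =>
  (Bool.eqb (edge (papp tA c) (papp tA d)) (edge c d)) &&
  (Bool.eqb (edge (papp tB c) (papp tB d)) (edge c d))) codes) codes) = true.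
Proof. compute_bool. Qed.

Definition qtabs := [seq hj_tab m.1 | m <- hj_nbrs x0].
(** Every orbit on the 100 points of the group generated by [qtabs] meets this list, so a
    permutation commuting with that group is determined by its values at these 15 points. *)
Definition orbit_reps : seq (seq f4) := Eval vm_compute in
  [seq nth [::] codes i | i <- [:: 10; 7; 3; 2; 1; 63; 61; 41; 33; 32; 21; 20; 5; 4; 0]].

Definition extend_ok (qs : seq ptab) (asg : seq (seq f4 * seq f4)) (r c : seq f4) :=
  all (fun p : seq f4 * seq f4 => all (fun q =>
    Bool.eqb (edge (papp q r) p.1) (edge (papp q c) p.2)) qs) asg.

(* The maps on the representatives that are compatible with the graph and with the permutations
   [qs]. *)
Fixpoint assignments (qs : seq ptab) (rs : seq (seq f4)) (asg : seq (seq f4 * seq f4)) :=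
  if rs is r :: rs' then
    flatten [seq (if all (fun q => Bool.eqb (eqf (papp q r) r) (eqf (papp q c) c)) qs then
       if extend_ok (idtab :: qs) ((r, c) :: asg) r c
       then assignments qs rs' ((r, c) :: asg) else [::] else [::]) | c <- codes]
  else [:: asg].

Lemma assignments_check : (let t := tz in let qs := qtabs in
  all (fun asg => all (fun p => eqf p.1 p.2) asg || all (fun p => eqf (papp t p.1) p.2) asg)
    (assignments qs orbit_reps [::])) = true.
Proof. compute_bool. Qed.

Lemma orbit_reps_check : (let fs := [seq papp t | t <- qtabs] in
  let os := [seq reach id fs 100 r | r <- orbit_reps] in
  all (fun c => has (fun o => isome (tfind c o)) os) codes) = true.
Proof. compute_bool. Qed.

Fixpoint tchain (prefix rest : seq ptab) : bool :=
  if rest is t :: rest' then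
    all (fun u => has (teqb (tconj u t t)) prefix) prefix && tchain (t :: prefix) rest'
  else true.
Lemma tchain_check : tchain [:: hj_tab x0] qtabs.
Proof. compute_bool. Qed.

Lemma orbit_reps_reached c : c \in codes ->
  exists2 r, r \in orbit_reps & isome (tfind c (reach id [seq papp t | t <- qtabs] 100 r)).
Proof.
have H : all (fun c => has (fun o => isome (tfind c o))
    [seq reach id [seq papp t | t <- qtabs] 100 r | r <- orbit_reps]) codes.
  exact: orbit_reps_check.
by move/(allP H); rewrite has_map => /hasP.
Qed.

Lemma assignments_checked : all (fun asg : seq (seq f4 * seq f4) =>
    all (fun p => eqf p.1 p.2) asg || all (fun p => eqf (papp tz p.1) p.2) asg)
  (assignments qtabs orbit_reps [::]).
Proof. exact: assignments_check. Qed.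

Lemma hj_base : in_hj x0.
Proof. compute_bool. Qed.

Lemma gens_labels : all inX (J2_a_labs ++ J2_b_labs).
Proof. compute_bool. Qed.

Lemma hj_reachE : hj_reach = reach (fun p : ptab * lab => lkey p.2) hj_steps 100 (tz, x0).
Proof. by rewrite /hj_reach. Qed.

Lemma tAE : tA = ctab (fun c => nth [::] codes (cycles_eval a_cycles (find (eqf c) codes))).
Proof. by rewrite /tA. Qed.
Lemma tBE : tB = ctab (fun c => nth [::] codes (cycles_eval b_cycles (find (eqf c) codes))).
Proof. by rewrite /tB. Qed.
Lemma tBVE : tBV = tcomp tB tB.
Proof. by rewrite /tBV. Qed.
Lemma tzE : tz = let w := tcomp tA (tcomp tB (tcomp tA tBV)) in
  let w3 := tcomp w (tcomp w w) in tcomp w3 w3.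
Proof. by rewrite /tz. Qed.

Lemma hj_commute_checked : all (fun p => [&& inX p.2,
     Bool.eqb (teqb p.1 tz) (leqb p.2 x0) &
     (if leqb p.2 x0 || has_fst p.2 (hj_nbrs x0) then tcommb p.1 tz else ~~ tcommb p.1 tz)])
  (telems hj_reach).
Proof. exact: hj_commute. Qed.

Lemma hj_closed_checked :
  all (fun p => all (fun f => step_ok hj_reach f p) hj_steps) (telems hj_reach).
Proof. exact: hj_closed. Qed.

Lemma hj_tab_find l : hj_tab l = if tfind (lkey l) hj_reach is Some p then p.1 else Tip.
Proof. by rewrite /hj_tab. Qed.

Lemma hj_product_checked : all (fun m => teqb (tcomp tz (hj_tab m.1)) (hj_tab m.2)) (hj_nbrs x0).
Proof. exact: hj_product. Qed.

Lemma hj_labels : eqn (size (telems hj_reach)) 315 &&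
  nodup_keys [seq lkey p.2 | p <- telems hj_reach] Tip.
Proof. exact: hj_size. Qed.

Opaque hj_reach.

Lemma hj_labels_size : size (telems hj_reach) = 315.
Proof. exact: (eqnP (proj1 (andP hj_labels))). Qed.

Lemma hj_labels_uniq : uniq [seq p.2 | p <- telems hj_reach].
Proof.
apply: (@map_uniq _ _ lkey); rewrite -map_comp; apply: nodup_keysP.
exact: (proj2 (andP hj_labels)).
Qed.

Lemma qtabsE : [seq (hj_tab \o fst) m | m <- hj_nbrs x0] = qtabs.
Proof. by rewrite /qtabs. Qed.

Opaque step_ok.

Lemma step_okP p : all (fun f => step_ok hj_reach f p) hj_steps ->
  step_ok hj_reach stepa p /\ step_ok hj_reach stepb p.
Proof. move=> /and3P[pa pb _]; exact: conj pa pb. Qed.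

Opaque hj_reach hj_tab hj_edges qtabs tA tB tBV tz.

(** * Local structure of the Hall-Janko octagon and patterns of near lines *)

Section Local.

Variables (A : Type) (D : A -> nat).

Definition at_dist (d : nat) (m : A * A) := eqn (D m.1) d.

(** Counts given by the parameters (2,4;0,3), with every line listed in two orders and [at_dist]
    reading the first entry: ten pairs at the base point, at distance 3 four lines towards it and
    one away from it, at distance 4 five lines towards it. *)
Definition hj_local (nb : seq (A * A)) (d : nat) :=
  match d with
  | 0 => eqn (size nb) 10
  | 1 => has (at_dist 0) nb && has (at_dist 2) nb
  | 2 => has (at_dist 1) nb && has (at_dist 3) nb
  | 3 => [&& eqn (count (at_dist 2) nb) 4, eqn (count (at_dist 4) nb) 2,
             eqn (count (fun m => at_dist 2 m || at_dist 2 (m.2, m.1)) nb) 8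
           & all (fun m => [|| at_dist 2 m, at_dist 2 (m.2, m.1) | at_dist 4 m]) nb]
  | 4 => eqn (count (at_dist 3) nb) 5
  | _ => false
  end.

End Local.

Lemma hj_local_map (A B : Type) (f : A -> B) (D : B -> nat) (nb : seq (A * A)) d :
  hj_local D [seq (f m.1, f m.2) | m <- nb] d = hj_local (fun a => D (f a)) nb d.
Proof. by move: d => [|[|[|[|[|d]]]]] //=; rewrite ?size_map ?has_map ?count_map ?all_map. Qed.

Lemma hj_local_perm (A : eqType) (D : A -> nat) (nb nb' : seq (A * A)) d :
  perm_eq nb nb' -> hj_local D nb d = hj_local D nb' d.
Proof.
move=> p; have c := seq.permP p; move: d => [|[|[|[|[|d]]]]] //=.
- by rewrite (perm_size p).
- by rewrite !(perm_has _ p).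
- by rewrite !(perm_has _ p).
- by rewrite !c (perm_all _ p).
by rewrite c.
Qed.

Lemma eq_in_hj_local (A : eqType) (D D' : A -> nat) (nb : seq (A * A)) d :
  {in nb, forall m, D m.1 = D' m.1 /\ D m.2 = D' m.2} -> hj_local D nb d = hj_local D' nb d.
Proof.
move=> e; have e1 k : {in nb, at_dist D k =1 at_dist D' k}.
  by move=> m /e[e1 _]; rewrite /at_dist e1.
have e2 k : {in nb, forall m, at_dist D k (m.2, m.1) = at_dist D' k (m.2, m.1)}.
  by move=> m /e[_ e2]; rewrite /at_dist e2.
move: d => [|[|[|[|[|d]]]]] //=.
- by rewrite !(eq_in_has (e1 _)).
- by rewrite !(eq_in_has (e1 _)).
- rewrite (eq_in_count (e1 2)) (eq_in_count (e1 4)).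
  have -> : count (fun m => at_dist D 2 m || at_dist D 2 (m.2, m.1)) nb =
      count (fun m => at_dist D' 2 m || at_dist D' 2 (m.2, m.1)) nb.
    by apply: eq_in_count => m mn; rewrite e1 ?e2.
  congr (_ && (_ && (_ && _))).
  by apply/allP/allP => H m mn; have := H m mn; rewrite !(e1 _ m mn) !(e2 _ m mn).
by rewrite (eq_in_count (e1 _)).
Qed.

Lemma hj_local_check : (let r := hj_reach in let ls := [seq p.2 | p <- telems r] in
  [&& all (fun l => hj_local dist0 (hj_nbrs l) (dist0 l)) ls,
      eqn (count (fun l => eqn (dist0 l) 3) ls) 160 & eqn (count (fun l => eqn (dist0 l) 4) ls) 64])
  = true.
Proof. compute_bool. Qed.

Lemma common_check : all (fun e => if eqn (edist e) 2 then
  leq (count (at_dist dist0 1) (enbrs e)) 3 else true) pts.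
Proof. compute_bool. Qed.

(** For [l] at distance 3 from the base point, these are the neighbours of the base point at
    distance 2 from [l]. *)
Definition near_set (D : lab -> nat) l := flatten [seq [seq k.1 | k <- nbrsT w.1 & at_dist D 1 k]
  | w <- nbrsT l & at_dist D 2 w].

(** A bit tells whether a line through the base point has a point at distance 2 from [l]. A line is
    listed in two orders and contributes two equal bits, so the threshold 8 below means four
    lines. *)
Definition near_bits (D : lab -> nat) (nb : seq (lab * lab)) l : seq bool :=
  let ns := near_set D l in [seq has (leqb m.1) ns || has (leqb m.2) ns | m <- nb].

Fixpoint eqbits (s t : seq bool) : bool :=
  match s, t with
  | a :: s', b :: t' => if Bool.eqb a b then eqbits s' t' else false
  | [::], [::] => true
  | _, _ => false
  end.

Definition ntrue (s : seq bool) := count id s.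
Definition both (s t : seq bool) := [seq p.1 && p.2 | p <- zip s t].

Definition bits3 := [seq near_bits dist0 (nbrsT x0) (eself e) | e <- pts & eqn (edist e) 3].
Definition heavy := [seq b <- bits3 | leq 8 (ntrue b)].
Definition patterns : seq (seq bool) := Eval vm_compute in
  foldl (fun acc b => if has (eqbits b) acc then acc else b :: acc) [::] heavy.

Lemma patterns_check : (let hs := heavy in
  [&& all (fun b => has (eqbits b) patterns) hs,
      all (fun b => all (fun c => eqbits b c || ~~ leq 8 (ntrue (both b c))) patterns) patterns
    & all (fun c => leq (count (eqbits c) hs) 64) patterns]) = true.
Proof. compute_bool. Qed.

Definition typeA_lab (D : lab -> nat) l :=
  if eqn (D l) 3 then leq 4 (count (at_dist D 2) (nbrsT l)) else false.

(** A shortest path of length 3 that starts along the spread line never ends at a point with four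
    neighbours at distance 2. Inside a copy of HJ such paths do end at such points, so a copy
    contains no spread line. *)
Lemma spread_check : all (fun s => all (fun u => if at_dist dist0 2 u then
    all (fun k => ~~ typeA_lab dist0 k.1) (nbrsT u.1) else true) (nbrsT s.1)) (take 2 (nbrsT x0)).
Proof. compute_bool. Qed.

(** At a point at distance 4, distances alone single out five lines off the spread; they must be the
    lines there of any copy containing both points. *)
Lemma near_check : eqn (count (fun m => typeA_lab dist0 m.1) (drop 2 (nbrsT x1))) 5.
Proof. compute_bool. Qed.

Lemma antipodes_check : eqn (count (fun e => eqn (edist e) 4) pts) 2048.
Proof. compute_bool. Qed.

Opaque patterns.

Lemma hj_local_checked : all (fun l => hj_local dist0 (hj_nbrs l) (dist0 l)) [seq p.2 | p <- telems hj_reach].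
Proof. exact: (proj1 (andP hj_local_check)). Qed.
Lemma hj_counts : eqn (count (fun l => eqn (dist0 l) 3) [seq p.2 | p <- telems hj_reach]) 160 &&
  eqn (count (fun l => eqn (dist0 l) 4) [seq p.2 | p <- telems hj_reach]) 64.
Proof. exact: (proj2 (andP hj_local_check)). Qed.

Lemma patterns_checked : [/\ all (fun b => has (eqbits b) patterns) heavy,
  all (fun b => all (fun c => eqbits b c || ~~ leq 8 (ntrue (both b c))) patterns) patterns
  & all (fun c => leq (count (eqbits c) heavy) 64) patterns].
Proof.
have /and3P[pa pb pc] : [&& all (fun b => has (eqbits b) patterns) heavy,
  all (fun b => all (fun c => eqbits b c || ~~ leq 8 (ntrue (both b c))) patterns) patterns
  & all (fun c => leq (count (eqbits c) heavy) 64) patterns] by exact: patterns_check.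
split; [exact: pa | exact: pb | exact: pc].
Qed.

(** * From a field of order four to [f4] *)

From mathcomp Require Import ring.

Section FieldFour.
Import GRing.Theory.
Local Open Scope ring_scope.

Variable F : finFieldType.
Hypothesis hF : #|F| = 4.

Lemma addxx (x : F) : x + x = 0.
Proof.
(* At x = -1 the identity x^4 = x reads 1 = -1. *)
have /eqP := expf_card (-1 : F); rewrite hF -signr_odd /= expr0 -subr_eq0 opprK => /eqP e.
by rewrite -[x]mulr1 -mulrDr e mulr0.
Qed.

Lemma opp_id (x : F) : - x = x.
Proof. by apply/eqP; rewrite -subr_eq0 -opprD oppr_eq0 addxx. Qed.

(** From x^4 = x and x != 0 one gets x^3 = 1; cancelling x + 1 in x^3 + 1 = (x + 1)(x^2 + x + 1)
    leaves x^2 = x + 1 in characteristic 2. *)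
Lemma sqr_generic (x : F) : x != 0 -> x != 1 -> x * x = x + 1.
Proof.
move=> x0 x1; have := expf_card x; rewrite hF => e.
have e3 : x * x * x = 1.
  by apply: (mulfI x0); rewrite mulr1 -[RHS]e; ring.
have : (x + 1) * (x * x + (x + 1)) = 0.
  have -> : (x + 1) * (x * x + (x + 1)) = x * x * x + 1 + (x * x + x * x) + (x + x) by ring.
  by rewrite e3 !addxx ?addr0.
move/eqP; rewrite mulf_eq0 => /orP[|]; first by rewrite addr_eq0 opp_id (negbTE x1).
by rewrite addr_eq0 opp_id => /eqP.
Qed.

Lemma generator_exists : {w : F | (w != 0) && (w != 1)}.
Proof.
apply: sigW; have : (0 < #|~: [set (0%R : F); 1%R]|)%N.
  by rewrite cardsCs setCK hF cards2; case: (_ != _).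
by case/card_gt0P=> w; rewrite !inE negb_or; exists w.
Qed.

Definition om : F := sval generator_exists.
Lemma om0 : om != 0. Proof. by case/andP: (svalP generator_exists). Qed.
Lemma om1 : om != 1. Proof. by case/andP: (svalP generator_exists). Qed.

Definition ff (a : f4) : F := match a with q0 => 0 | q1 => 1 | qw => om | qv => om + 1 end.
Definition fi (x : F) : f4 :=
  if x == 0 then q0 else if x == 1 then q1 else if x == om then qw else qv.

Lemma ffD a b : ff (fadd a b) = ff a + ff b.
Proof.
case: a b => [] []; rewrite /= ?add0r ?addr0 ?addxx //.
- by rewrite addrC.
- by rewrite addrCA addxx addr0.
- by rewrite addrA addxx add0r.
- by rewrite -addrA addxx addr0.
by rewrite addrAC addxx add0r.
Qed.

Lemma ffM a b : ff (fmul a b) = ff a * ff b.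
Proof.
have ww := sqr_generic om0 om1.
case: a b => [] []; rewrite /= ?mul0r ?mulr0 ?mul1r ?mulr1 ?ww //.
- have -> : om * (om + 1) = om * om + om by ring.
  by rewrite ww addrAC addxx add0r.
- have -> : (om + 1) * om = om * om + om by ring.
  by rewrite ww addrAC addxx add0r.
have -> : (om + 1) * (om + 1) = om * om + (om + om) + 1 by ring.
by rewrite ww addxx addr0 -addrA addxx addr0.
Qed.

Lemma fiK : cancel fi ff.
Proof.
move=> x; rewrite /fi; case: eqVneq => [->|x0] //; case: eqVneq => [->|x1] //.
case: eqVneq => [->|xw] //=; apply/eqP; rewrite eq_sym -subr_eq0 opp_id.
have := sqr_generic x0 x1; have := sqr_generic om0 om1 => ww xx.
have : (x + om) * (x + (om + 1)) = 0.
  have -> : (x + om) * (x + (om + 1)) = x * x + om * om + (x * om + x * om) + (x + om) by ring.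
  rewrite xx ww; have -> : x + 1 + (om + 1) + (x * om + x * om) + (x + om) =
    (x + x) + (1 + 1) + (om + om) + (x * om + x * om) by ring.
  by rewrite !addxx ?addr0.
move/eqP; rewrite mulf_eq0 !addr_eq0 !opp_id => /orP[/eqP e|/eqP->].
  by rewrite e eqxx in xw.
by rewrite eqxx.
Qed.

Lemma ffK : cancel ff fi.
Proof.
have w0 := negbTE om0; have w1 := negbTE om1; rewrite /fi; case=> /=.
- by rewrite eqxx.
- by rewrite oner_eq0 eqxx.
- by rewrite w0 w1 eqxx.
rewrite addr_eq0 opp_id w1 -subr_eq0 opp_id -addrA addxx addr0 w0.
by rewrite -subr_eq0 opp_id addrAC addxx add0r oner_eq0.
Qed.

Lemma fiD x y : fi (x + y) = fadd (fi x) (fi y).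
Proof. by rewrite -{1}[x]fiK -{1}[y]fiK -ffD ffK. Qed.

Lemma fiM x y : fi (x * y) = fmul (fi x) (fi y).
Proof. by rewrite -{1}[x]fiK -{1}[y]fiK -ffM ffK. Qed.

Lemma fiN x : fi (- x) = fi x.
Proof. by rewrite opp_id. Qed.

Definition i0 : 'I_3 := 0.
Definition i1 : 'I_3 := 1.
Definition i2 : 'I_3 := 1 + 1.

Definition co (x : octonion F) : oct :=
  let: (a, u, v, b) := x in
  Oct (fi a) (fi (u 0 i0)) (fi (u 0 i1)) (fi (u 0 i2)) (fi (v 0 i0)) (fi (v 0 i1)) (fi (v 0 i2)) (fi b).

Definition row3 (a b c : F) : 'rV[F]_3 := \row_(i < 3) if i == i0 then a else if i == i1 then b else c.

Definition oc (x : oct) : octonion F :=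
  let: Oct a u1 u2 u3 v1 v2 v3 b := x in
  (ff a, row3 (ff u1) (ff u2) (ff u3), row3 (ff v1) (ff v2) (ff v3), ff b).

Lemma ocK : cancel oc co.
Proof. by case=> [a u1 u2 u3 v1 v2 v3 b]; rewrite /= !mxE /= !ffK. Qed.

Lemma row3E (u : 'rV[F]_3) : row3 (u 0 i0) (u 0 i1) (u 0 i2) = u.
Proof.
apply/rowP=> i; rewrite mxE; case: eqVneq => [->|n0] //; case: eqVneq => [->|n1] //.
by congr (u 0 _); apply/val_inj; case: i n0 n1 => [[|[|[|i]]] lt].
Qed.

Lemma coK : cancel co oc.
Proof. by case=> [[[a u] v] b]; rewrite /= !fiK !row3E. Qed.

Lemma coD x y : co (x + y) = oadd (co x) (co y).
Proof.
case: x y => [[[a u] v] b] [[[a' u'] v'] b'].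
by rewrite /= !mxE !fiD.
Qed.

Lemma coZ k x : co (k *: x) = oscale (fi k) (co x).
Proof. by case: x => [[[a u] v] b]; rewrite /= !mxE !fiM. Qed.

Lemma coM x y : co (omul x y) = omul8 (co x) (co y).
Proof.
case: x y => [[[a u] v] b] [[[a' u'] v'] b'].
have dotE (s t : 'rV[F]_3) : fi (dotv s t) =
    dot3 (fi (s 0 i0)) (fi (s 0 i1)) (fi (s 0 i2)) (fi (t 0 i0)) (fi (t 0 i1)) (fi (t 0 i2)).
  have o0 : ord0 = i0 by apply/val_inj.
  have o1 : lift ord0 ord0 = i1 by apply/val_inj.
  have o2 : lift ord0 (lift ord0 ord0) = i2 by apply/val_inj.
  by rewrite /dotv !big_ord_recl big_ord0 addr0 o2 o1 o0 /dot3 -!fiM -!fiD.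
have crossE (s t : 'rV[F]_3) : [/\ fi (crossv s t 0 i0) = det2 (fi (s 0 i1)) (fi (s 0 i2)) (fi (t 0 i1)) (fi (t 0 i2)),
    fi (crossv s t 0 i1) = det2 (fi (s 0 i2)) (fi (s 0 i0)) (fi (t 0 i2)) (fi (t 0 i0)) &
    fi (crossv s t 0 i2) = det2 (fi (s 0 i0)) (fi (s 0 i1)) (fi (t 0 i0)) (fi (t 0 i1))].
  have o01 : i0 + 1 = i1 by apply/val_inj.
  have o02 : i0 + 2 = i2 by apply/val_inj.
  have o11 : i1 + 1 = i2 by apply/val_inj.
  have o12 : i1 + 2 = i0 by apply/val_inj.
  have o21 : i2 + 1 = i0 by apply/val_inj.
  have o22 : i2 + 2 = i1 by apply/val_inj.
  by rewrite /crossv !mxE /det2 -!fiM -!fiD !opp_id o01 o02 o11 o12 o21 o22.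
have [c1 c2 c3] := crossE v v'; have [d1 d2 d3] := crossE u u'.
have uE k l (s t c : 'rV[F]_3) i : fi ((k *: s + l *: t - c) 0 i) =
    fadd (fadd (fmul (fi k) (fi (s 0 i))) (fmul (fi l) (fi (t 0 i)))) (fi (c 0 i)).
  by rewrite !mxE !fiD fiN !fiM.
have vE k l (s t c : 'rV[F]_3) i : fi ((k *: s + l *: t + c) 0 i) =
    fadd (fadd (fmul (fi k) (fi (s 0 i))) (fmul (fi l) (fi (t 0 i)))) (fi (c 0 i)).
  by rewrite !mxE !fiD !fiM.
by rewrite /co /omul /= !uE !vE c1 c2 c3 d1 d2 d3 !fiD !fiM !dotE.
Qed.

End FieldFour.

Section Octonions.
Import GRing.Theory.
Local Open Scope ring_scope.

Variable F : finFieldType.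
Hypothesis hF : #|F| = 4.

Local Notation co := (@co F hF).
Local Notation oc := (@oc F hF).
Local Notation fi := (@fi F hF).
Local Notation ff := (@ff F hF).

Definition oct_act (g : {perm octonion F}) (x : oct) : oct := co (g (oc x)).

Lemma oct_act_co g x : oct_act g (co x) = co (g x).
Proof. by rewrite /oct_act coK. Qed.

Lemma oct_act1 x : oct_act 1%g x = x.
Proof. by rewrite /oct_act perm1 ocK. Qed.

Lemma oct_actM g h x : oct_act (g * h)%g x = oct_act h (oct_act g x).
Proof. by rewrite /oct_act permM coK. Qed.

Lemma oct_act_inj g h : oct_act g =1 oct_act h -> g = h.
Proof.
move=> e; apply/permP=> x; apply: (can_inj (coK hF)).
by rewrite -!oct_act_co.
Qed.

Lemma ocD x y : oc (oadd x y) = oc x + oc y.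
Proof. by apply: (can_inj (coK hF)); rewrite coD !ocK. Qed.

Lemma ocZ k x : oc (oscale k x) = ff k *: oc x.
Proof. by apply: (can_inj (coK hF)); rewrite coZ !ocK ffK. Qed.

Lemma ocM x y : oc (omul8 x y) = omul (oc x) (oc y).
Proof. by apply: (can_inj (coK hF)); rewrite coM !ocK. Qed.

(** Since f is onto, e is the image of some x. Reading f(kx) = tau(k) e for the four scalars gives
    tau(w)^2 = tau(w^2) = tau(w) + 1, which leaves two possibilities for tau. *)
Lemma twist_cases (f : oct -> oct) (tau : f4 -> f4) : oadditive f -> bijective f ->
    (forall k x, f (oscale k x) = oscale (tau k) (f x)) ->
  exists s, forall k x, f (oscale k x) = oscale (twist s k) (f x).
Proof.
move=> fD [f' fK f'K] fZ; pose e := Oct q1 q0 q0 q0 q0 q0 q0 q0.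
have fe : f (f' e) = e by [].
have t0 : tau q0 = q0.
  have := fZ q0 (f' e); rewrite oscale0 (oadditive0 fD) fe.
  by case: (tau q0).
have t1 : tau q1 = q1.
  by have := fZ q1 (f' e); rewrite oscale1 fe; case: (tau q1).
have tv : tau qv = fadd (tau qw) q1.
  have := fZ qv (f' e); rewrite (oscaleDl qw q1) fD !fZ t1 fe.
  by case: (tau qw); case: (tau qv).
have tw : fmul (tau qw) (tau qw) = tau qv.
  have := fZ qv (f' e); rewrite -[qv]/(fmul qw qw) -oscaleA !fZ fe.
  by case: (tau qw); case: (tau qv).
have [s sE] : exists s, tau =1 twist s.
  case w: (tau qw) tv tw => /= tv; rewrite tv // => _.
    by exists false; case; rewrite /= ?t0 ?t1 ?w ?tv.
  by exists true; case; rewrite /= ?t0 ?t1 ?w ?tv.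
by exists s => k x; rewrite fZ sE.
Qed.

Lemma oct_act_semi g : g \in G2_semilinear F -> semi (oct_act g).
Proof.
rewrite inE => /existsP[sigma /and3P[gD gZ gM]].
have D : oadditive (oct_act g).
  by move=> x y; rewrite /oct_act ocD (eqP ('forall_forallP gD _ _)) coD.
split=> //; last by move=> x y; rewrite /oct_act ocM (eqP ('forall_forallP gM _ _)) coM.
apply: (@twist_cases _ (fun k => fi (sigma (ff k)))) => //.
  exists (oct_act g^-1%g) => x; rewrite -oct_actM ?mulgV ?mulVg; exact: oct_act1.
by move=> k x; rewrite /oct_act ocZ (eqP ('forall_forallP gZ _ _)) coZ.
Qed.

Lemma oct_act_surj f f' : semi f -> cancel f f' ->
  exists2 g, g \in G2_semilinear F & oct_act g =1 f.
Proof.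
move=> [fD [s fZ] fM] fK; have inj : injective (fun x => oc (f (co x))).
  by move=> x y /(can_inj (ocK hF))/(can_inj fK)/(can_inj (coK hF)).
exists (perm inj); last by move=> x; rewrite /oct_act permE !ocK.
rewrite inE; apply/existsP; exists [ffun a => ff (twist s (fi a))]; apply/and3P; split.
- by apply/'forall_forallP => x y; rewrite !permE coD fD ocD.
- by apply/'forall_forallP => a x; rewrite !permE ffunE coZ fZ ocZ.
- by apply/'forall_forallP => x y; rewrite !permE coM fM ocM.
Qed.

End Octonions.

(** * Finite groups and distances in geometries *)

Import GroupScope.

Lemma uniq_map_inj (T1 T2 : eqType) (f : T1 -> T2) (s : seq T1) :
  uniq [seq f x | x <- s] -> {in s &, injective f}.
Proof.
elim: s => //= a s IH /andP[fa us] x y.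
rewrite !inE => /predU1P[->|xs] /predU1P[->|ys] fxy //; last exact: IH.
  by case/negP: fa; rewrite fxy map_f.
by case/negP: fa; rewrite -fxy map_f.
Qed.

Lemma gen_ind (gT : finGroupType) (A : {set gT}) (Q : gT -> Prop) :
  Q 1 -> (forall x y, Q x -> y \in A -> Q (x * y)) -> forall x, x \in <<A>> -> Q x.
Proof.
move=> Q1 QM x /gen_prodgP[n [c cA ->]].
elim: n c cA => [|n IH] c cA; first by rewrite big_ord0.
by rewrite big_ord_recr /=; apply: QM => //; apply: IH.
Qed.

Section CentralInvolutions.

Variables (gT : finGroupType) (G : {group gT}) (z : gT).
Hypotheses (Gz : z \in G) (z2 : #[z] = 2).

(** The size of the class is the index of the centralizer. When it is odd, a Sylow 2-subgroup of the
    centralizer is one of G. *)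
Lemma central_of_odd_class : odd #|z ^: G| -> central_involution G z.
Proof.
move=> oz; rewrite /central_involution Gz z2 eqxx /=; apply/existsP.
have [S sS] := Sylow_exists 2 'C_G[z]; exists S.
have sSC := pHall_sub sS; rewrite sSC andbT inE.
have sSG : S \subset G by apply: subset_trans sSC (subsetIl _ _).
rewrite pHallE sSG /= (card_Hall sS).
have <- : (#|'C_G[z]| * #|z ^: G|)%N = #|G| by rewrite -index_cent1 Lagrange ?subsetIl.
rewrite partnM ?cardG_gt0 //; last by rewrite -index_cent1.
by rewrite [X in (_ * X)%N]part_p'nat ?muln1 // p'natE // -prime_coprime // coprime2n.
Qed.

Lemma central_conj (K : {group gT}) : K \subset G -> 2.-group K ->
    (forall t, t \in 'C_G(K) -> #[t] = 2 -> t = z) ->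
  forall x, central_involution G x -> x \in z ^: G.
Proof.
move=> sKG pK CK x /and3P[Gx /eqP x2 /existsP[S /andP[sylS sSC]]].
rewrite inE in sylS; have [y Gy sKSy] := Sylow_Jsub sylS sKG pK.
have tz : x ^ y^-1 = z.
  apply: CK; last by rewrite orderJ.
  rewrite inE groupJ ?groupV //; apply/centP => k Kk.
  have /(subsetP sKSy) : k ^ y \in K :^ y by rewrite memJ_conjg.
  move/(subsetP sSC); rewrite inE => /andP[_ /cent1P c].
  rewrite /commute; apply: (@conjg_inj _ y); rewrite [LHS]conjMg [RHS]conjMg conjgKV; exact: esym c.
by apply/imsetP; exists y; rewrite // -tz conjgKV.
Qed.

Lemma central_involutions_class (K : {group gT}) : odd #|z ^: G| -> K \subset G ->
    2.-group K -> (forall t, t \in 'C_G(K) -> #[t] = 2 -> t = z) ->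
  central_involutions G = z ^: G.
Proof.
move=> oz sKG pK CK; apply/setP => x; rewrite inE; apply/idP/idP.
  exact: central_conj CK x.
case/imsetP => y Gy ->; have := central_of_odd_class oz.
case/and3P=> _ _ /existsP[S /andP[sylS sSC]].
rewrite /central_involution groupJ // orderJ z2 eqxx /=.
apply/existsP; exists (S :^ y)%G; move: sylS; rewrite !inE => sylS.
rewrite pHallJ // sylS /=; apply/subsetP => _ /imsetP[s Ss ->].
move/subsetP/(_ s Ss)/setIP: sSC => [Gs /cent1P c].
apply/setIP; split; first by rewrite groupJ.
by apply/cent1P; rewrite /commute -[LHS]conjMg c conjMg.
Qed.

End CentralInvolutions.

Lemma pgroup_cons (gT : finGroupType) (p : nat) (x : gT) (s : seq gT) :
    p.-group <<[set y in s]>> -> p.-elt x -> {in s, forall y, y ^ x \in s} ->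
  p.-group <<[set y in x :: s]>>.
Proof.
move=> ps px H; have nx : <[x]> \subset 'N(<<[set y in s]>>).
  rewrite cycle_subG; apply: (subsetP (norm_gen _)); rewrite inE.
  by apply/subsetP => _ /imsetP[y ys ->]; rewrite !inE in ys *; apply: H.
have -> : <<[set y in x :: s]>> = <<[set y in s]>> <*> <[x]>.
  rewrite -[LHS]/(<<_>>) joing_idl joing_idr; congr <<_>>.
  by apply/setP=> y; rewrite !inE orbC.
by rewrite norm_joinEr // pgroupM ps.
Qed.

(** * Triples of commuting involutions and normalizer indices *)

Section Triples.

Variable gT : finGroupType.
Implicit Types (G : {group gT}) (x y z : gT).

Lemma gen_klein x y : #[x] = 2 -> #[y] = 2 -> commute x y ->
  <<[set x; y]>> = 1 |: triple x y.
Proof.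
move=> x2 y2 xy; have xx : x * x = 1 by rewrite -[_ * _]/(x ^+ 2) -x2 expg_order.
have yy : y * y = 1 by rewrite -[_ * _]/(y ^+ 2) -y2 expg_order.
apply/eqP; rewrite eqEsubset; apply/andP; split; last first.
  have xG : x \in <<[set x; y]>> by rewrite mem_gen // !inE eqxx.
  have yG : y \in <<[set x; y]>> by rewrite mem_gen // !inE eqxx orbT.
  by apply/subsetP=> t; rewrite !inE -?orbA => /or4P[] /eqP->; rewrite ?group1 ?groupM.
have gs : group_set (1 |: triple x y).
  apply/group_setP; split=> [|a b]; first by rewrite !inE eqxx.
  have xyx : x * y * x = y by rewrite -mulgA -xy mulgA xx mul1g.
  have yxy : y * (x * y) = x by rewrite xy mulgA yy mul1g.
  have xyxy : x * y * (x * y) = 1 by rewrite mulgA xyx yy.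
  have xxy : x * (x * y) = y by rewrite mulgA xx mul1g.
  have xyy : x * y * y = x by rewrite -mulgA yy mulg1.
  rewrite !inE -?orbA => /or4P[]/eqP-> /or4P[]/eqP->;
    by rewrite ?mul1g ?mulg1 ?xx ?yy -?xy ?xyx ?yxy ?xyxy ?xxy ?xyy eqxx ?orbT.
rewrite -[1 |: _]/(gval (Group gs)) gen_subG; apply/subsetP=> t.
by rewrite !inE => /orP[]/eqP->; rewrite eqxx ?orbT.
Qed.

Lemma tripleJ x y g : triple x y :^ g = triple (x ^ g) (y ^ g).
Proof. by rewrite /triple !conjUg !conjg_set1 conjMg. Qed.

(** The Klein group is the triple together with 1, so its normalizer is the stabilizer of the triple
    and the index counts conjugate triples. *)
Lemma index_triple G x y : #[x] = 2 -> #[y] = 2 -> commute x y -> x != y ->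
  #|G : 'N_G(<<[set x; y]>>)| = #|triple x y :^: G|.
Proof.
move=> x2 y2 xy nxy; rewrite card_conjugates; congr #|G : G :&: _|.
rewrite gen_klein //; apply/setP => g; rewrite !inE conjUg conjg_set1 conj1g.
have n1 : 1 \notin triple x y.
  rewrite !inE !negb_or -?andbA; apply/and3P; split; apply/eqP => e.
  - by rewrite -e order1 in x2.
  - by rewrite -e order1 in y2.
  by case/eqP: nxy; apply: (mulgI x); rewrite -e -[x * x]/(x ^+ 2) -x2 expg_order.
have n1g : 1 \notin triple x y :^ g by rewrite -[1](conj1g g) memJ_conjg.
apply/idP/idP => [/subsetP H|/subsetP H]; apply/subsetP => t.
  move=> tg; have := H t; rewrite !inE tg orbT => /(_ isT) /predU1P[t1|//].
  by rewrite -t1 tg in n1g.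
by rewrite !inE => /predU1P[->|/H]; rewrite ?eqxx // !inE => ->; rewrite orbT.
Qed.

(** Double counting of the pairs of a conjugate triple and a point on it; transitivity on [P] makes
    the number of triples through a point constant. *)
Lemma card_triple_class G x y (P : {set gT}) : P \subset G ->
    {in P &, forall a b, exists2 g, g \in G & a ^ g = b} -> {in G & P, forall g a, a ^ g \in P} ->
    x \in P -> triple x y \subset P -> #|triple x y| = 3 ->
  (3 * #|triple x y :^: G| = #|P| * #|[set t in triple x y :^: G | x \in t]|)%N.
Proof.
move=> sPG trP cP xP sTP T3; set O := _ :^: G.
have cO g : g \in G -> {mono (fun t : {set gT} => t :^ g) : t / t \in O}.
  move=> Gg t; apply/imsetP/imsetP => [[h Gh e]|[h Gh ->]].
    by exists (h * g^-1); rewrite ?groupM ?groupV // conjsgM -e -conjsgM mulgV conjsg1.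
  by exists (h * g); rewrite ?groupM // conjsgM.
transitivity (\sum_(t in O) \sum_(a in P | a \in t) 1)%N.
  rewrite mulnC -sum_nat_const; apply: eq_bigr => t /imsetP[g Gg ->].
  rewrite sum1_card -T3 -(cardJg _ g); apply: eq_card => a.
  rewrite [RHS]unfold_in; case ag: (a \in _ :^ _); rewrite ?andbF // andbT.
  have : a ^ g^-1 \in triple x y by rewrite -mem_conjg.
  by move/(subsetP sTP)/(cP _ _ Gg); rewrite conjgKV.
rewrite (exchange_big_dep (mem P)) //=; last by move=> ? ? _ /andP[].
rewrite -sum_nat_const; apply: eq_bigr => a aP.
have [g Gg <-] := trP _ _ xP aP.
rewrite (reindex_inj (@conjsg_inj _ g)) /= sum1_card; apply: eq_card => t.
by rewrite [LHS]unfold_in [RHS]inE cO // memJ_conjg (cP _ _ Gg xP).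
Qed.

(** The triple of x and y arises from y and xy only, so at most two elements of [A] yield it, and
    exactly two if [A] is closed under y -> xy. *)
Lemma card_triples_through x (A : {set gT}) : x != 1 -> {in A, forall y, x * x = 1} ->
  x \notin A -> #|A| <= 2 * #|[set triple x y | y in A]| /\
  ({in A, forall y, x * y \in A} -> #|A| = (2 * #|[set triple x y | y in A]|)%N).
Proof.
move=> x1 xx xA.
have fib t : t \in [set triple x y | y in A] ->
    #|[pred y in A | triple x y == t]| <= 2 /\
    ({in A, forall y, x * y \in A} -> #|[pred y in A | triple x y == t]| = 2).
  case/imsetP=> y yA ->.
  have sub a : a \in A -> triple x a = triple x y -> (a == y) || (a == x * y).
    move=> aA e; have : a \in triple x y by rewrite -e !inE eqxx orbT.
    by rewrite !inE -orbA => /predU1P[ax|//]; rewrite ax (negPf xA) in aA.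
  have xyy : x * y != y by rewrite -{2}[y]mul1g (can_eq (mulgK y)).
  split=> [|cA].
    apply: (@leq_trans #|[set y; x * y]|); last by rewrite cards2 eq_sym xyy.
    apply: subset_leq_card; apply/subsetP => a; rewrite !inE => /andP[aA /eqP].
    exact: sub.
  transitivity #|[set y; x * y]|; last by rewrite cards2 eq_sym xyy.
  apply: eq_card => a; rewrite !inE; apply/andP/orP => [[aA /eqP/(sub _ aA)/orP//]|].
  case=> /eqP->; split; rewrite ?cA // /triple mulgA (xx y) // mul1g.
  by rewrite -!setUA [_ |: [set y]]setUC.
rewrite -sum1_card (partition_big_imset (triple x)) /=; split=> [|cA].
  rewrite mulnC -sum_nat_const; apply: leq_sum => t /fib[H _].
  by rewrite sum1_card.
rewrite mulnC -sum_nat_const; apply: eq_bigr => t /fib[_ /(_ cA) H].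
by rewrite sum1_card.
Qed.

End Triples.

(** * Distances and automorphisms of geometries *)

Section Distance.

Variables (T : finType) (g : geometry T).
Implicit Types (x y z : T).

Lemma walkP n x y : reflect (exists p, [/\ size p = n, path (collinear g) x p & last x p = y])
  (walk g n x y).
Proof.
apply: (iffP existsP) => [[p /andP[pp /eqP lp]]|[p [sp pp lp]]].
  by exists p; rewrite size_tuple.
by exists (tcast sp (in_tuple p)); rewrite val_tcast /= pp lp /=.
Qed.

Lemma walk0 x y : walk g 0 x y = (x == y).
Proof.
apply/walkP/eqP => [[p [/size0nil-> _]] //|->]; by exists [::].
Qed.

Lemma walkS n x y : reflect (exists2 z, walk g n x z & collinear g z y) (walk g n.+1 x y).
Proof.
apply: (iffP (walkP _ _ _)) => [[p]|[z /walkP[p [sp pp lp]] zy]].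
  case/lastP: p => [[] //|p z []]; rewrite size_rcons => -[sp].
  rewrite rcons_path last_rcons => /andP[pp zl] <-.
  by exists (last x p) => //; apply/walkP; exists p.
by exists (rcons p y); rewrite size_rcons rcons_path last_rcons sp pp lp.
Qed.

Lemma collinear_sym x y : collinear g x y = collinear g y x.
Proof. by rewrite /collinear /= eq_sym; congr (_ && _); apply: eq_existsb => l; rewrite (andbC (x \in l)). Qed.

Lemma walk_sym n x y : walk g n x y = walk g n y x.
Proof.
have left k a b : walk g k.+1 a b -> exists2 z, collinear g a z & walk g k z b.
  case/walkP=> -[|z p] [] //= [sp] /andP[az pp] lp.
  by exists z => //; apply/walkP; exists p.
suff main k a b : walk g k a b -> walk g k b a by apply/idP/idP; apply: main.
elim: k a b => [|k IH] a b; first by rewrite !walk0 eq_sym.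
by case/left=> z az /IH bz; apply/walkS; exists z; rewrite // collinear_sym.
Qed.

Lemma distance_sym x y : distance g x y = distance g y x.
Proof. by apply: eq_find => n; apply: walk_sym. Qed.

Hypothesis gp : {in lines g, forall l : {set T}, l \subset points g}.

Lemma collinear_points x y : collinear g x y -> x \in points g /\ y \in points g.
Proof.
case/andP=> _ /existsP[l /and3P[lg xl yl]].
by split; apply: (subsetP (gp lg)).
Qed.

(** No walk is shorter than [d] since [d] rises by at most 1 per step, and descending along [d]
    gives a walk of that length. The bound [#|T|] comes from [distance], which inspects only smaller
    lengths. *)
Lemma distance_potential x (d : T -> nat) :
    x \in points g -> d x = 0 -> {in points g, forall y, d y < #|T|} ->
    (forall y z, collinear g y z -> d z <= (d y).+1) ->
    {in points g, forall y, y != x -> exists2 z, collinear g z y & d y = (d z).+1} ->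
  {in points g, forall y, distance g x y = d y}.
Proof.
move=> xP dx dT d1 dS y yP.
have le n z : walk g n x z -> d z <= n.
  elim: n z => [|n IH] z; first by rewrite walk0 => /eqP <-; rewrite dx.
  by case/walkS=> z' /IH z'n /d1/leq_trans-> //.
have ge : walk g (d y) x y.
  move e: (d y) => n; elim: n y yP e => [|n IH] y yP e.
    rewrite walk0 eq_sym; apply/negPn/negP=> /(dS _ yP)[z _].
    by rewrite e.
  have yx : y != x by apply/eqP=> yx; rewrite yx dx in e.
  have [z zy ez] := dS _ yP yx; apply/walkS; exists z => //.
  by apply: IH; [case: (collinear_points zy) | move: ez; rewrite e => -[]].
rewrite /distance; have dyT := dT _ yP.
have fs : find (fun n => walk g n x y) (iota 0 #|T|) <= d y.
  rewrite leqNgt; apply/negP=> /(before_find 0); rewrite nth_iota // add0n.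
  by rewrite ge.
apply/eqP; rewrite eqn_leq fs /=; apply: le.
have h : has (fun n => walk g n x y) (iota 0 #|T|).
  by rewrite has_find size_iota (leq_ltn_trans fs).
by have := nth_find 0 h; rewrite nth_iota ?add0n // (leq_ltn_trans fs).
Qed.

Lemma distance_connect x y : x \in points g -> distance g x y < #|T| -> connect (collinear g) x y.
Proof.
move=> xP dT; have h : has (fun n => walk g n x y) (iota 0 #|T|).
  by rewrite has_find size_iota.
have /walkP[p [_ pp <-]] := nth_find 0 h.
by apply/connectP; exists p.
Qed.

Section Auto.

Variable s : {perm T}.
Hypothesis sL : [set [set s x | x in l] | l : {set T} in lines g] = lines g.

Lemma aut_collinear x y : collinear g (s x) (s y) = collinear g x y.
Proof.
rewrite /collinear /= (inj_eq perm_inj); congr (_ && _).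
apply/existsP/existsP => [[l /and3P[]]|[l /and3P[lg xl yl]]].
  rewrite -{1}sL => /imsetP[m mg ->]; rewrite !mem_imset; try exact: perm_inj.
  by move=> xm ym; exists m; rewrite mg xm.
exists [set s z | z in l]; rewrite !mem_imset ?xl ?yl ?andbT; try exact: perm_inj.
by rewrite -sL imset_f.
Qed.

Lemma aut_distance x y : distance g (s x) (s y) = distance g x y.
Proof.
apply: eq_find => n; elim: n y => [|n IH] y.
  by rewrite !walk0 (inj_eq perm_inj).
apply/walkS/walkS => [[z]|[z w c]].
  by rewrite -{1 2}(permKV s z) IH aut_collinear => w c; exists (s^-1 z).
by exists (s z); rewrite ?IH ?aut_collinear.
Qed.

End Auto.

End Distance.

(** * Isomorphism of geometries *)

Section Isomorphism.

Lemma geom_isomorphicP (T U : finType) (g : geometry T) (h : geometry U) :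
  reflect (exists f : T -> U, [/\ {in points g &, injective f}, [set f x | x in points g] = points h
    & [set [set f x | x in l] | l : {set T} in lines g] = lines h])
  (geom_isomorphic g h).
Proof.
apply: (iffP existsP) => [[f /and3P[inj /eqP ep /eqP el]]|[f [inj ep el]]].
  exists f; split=> // x y xP yP e; apply/eqP.
  by move/forall_inP/(_ x xP)/forall_inP/(_ y yP)/implyP: inj; apply; apply/eqP.
exists [ffun x => f x]; apply/and3P; split.
- apply/forall_inP=> x xP; apply/forall_inP=> y yP; rewrite !ffunE.
  by apply/implyP=> /eqP/(inj _ _ xP yP)->.
- by rewrite -ep; apply/eqP/eq_imset => x; rewrite ffunE.
by rewrite -el; apply/eqP/eq_imset => l; apply: eq_imset => x; rewrite ffunE.
Qed.

Lemma geom_isomorphic_sym (T U : finType) (g : geometry T) (h : geometry U) (t0 : T) :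
    {in lines g, forall l : {set T}, l \subset points g} ->
  geom_isomorphic g h -> geom_isomorphic h g.
Proof.
move=> sub /geom_isomorphicP[f [inj ep el]]; apply/geom_isomorphicP.
(* [t0] is only the value taken outside the image of the points. *)
pose f' u := odflt t0 [pick x in points g | f x == u].
have f'K x : x \in points g -> f' (f x) = x.
  move=> xP; rewrite /f'; case: pickP => [y /andP[yP /eqP/inj]|/(_ x)]; first exact.
  by rewrite /= xP eqxx.
exists f'; split.
- move=> u v; rewrite -ep => /imsetP[x xP ->] /imsetP[y yP ->].
  by rewrite !f'K // => ->.
- rewrite -ep -imset_comp -[RHS]imset_id; apply: eq_in_imset => x xP /=; exact: f'K.
rewrite -el -imset_comp -[RHS]imset_id; apply: eq_in_imset => l lg /=.
rewrite -imset_comp -[RHS]imset_id; apply: eq_in_imset => x xl /=.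
by apply: f'K; apply: subsetP xl; apply: sub.
Qed.

Lemma geom_isomorphic_trans (T U V : finType) (g : geometry T) (h : geometry U) (k : geometry V) :
  geom_isomorphic g h -> geom_isomorphic h k -> geom_isomorphic g k.
Proof.
move=> /geom_isomorphicP[f [inj ep el]] /geom_isomorphicP[f1 [inj1 ep1 el1]].
apply/geom_isomorphicP; exists (f1 \o f); split.
- move=> x y xP yP /= e; apply: inj => //; apply: inj1 e; rewrite -ep; exact: imset_f.
- by rewrite -ep1 -ep -imset_comp.
rewrite -el1 -el -imset_comp; apply: eq_imset => l /=; exact: imset_comp.
Qed.

End Isomorphism.

(* Permutations of 100 points as tables, and centralizers in J_2 *)
Opaque T pts hj_reach hj_tab hj_edges qtabs tA tB tBV tz edge papp reach assignments.

Lemma eqfP s t : reflect (s = t) (eqf s t).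
Proof.
have feqbP a b : reflect (a = b) (feqb a b) by case: a b => [] []; constructor.
elim: s t => [|a s IH] [|b t]; try by constructor.
rewrite /=; case: feqbP => [->|n]; last by constructor=> -[].
by apply: (iffP (IH t)) => [->|[]].
Qed.

Lemma beqP b c : Bool.eqb b c -> b = c. Proof. by case: b c => [] []. Qed.
Lemma beq_of b c : b = c -> Bool.eqb b c. Proof. by move=> ->; case: c. Qed.

Lemma codes_uniq : uniq codes. Proof. by []. Qed.
Lemma size_codes : size codes = 100. Proof. by []. Qed.
Opaque codes.

Definition pc (i : 'I_100) := nth [::] codes i.

Lemma pc_codes i : pc i \in codes.
Proof. by rewrite mem_nth // size_codes. Qed.

Lemma codesP c : c \in codes -> exists i, c = pc i.
Proof.
move=> cc; have lt : index c codes < 100 by rewrite -size_codes index_mem.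
by exists (Ordinal lt); rewrite /pc nth_index.
Qed.

Lemma pc_inj : injective pc.
Proof.
by move=> i j /eqP; rewrite /pc nth_uniq ?size_codes ?codes_uniq // => /eqP/val_inj.
Qed.

Lemma find_pc i : find (eqf (pc i)) codes = i.
Proof.
transitivity (index (pc i) codes); last by rewrite index_uniq ?size_codes ?codes_uniq.
by apply: eq_find => c; apply/eqfP/eqP.
Qed.

Transparent papp.
Lemma ctabE F c : c \in codes -> papp (ctab F) c = F c.
Proof.
rewrite /papp /ctab => cc; set t := foldl _ _ _.
suff -> : tfind c t = Some (F c) by [].
rewrite {}/t; elim/last_ind: codes cc => // s d IH.
rewrite mem_rcons inE foldl_rcons tfind_tadd.
by case: eqP => [-> //|_] /= /IH.
Qed.

Opaque papp.

Definition reprs (t : ptab) (s : 'S_100) := forall i, papp t (pc i) = pc (s i).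

Lemma repr_id : reprs idtab 1.
Proof. by move=> i; rewrite ctabE ?pc_codes // perm1. Qed.

Lemma repr_comp t u s r : reprs t s -> reprs u r -> reprs (tcomp t u) (s * r).
Proof. by move=> ts ur i; rewrite ctabE ?pc_codes // ts ur permM. Qed.

Lemma repr_conj t d d' s r : reprs t s -> reprs d r -> reprs d' r^-1 -> reprs (tconj t d d') (s ^ r).
Proof. by move=> ts dr dr' i; rewrite ctabE ?pc_codes // dr' ts dr conjgE !permM. Qed.

Lemma repr_eq t u s r : reprs t s -> reprs u r -> teqb t u = (s == r).
Proof.
move=> ts ur; apply/allP/eqP => [H|e c /codesP[i ->]].
  by apply/permP=> i; apply: pc_inj; rewrite -ts -ur; apply/eqfP/H/pc_codes.
by rewrite ts ur e; apply/eqfP.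
Qed.

Lemma repr_comm t u s r : reprs t s -> reprs u r -> tcommb t u = (s * r == r * s).
Proof.
move=> ts ur; apply/allP/eqP => [H|e c /codesP[i ->]].
  apply/permP=> i; apply: pc_inj; rewrite !permM -ur -ts -ts -ur.
  by apply/esym/eqfP/H/pc_codes.
by rewrite ts ur ur ts -!permM e; apply/eqfP.
Qed.

Lemma cycle_permE (c : seq nat) i : all (fun y => y.-1 <= 99) c ->
  val (cycle_perm c i) = cycle_eval c i.
Proof.
rewrite /cycle_perm /cycle_eval; case: c => [|h s] /=; first by rewrite big_nil perm1.
case/andP=> h99; elim: s i => [|y s IH] i /=; first by rewrite big_nil perm1.
case/andP=> y99 s99; rewrite big_cons permM IH //; congr foldl.
rewrite /swapn -!/(_ == _) permE /=.
have e (k : nat) : k <= 99 -> (i == inord k) = (i == k :> nat).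
  by move=> k99; rewrite -val_eqE /= inordK.
by rewrite !e //; case: ifP => _; [|case: ifP => _]; rewrite ?inordK.
Qed.

Lemma cycles_permE cs i : cycles_ok cs ->
  val ((\prod_(c <- cs) cycle_perm c) i) = cycles_eval cs i.
Proof.
rewrite /cycles_eval; elim: cs i => [|c cs IH] i /=; first by rewrite big_nil perm1.
by case/andP=> cok csok; rewrite big_cons permM IH // cycle_permE.
Qed.

Lemma repr_tA : reprs tA J2_a.
Proof.
have /and4P[ok _ _ _] := J2_gens_check.
move=> i; rewrite tAE.
by rewrite ctabE ?pc_codes // find_pc -(cycles_permE _ ok).
Qed.

Lemma repr_tB : reprs tB J2_b.
Proof.
have /and4P[_ ok _ _] := J2_gens_check.
move=> i; rewrite tBE.
by rewrite ctabE ?pc_codes // find_pc -(cycles_permE _ ok).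
Qed.

Lemma repr_tBV : reprs tBV (J2_b * J2_b).
Proof.
rewrite tBVE.
exact: repr_comp repr_tB repr_tB.
Qed.

Definition zS : 'S_100 :=
  let w := J2_a * (J2_b * (J2_a * (J2_b * J2_b))) in (w * (w * w)) * (w * (w * w)).

Lemma repr_tz : reprs tz zS.
Proof.
rewrite tzE.
have rw : reprs _ _ := repr_comp repr_tA (repr_comp repr_tB (repr_comp repr_tA repr_tBV)).
have rww : reprs _ _ := repr_comp rw (repr_comp rw rw); exact: (repr_comp rww rww).
Qed.

Lemma J2_gens_inv : J2_a^-1 = J2_a /\ J2_b^-1 = J2_b * J2_b.
Proof.
have /and4P[_ _ aa bb] := J2_gens_check.
rewrite (repr_eq (repr_comp repr_tA repr_tA) repr_id) in aa.
rewrite (repr_eq (repr_comp repr_tB repr_tBV) repr_id) in bb.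
by split; apply/eqP; rewrite eq_invg_mul.
Qed.

Lemma zS_J2 : zS \in J2.
Proof.
have aJ : J2_a \in J2 by rewrite mem_gen ?inE ?eqxx.
have bJ : J2_b \in J2 by rewrite mem_gen ?inE ?eqxx ?orbT.
by rewrite /zS !groupM.
Qed.

Lemma zS_order : #[zS] = 2.
Proof.
have /andP[z1 zz] := tz_check.
rewrite (repr_eq repr_tz repr_id) in z1.
rewrite (repr_eq (repr_comp repr_tz repr_tz) repr_id) in zz.
by apply: nt_prime_order => //; apply/eqP.
Qed.

Definition pedge (i j : 'I_100) := locked edge (pc i) (pc j).

Lemma pedgeE i j : pedge i j = edge (pc i) (pc j).
Proof. by rewrite /pedge -lock. Qed.

Lemma gens_edge i j : pedge (J2_a i) (J2_a j) = pedge i j /\ pedge (J2_b i) (J2_b j) = pedge i j.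
Proof.
have /andP[ea eb] := allP (allP edge_check _ (pc_codes i)) _ (pc_codes j).
rewrite !repr_tA in ea; rewrite !repr_tB in eb; rewrite !pedgeE.
by split; [exact: (beqP ea) | exact: (beqP eb)].
Qed.

Lemma J2_edge s i j : s \in J2 -> pedge (s i) (s j) = pedge i j.
Proof.
move=> sJ; move: i j; elim/gen_ind: s / sJ => [|s t IH tg] i j; first by rewrite !perm1.
rewrite !permM -[RHS]IH; move: (s i) (s j) => {IH}k l; have [ea eb] := gens_edge k l.
by case/set2P: tg => ->.
Qed.

Section Centralizer.

Variables (I : eqType) (qs : seq I) (tab : I -> ptab) (prm : I -> 'S_100) (t : 'S_100).
Hypothesis qsP : forall q, q \in qs -> reprs (tab q) (prm q) /\ commute (prm q) t.
Hypothesis tJ : t \in J2.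

Definition asg_of (rs : seq 'I_100) := [seq (pc r, pc (t r)) | r <- rs].

Lemma extend_ok_of rs r : extend_ok (idtab :: [seq tab q | q <- qs]) (asg_of rs) (pc r) (pc (t r)).
Proof.
have main (q : 'S_100) k : commute q t -> edge (pc (q r)) (pc k) = edge (pc (q (t r))) (pc (t k)).
  by move=> c; rewrite -!pedgeE -(J2_edge (q r) k tJ) -!permM c.
have consE f : all f (idtab :: [seq tab q | q <- qs]) = f idtab && all (preim tab f) qs.
  by rewrite -all_map.
apply/allP=> _ /mapP[k _ ->]; rewrite consE; apply/andP; split.
  by rewrite !repr_id; apply: beq_of; apply: main; apply: commute_sym (commute1 t).
apply/allP=> q /qsP[qr qt]; rewrite /= !qr; apply: beq_of; exact: main.
Qed.

Transparent assignments.
Arguments extend_ok : simpl never.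
(** Completeness of the backtracking: no test discards the values of a permutation in J_2 that
    commutes with every [prm q]. Assignments are accumulated backwards, hence [rev]. *)
Lemma assignments_of rs ds :
  rev (asg_of (rs ++ ds)) \in assignments [seq tab q | q <- qs] [seq pc r | r <- ds] (rev (asg_of rs)).
Proof.
elim: ds rs => [|d ds IH] rs /=; first by rewrite cats0 inE.
apply/flattenP; exists (assignments [seq tab q | q <- qs] [seq pc r | r <- ds] (rev (asg_of (rcons rs d)))).
  apply/mapP; exists (pc (t d)); first exact: pc_codes.
  have -> : (pc d, pc (t d)) :: rev (asg_of rs) = rev (asg_of (rcons rs d)).
    by rewrite /asg_of map_rcons rev_rcons.
  have -> : rev (asg_of (rcons rs d)) = asg_of (rev (rcons rs d)) by rewrite /asg_of map_rev.
  rewrite extend_ok_of ifT // all_map; apply/allP=> q /qsP[qr qt].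
  rewrite /= !qr; apply: beq_of; rewrite -permM -qt permM.
  by apply/eqfP/eqfP => [/pc_inj->|/pc_inj/perm_inj->].
by rewrite -cat_rcons; apply: IH.
Qed.

Opaque assignments.

(** Two permutations that commute with a group and agree at one point agree on its orbit. *)
Lemma orbit_eq u rs i :
    (forall q, q \in qs -> commute (prm q) u) -> {in rs, forall r, t r = u r} ->
    (exists2 r, r \in [seq pc r | r <- rs] &
       isome (tfind (pc i) (reach id [seq papp t | t <- [seq tab q | q <- qs]] 100 r))) ->
  t i = u i.
Proof.
move=> uq ur [_ /mapP[r rrs ->]]; case eT: tfind => [d|//] _.
have {eT}H := reachP (R := fun c => exists2 k, c = pc k & t k = u k) _ _ eT; case: H.
- move=> _ [k -> tk]; rewrite -map_comp; elim: qs qsP uq => //= q s IH sP uq; split.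
    have [qr qt] := sP q (mem_head _ _); exists (prm q k); first by rewrite qr.
    by rewrite -!permM qt (uq q (mem_head _ _)) !permM tk.
  by apply: IH => p ps; [apply: sP | apply: uq]; rewrite inE ps orbT.
- by exists r; rewrite ?ur.
by case=> k -> tk /pc_inj <-.
Qed.

End Centralizer.

Lemma cent_qs (I : eqType) (qs : seq I) (tab : I -> ptab) (prm : I -> 'S_100) t :
    (forall q, q \in qs -> reprs (tab q) (prm q) /\ commute (prm q) t) -> t \in J2 ->
    (forall q, q \in qs -> commute (prm q) zS) -> [seq tab q | q <- qs] = qtabs ->
  t = 1 \/ t = zS.
Proof.
move=> qsP tJ qz qsE; have [rs rsE] : exists rs, [seq pc r | r <- rs] = orbit_reps.
  have {qsE}: {subset orbit_reps <= codes} by apply/allP.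
  elim: orbit_reps => [|r s IH] sub; first by exists [::].
  have [|rs <-] := IH; first by move=> x xs; apply: sub; rewrite inE xs orbT.
  by have [i ->] := codesP (sub r (mem_head _ _)); exists (i :: rs).
have main u : (forall q, q \in qs -> commute (prm q) u) -> {in rs, forall r, t r = u r} -> t = u.
  move=> uq ur; apply/permP=> i; apply: (orbit_eq qsP uq ur).
  rewrite rsE qsE; exact: orbit_reps_reached (pc_codes i).
have aq u : {in rs, forall r, pc (t r) = pc (u r)} -> {in rs, forall r, t r = u r}.
  by move=> {qsE rsE main}H r rrs; apply/pc_inj/H.
have := assignments_of qsP tJ [::] rs; rewrite qsE rsE.
move/(allP assignments_checked); rewrite {qsE}/asg_of cat0s => /orP A.
have {}A : {in rs, forall r, pc (t r) = pc ((1 : 'S_100) r)} \/ {in rs, forall r, pc (t r) = pc (zS r)}.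
  case: A => /allP H; [left|right] => r rrs.
    rewrite perm1; apply/esym/eqfP; apply: (H (pc r, pc (t r))).
    by rewrite mem_rev; apply: (map_f (fun r => (pc r, pc (t r)))).
  rewrite -repr_tz; apply/esym/eqfP; apply: (H (pc r, pc (t r))).
  by rewrite mem_rev; apply: (map_f (fun r => (pc r, pc (t r)))).
case: A => /aq H; [left|right]; apply: main H; last exact: qz.
by move=> q _; apply: commute1.
Qed.

Lemma tchain_pgroup (I : eqType) (tab : I -> ptab) (prm : I -> 'S_100)
    (rest prefix : seq I) :
    {in prefix ++ rest, forall p, reprs (tab p) (prm p) /\ prm p * prm p = 1} ->
    tchain [seq tab p | p <- prefix] [seq tab p | p <- rest] ->
    2.-group <<[set x in [seq prm p | p <- prefix]]>> ->
  2.-group <<[set x in [seq prm p | p <- catrev rest prefix]]>>.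
Proof.
elim: rest prefix => [|p rest IH] prefix //= H /andP[]; rewrite all_map => /allP c ch pp.
have [pr p2] : reprs (tab p) (prm p) /\ prm p * prm p = 1 by apply: H; rewrite mem_cat mem_head orbT.
apply: IH => //.
  move=> q; rewrite mem_cat inE => q_; apply: H; rewrite mem_cat inE.
  by case/orP: q_ => [/orP[]->|->]; rewrite ?orbT.
rewrite map_cons; apply: pgroup_cons => //.
  rewrite /p_elt; case: (eqVneq (prm p) 1) => [->|n]; first by rewrite order1.
  by rewrite (@nt_prime_order _ 2 (prm p)).
move=> _ /mapP[q qp ->]; have inH q' : q' \in prefix -> reprs (tab q') (prm q') by move=> q'p; case: (H q'); rewrite ?mem_cat ?q'p.
have qr := inH _ qp.
have := c q qp; rewrite /= has_map => /hasP[q' q'p /=].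
have q'r := inH _ q'p.
have pV : reprs (tab p) (prm p)^-1 by have -> : (prm p)^-1 = (prm p) by apply/eqP; rewrite eq_invg_mul p2.
by rewrite (repr_eq (repr_conj qr pr pV) q'r) => /eqP->; apply: map_f.
Qed.

Opaque patterns codes papp reach edge.
Opaque T pts x0_orbit u1_orbit v1_orbit u2_orbit u3_orbit.
Arguments reach : simpl never.

(** * The near octagon of a group acting on octonions *)

Lemma T_eself l e : tfind (lkey l) T = Some e -> eself e = l.
Proof. by move/(tallP T_keys)/keqbP/lkey_inj. Qed.

Lemma pts_find e : e \in pts -> tfind (lkey (eself e)) T = Some e.
Proof. by case/telemsP=> k eT; rewrite -(keqbP (tallP T_keys eT)). Qed.

Lemma find_pts l e : tfind (lkey l) T = Some e -> e \in pts.
Proof. exact: mem_telems. Qed.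

Lemma inXP l : reflect (exists2 e, e \in pts & eself e = l) (inX l).
Proof.
rewrite /inX; case eT: tfind => [e|]; constructor.
  by exists e; [apply: find_pts eT | apply: T_eself eT].
by case=> e /pts_find eT' el; rewrite el eT in eT'.
Qed.

(* Locking keeps conversion from unfolding the tables. *)
Definition X : seq lab := locked [seq eself e | e <- pts].
Definition nbrs : lab -> seq (lab * lab) := locked nbrsT.
Definition dist : lab -> nat := locked dist0.

Lemma mem_X l : (l \in X) = inX l.
Proof.
rewrite /X -lock; apply/mapP/inXP => [[e ep ->]|[e ep <-]]; first by exists e.
by exists e.
Qed.

Lemma uniq_X : uniq X.
Proof. by rewrite /X -lock; apply: (@map_uniq _ _ sig); rewrite -map_comp; apply: nodup_keysP nodup_sig. Qed.

Lemma sig_inj : {in X &, injective sig}.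
Proof. by apply: uniq_map_inj; rewrite /X -lock -map_comp; apply: nodup_keysP nodup_sig. Qed.

Arguments epsf : simpl never.
Arguments lact : simpl never.
Arguments omul8 : simpl never.

Lemma commute_withP l m : commute_with (epsf l) (epsf m) ->
  forall x, epsf l (epsf m x) = epsf m (epsf l x).
Proof. by move/agreeP => H x; apply: H => y y'; rewrite !epsfD. Qed.

Section Group.

Variables (gT : finGroupType) (G : {group gT}) (act : gT -> oct -> oct).
Hypothesis act1 : forall x, act 1 x = x.
Hypothesis actM : forall g h x, act (g * h) x = act h (act g x).
Hypothesis act_inj : forall g h, act g =1 act h -> g = h.
Hypothesis act_semi : forall g, g \in G -> semi (act g).
Hypothesis act_surj : forall f f', semi f -> cancel f f' -> exists2 g, g \in G & act g =1 f.

Lemma actK g : cancel (act g) (act g^-1).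
Proof. by move=> x; rewrite -actM mulgV act1. Qed.
Lemma actVK g : cancel (act g^-1) (act g).
Proof. by move=> x; rewrite -actM mulVg act1. Qed.

Lemma act_additive g : g \in G -> oadditive (act g).
Proof. by case/act_semi. Qed.

(* The element of [G] acting as [f] (and 1 when there is none). *)
Definition elt (f : oct -> oct) : gT := odflt 1 [pick g in G | agree (act g) f].

Definition realizable f := elt f \in G /\ act (elt f) =1 f.

Lemma eltP f g : g \in G -> act g =1 f -> elt f = g.
Proof.
move=> Gg gf; have fD : oadditive f.
  by move=> x y; rewrite -!gf (act_additive Gg).
rewrite /elt; case: pickP => [h /andP[Gh /agreeP hf]|/(_ g)] /=.
  by apply: act_inj => x; rewrite gf hf //; apply: act_additive.
by rewrite Gg /=; case/agreeP => //; apply: act_additive.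
Qed.

Lemma realizableP f g : g \in G -> act g =1 f -> realizable f.
Proof. by move=> Gg gf; split; rewrite (eltP Gg gf). Qed.

Lemma semi_realizable f f' : semi f -> cancel f f' -> realizable f.
Proof. by move=> /act_surj H /H[g]; apply: realizableP. Qed.

Definition eps l := elt (epsf l).

Definition good l := null_pair l /\ realizable (epsf l).

Lemma act_tableP f k l : tfind k (act_table f) = Some l ->
  exists2 m, m \in X & k = lkey m /\ l = lact f m.
Proof.
rewrite /act_table.
have: forall m, m \in [seq eself e | e <- pts] -> m \in X by rewrite /X -lock.
have: tfind k (Tip : trie lab) = Some l -> exists2 m, m \in X & k = lkey m /\ l = lact f m by [].
elim: pts Tip => //= e s IH t Ht sX.
apply: IH => [|m ms]; last by apply: sX; rewrite inE ms orbT.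
rewrite tfind_tadd; case: eqP => [-> [<-]|_ /Ht //].
by exists (eself e); first by apply: sX; rewrite mem_head.
Qed.

Definition snbrs l := take 2 (nbrs l).
Definition wnbrs l := drop 2 (nbrs l).

Lemma nbrsE e : e \in pts -> nbrs (eself e) = enbrs e.
Proof. by rewrite /nbrs -lock /nbrsT /nbrs_in => /pts_find->. Qed.

Lemma nbrs_cat l : nbrs l = snbrs l ++ wnbrs l.
Proof. by rewrite cat_take_drop. Qed.

Lemma peqbP m n : peqb m n -> m = n.
Proof. by case: m n => [a b] [c d] /andP[/leqbP /= -> /leqbP /= ->]. Qed.

Lemma table_nbrs f (nb nb' : seq (lab * lab)) :
    {in nb, forall m, (if tfind (lkey m.1) (act_table f) is Some m1 then
      if tfind (lkey m.2) (act_table f) is Some m2 then has (peqb (m1, m2)) nb'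
      else false else false)} -> forall m, m \in nb ->
  [/\ m.1 \in X, m.2 \in X & (lact f m.1, lact f m.2) \in nb'].
Proof.
move=> K m /K; case m1T: tfind => [m1|//]; case m2T: tfind => [m2|//].
have [n1 n1X [/lkey_inj-> ->]] := act_tableP m1T.
have [n2 n2X [/lkey_inj-> ->]] := act_tableP m2T.
by move=> {K m1T m2T} /hasP[m' m'nb /peqbP->].
Qed.

Lemma preserves_nbrsP f l : preserves_nbrs f -> l \in X ->
  lact f l \in X /\
  (forall m, m \in snbrs l ->
     [/\ m.1 \in X, m.2 \in X & (lact f m.1, lact f m.2) \in snbrs (lact f l)]) /\
  (forall m, m \in wnbrs l ->
     [/\ m.1 \in X, m.2 \in X & (lact f m.1, lact f m.2) \in wnbrs (lact f l)]).
Proof.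
rewrite mem_X => /allP H /inXP[e ep <-]; move/(_ e ep): H.
case lT: tfind => [l'|//]; have [m _ [/lkey_inj<- {m}->]] := act_tableP lT; move=> {lT}.
case eT: tfind => [e'|//] /andP[/allP Hs /allP Hw].
have e'X := find_pts eT; have e'E := T_eself eT; move=> {eT}.
rewrite /snbrs /wnbrs -e'E (nbrsE ep) (nbrsE e'X); split; first by rewrite mem_X; apply/inXP; exists e'.
by split; [exact: (table_nbrs Hs) | exact: (table_nbrs Hw)].
Qed.

Lemma good_act l g : good l -> g \in G ->
  good (lact (act g) l) /\ eps l ^ g = eps (lact (act g) l).
Proof.
move=> [sl [Gl actl]] Gg; have sg := act_semi Gg.
have e : act (eps l ^ g) =1 epsf (lact (act g) l).
  move=> x; rewrite conjgE !actM actl -epsf_lact //.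
  by rewrite actVK.
have Gc : eps l ^ g \in G by rewrite groupJ.
split; last by rewrite [RHS](eltP Gc e).
by split; [apply: lact_null_pair | apply: realizableP e].
Qed.

Lemma epsf_semi l : mulcheck (epsf l) -> semi (epsf l).
Proof. by apply: linear_semi; [apply: epsf_additive | apply: epsf_linear]. Qed.

Lemma kapf_real : realizable kapf.
Proof.
(* [kapf] has order 6, so its fifth power is its inverse. *)
apply: (@semi_realizable _ (fun x => kapf (kapf (kapf (kapf (kapf x)))))); last by case.
apply: linear_semi mulcheck_kapf; first by move=> [????????] [????????].
by move=> k [????????].
Qed.

Lemma les_good : good les.
Proof.
have sl : null_pair les by [].
by split=> //; apply: semi_realizable (epsf_invol sl); apply: epsf_semi mulcheck_les.
Qed.

Lemma x0_good : good x0.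
Proof.
have sl : null_pair x0 by [].
by split=> //; apply: semi_realizable (epsf_invol sl); apply: epsf_semi mulcheck_x0.
Qed.

Lemma ofrob_real : realizable ofrob.
Proof.
apply: (@semi_realizable _ ofrob); first exact: ofrob_semi.
by move=> [a1 a2 a3 a4 a5 a6 a7 a8]; rewrite /=; congr Oct; [move: a1|move: a2|move: a3|
  move: a4|move: a5|move: a6|move: a7|move: a8]; case.
Qed.

Definition Gam : {group gT} := <<[set x in [:: elt kapf; eps les; eps x0; elt ofrob]]>>%G.

Lemma Gam_gen : [/\ elt kapf \in Gam, eps les \in Gam, eps x0 \in Gam & elt ofrob \in Gam].
Proof. by split; apply: mem_gen; rewrite !inE eqxx ?orbT. Qed.

Lemma Gam_sub : Gam \subset G.
Proof.
rewrite gen_subG; apply/subsetP => x; rewrite !inE.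
case/or4P => /eqP->; [by case: kapf_real | by case: les_good => _ [] |
  by case: x0_good => _ [] | by case: ofrob_real].
Qed.

Lemma act_elt_lact f l : realizable f -> lact f l = lact (act (elt f)) l.
Proof. by case=> _ fE; case: l => a b; rewrite /lact !fE. Qed.

Definition conj_from l0 (H : {set gT}) l := good l /\ exists2 g, g \in H & eps l0 ^ g = eps l.

Lemma conj_from_step l0 (H : {group gT}) f l : realizable f -> elt f \in H ->
  conj_from l0 H l -> conj_from l0 H (lact f l).
Proof.
move=> fr fH [gl [g gH eg]]; rewrite (act_elt_lact _ fr).
case: fr => fG _; have [gl' e'] := good_act gl fG.
by split=> //; exists (g * elt f); rewrite ?groupM // conjgM eg.
Qed.

Lemma X_conj l : l \in X -> conj_from x0 Gam l.
Proof.
rewrite mem_X => /inXP[e /pts_reached + <-].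
case eT: tfind => [l'|//] _.
rewrite x0_orbitE in eT.
have [] := reachP (R := conj_from x0 Gam) _ _ eT.
- move=> l1 R1; case: Gam_gen => g1 g2 _ _.
  split; first exact: conj_from_step kapf_real g1 R1.
  by split; first exact: conj_from_step (proj2 les_good) g2 R1.
- by split; [apply: x0_good | exists 1; rewrite ?conjg1].
by move=> H /lkey_inj <-.
Qed.

Lemma X_good l : l \in X -> good l. Proof. by case/X_conj. Qed.

Lemma eps_Gam l : l \in X -> eps l \in Gam.
Proof. by case/X_conj=> _ [g gG <-]; case: Gam_gen => _ _ x0G _; rewrite groupJ. Qed.

Lemma eps_G l : l \in X -> eps l \in G.
Proof. by case/X_good=> _ []. Qed.

Lemma act_eps l : l \in X -> act (eps l) =1 epsf l.
Proof. by case/X_good=> _ []. Qed.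

Lemma eps_inj : {in X &, injective eps}.
Proof.
move=> l m lX mX lm; apply: sig_inj => //.
have e x : epsf l x = epsf m x by rewrite -act_eps // -act_eps // lm.
by rewrite /sig !e.
Qed.

Lemma x0X : x0 \in X. Proof. by rewrite mem_X; compute_bool. Qed.

Lemma act_omul g x y : g \in G -> act g (omul8 x y) = omul8 (act g x) (act g y).
Proof. by case/act_semi. Qed.

Lemma act0 g : g \in G -> act g ozero = ozero.
Proof. by move=> Gg; apply/oadditive0/act_additive. Qed.

Lemma act_one g : g \in G -> act g oone = oone.
Proof.
move=> Gg; rewrite -[LHS]omul1 -{2}(actVK g oone) -act_omul // mul1o.
exact: actVK.
Qed.

Lemma act_eq0 g x : g \in G -> (act g x == ozero) = (x == ozero).
Proof. by move=> Gg; rewrite -{1}(act0 Gg) (can_eq (actK g)). Qed.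

Lemma reach_stab (ws : seq oct) (ls : seq lab) n v0 k v :
    {subset ls <= X} -> fixes ws ls ->
    tfind k (reach okey [seq epsf l | l <- ls] n v0) = Some v ->
  (exists2 s, s \in Gam & {in ws, forall w, act s w = w} /\ act s v0 = v) /\ okey v = k.
Proof.
move=> lX lws eT.
pose R v := exists2 s, s \in Gam & {in ws, forall w, act s w = w} /\ act s v0 = v.
suff R_step v' : R v' -> foldr (fun f P => R (f v') /\ P) True [seq epsf l | l <- ls].
  apply: (reachP R_step _ eT).
  by exists 1; rewrite // act1; split=> // w _; rewrite act1.
move=> Rv; elim: ls lX lws {eT} => //= l ls IH lX /andP[/allP lw lws]; split; last first.
  by apply: IH => // m mls; apply: lX; rewrite inE mls orbT.
have {}lX : l \in X by apply: lX; rewrite mem_head.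
case: Rv => s sG [sw sv]; exists (s * eps l); first by rewrite groupM ?eps_Gam.
split=> [w wws|]; last by rewrite actM sv act_eps.
by rewrite actM sw // act_eps //; apply/oeqbP/lw.
Qed.

Lemma u1_trans x : omul8 x x = ozero -> x != ozero -> exists2 s, s \in Gam & act s u1 = x.
Proof.
move=> x2 xn0; have := null_reached x2 xn0; case eT: tfind => [y|//] _.
rewrite u1_orbitE in eT.
have [] := reachP (R := fun v => exists2 s, s \in Gam & act s u1 = v) _ _ eT.
- move=> {eT y}y [s sG <-]; case: Gam_gen => g1 g2 _ _.
  split; first by exists (s * elt kapf); rewrite ?groupM // actM; case: kapf_real.
  split=> //; exists (s * eps les); rewrite ?groupM // actM.
  by case: les_good => _ [].
- by exists 1; rewrite ?act1.
by move=> H /okey_inj <-.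
Qed.

Lemma stab_reduce (ws : seq oct) (ls : seq lab) v0 r g :
    r = reach okey [seq epsf l | l <- ls] 100 v0 ->
    {subset ls <= X} -> fixes ws ls ->
    {in ws, forall w, act g w = w} -> isome (tfind (okey (act g v0)) r) ->
  exists2 s, s \in Gam & {in v0 :: ws, forall w, act (g * s) w = w}.
Proof.
move=> -> lX lws gw; case eT: tfind => [y|//] _.
have [[s sG [sw sv0]] /okey_inj yv] := reach_stab lX lws eT.
exists s^-1; first by rewrite groupV.
move=> w; rewrite inE actM => /predU1P[->|wws]; first by rewrite -yv -sv0 actK.
by rewrite gw // -{1}(sw _ wws) actK.
Qed.

(** Invariance of the tables is checked only under the generators of [Gam]. An element of G is
    multiplied by elements of [Gam] until it fixes [u1], [v1], [u2] and [u3] in turn; then only 1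
    and the Frobenius map remain. *)
Lemma G_Gam : G \subset Gam.
Proof.
apply/subsetP => g Gg.
have sub_sls1 : {subset sls1 <= X} by move=> l /(allP sls1_pts); rewrite mem_X.
have sub_sls2 : {subset sls2 <= X} by move=> l /(allP sls2_pts); rewrite mem_X.
have sub_sls3 : {subset sls3 <= X} by move=> l /(allP sls3_pts); rewrite mem_X.
have GS := subsetP Gam_sub.
have sq h w : h \in G -> omul8 w w = ozero -> omul8 (act h w) (act h w) = ozero.
  by move=> Gh w2; rewrite -act_omul // w2 act0.
have [s1 s1G gs1] : exists2 s, s \in Gam & {in [:: u1], forall w, act (g * s) w = w}.
  have [||s sG su] := @u1_trans (act g u1); [exact: sq | by rewrite act_eq0 |].
  by exists s^-1; rewrite ?groupV // => w; rewrite inE => /eqP->; rewrite actM -su actK.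
move: (groupM Gg (GS _ s1G)) => {Gg}.
rewrite -(groupMr _ s1G); move: (g * s1) gs1 => {s1 s1G g}g gu1 Gg.
have gu1E : act g u1 = u1 by apply: gu1; rewrite mem_head.
have [|s2 s2G gs2] := stab_reduce v1_orbitE sub_sls1 sls1_fix gu1.
  apply: v1_reached; first exact: sq.
  by rewrite -{1 2}gu1E -!act_omul // -act_additive // -[RHS](act_one Gg).
move: (groupM Gg (GS _ s2G)) => {Gg}.
rewrite -(groupMr _ s2G); move: (g * s2) gs2 => {s2 s2G gu1 gu1E g}g gv1 Gg.
have gv1E : act g v1 = v1 by apply: gv1; rewrite mem_head.
have gu1E : act g u1 = u1 by apply: gv1; rewrite !inE eqxx orbT.
have geE : act g u1v1 = u1v1 by rewrite act_omul // gu1E gv1E.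
have [|s3 s3G gs3] := stab_reduce u2_orbitE sub_sls2 sls2_fix gv1.
  apply: u2_reached; first exact: sq.
  - by rewrite -{1}geE -act_omul.
  - by rewrite -{1}geE -act_omul // -[RHS](act0 Gg).
  - by rewrite -{1 2}gv1E -!act_omul // -act_additive // -[RHS](act0 Gg).
  by rewrite act_eq0.
move: (groupM Gg (GS _ s3G)) => {Gg}.
rewrite -(groupMr _ s3G); move: (g * s3) gs3 => {s3 s3G gv1 gv1E gu1E geE g}g gu2 Gg.
have gu2E : act g u2 = u2 by apply: gu2; rewrite mem_head.
have gv1E : act g v1 = v1 by apply: gu2; rewrite !inE eqxx ?orbT.
have gu1E : act g u1 = u1 by apply: gu2; rewrite !inE eqxx ?orbT.
have geE : act g u1v1 = u1v1 by rewrite act_omul // gu1E gv1E.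
have [|s4 s4G gs4] := stab_reduce u3_orbitE sub_sls3 sls3_fix gu2.
  apply: u3_reached; first exact: sq.
  - by rewrite -{1}geE -act_omul.
  - by rewrite -{1}geE -act_omul // -[RHS](act0 Gg).
  by rewrite -{1}gu2E -act_omul // -[RHS]gv1E.
move: (groupM Gg (GS _ s4G)) => {Gg}.
rewrite -(groupMr _ s4G); move: (g * s4) gs4 => {s4 s4G gu2 gu2E gv1E gu1E geE g}g gu3 Gg.
have g4 : [/\ act g u1 = u1, act g u2 = u2, act g u3 = u3 & act g v1 = v1].
  by split; apply: gu3; rewrite !inE eqxx ?orbT.
case: g4 => g1 g2 g3 g5.
(* The remaining basis octonions are products of the four fixed ones. *)
have gv2 : act g v2 = v2 by rewrite -[v2]/(omul8 u3 u1) act_omul // g3 g1.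
have gv3 : act g v3 = v3 by rewrite -[v3]/(omul8 u1 u2) act_omul // g1 g2.
have ge : act g u1v1 = u1v1 by rewrite act_omul // g1 g5.
have ge' : act g (omul8 v1 u1) = omul8 v1 u1 by rewrite act_omul // g1 g5.
have [] := semi_basis (act_semi Gg).
- move=> e; rewrite !inE => /or4P[/eqP->|/eqP->|/eqP->|] //.
  by case/or4P=> [/eqP->|/eqP->|/eqP->|] //; case/orP=> /eqP->.
- by move=> g_id; rewrite (_ : g = 1) ?group1 //; apply: act_inj => x; rewrite g_id act1.
by move=> /(eltP Gg) <-; case: Gam_gen.
Qed.

(** * Points, neighbours and transitivity *)

Definition P : {set gT} := [set x in [seq eps l | l <- X]].

(** The inverse of [eps] on [P]; elements outside [P] get the default [x0]. *)
Definition lbl (x : gT) : lab := nth x0 X (index x [seq eps l | l <- X]).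

Lemma PP x : reflect (exists2 l, l \in X & x = eps l) (x \in P).
Proof. by rewrite inE; apply: mapP. Qed.

Lemma eps_P l : l \in X -> eps l \in P. Proof. by move=> lX; apply/PP; exists l. Qed.

Lemma lblK l : l \in X -> lbl (eps l) = l.
Proof.
move=> lX; have uX : uniq [seq eps l | l <- X].
  by rewrite map_inj_in_uniq ?uniq_X //; apply: eps_inj.
have {1}-> : l = nth x0 X (index l X) by rewrite nth_index.
rewrite -(nth_map x0 1) ?index_mem // /lbl index_uniq ?nth_index ?size_map ?index_mem //.
Qed.

Lemma epsK x : x \in P -> eps (lbl x) = x.
Proof. by case/PP=> l lX ->; rewrite lblK. Qed.

Lemma lbl_X x : x \in P -> lbl x \in X.
Proof. by case/PP=> l lX ->; rewrite lblK. Qed.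

Lemma card_P : #|P| = 4095.
Proof.
rewrite cardsE; have /card_uniqP-> : uniq [seq eps l | l <- X].
  by rewrite map_inj_in_uniq ?uniq_X //; apply: eps_inj.
by rewrite size_map /X -lock size_map size_pts.
Qed.

Lemma P_G : P \subset G.
Proof. by apply/subsetP => _ /PP[l lX ->]; apply: eps_G. Qed.

Definition epair (m : lab * lab) := (eps m.1, eps m.2).
Definition snb x := [seq epair m | m <- snbrs (lbl x)].
Definition wnb x := [seq epair m | m <- wnbrs (lbl x)].
Definition nbx x := snb x ++ wnb x.

Definition cpair (g : gT) (q : gT * gT) := (q.1 ^ g, q.2 ^ g).

Definition keeps g := forall x, x \in P ->
  [/\ x ^ g \in P, forall q, q \in snb x -> cpair g q \in snb (x ^ g)
    & forall q, q \in wnb x -> cpair g q \in wnb (x ^ g)].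

Lemma keeps_gen f : realizable f -> preserves_nbrs f -> keeps (elt f).
Proof.
move=> fr pf _ /PP[l lX ->].
have cE m : m \in X -> eps m ^ elt f = eps (lact f m).
  by move=> mX; rewrite (act_elt_lact _ fr); apply: (good_act (X_good mX) (proj1 fr)).2.
have [flX [fs fw]] := preserves_nbrsP pf lX; move=> {pf}.
rewrite cE // /snb /wnb !lblK //; split; first exact: eps_P.
  move=> _ /mapP[m /fs[m1X m2X mm] ->]; apply/mapP.
  by exists (lact f m.1, lact f m.2); rewrite // /cpair /epair /= !cE.
move=> _ /mapP[m /fw[m1X m2X mm] ->]; apply/mapP.
by exists (lact f m.1, lact f m.2); rewrite // /cpair /epair /= !cE.
Qed.

Lemma keepsM g h : keeps g -> keeps h -> keeps (g * h).
Proof.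
move=> kg kh x /kg[xgP gs gw]; have [xghP hs hw] := kh _ xgP.
rewrite conjgM; split=> // q; rewrite /cpair !conjgM.
  by move/gs/hs.
by move/gw/hw.
Qed.

Lemma G_keeps g : g \in G -> keeps g.
Proof.
move/(subsetP G_Gam); move: g; apply: gen_ind => [x xP|g h kg].
  by rewrite conjg1; split=> // q; rewrite /cpair !conjg1; case: q.
rewrite !inE => H; apply: keepsM kg _.
case/or4P: H => /eqP->; apply: keeps_gen.
- exact: kapf_real.
- exact: kapf_nbrs.
- by case: les_good.
- exact: les_nbrs.
- by case: x0_good.
- exact: x0_nbrs.
- exact: ofrob_real.
- exact: ofrob_nbrs.
Qed.

Lemma PJ g x : g \in G -> (x ^ g \in P) = (x \in P).
Proof.
move=> Gg; apply/idP/idP => xP; last by have [] := G_keeps Gg xP.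
by rewrite -(conjgK g x); have [] := G_keeps (groupVr Gg) xP.
Qed.

Lemma cpairK g q : cpair g^-1 (cpair g q) = q.
Proof. by case: q => y z; rewrite /cpair /= !conjgK. Qed.

Lemma snbJ g x q : g \in G -> x \in P -> (cpair g q \in snb (x ^ g)) = (q \in snb x).
Proof.
move=> Gg xP; apply/idP/idP => qx; last by have [_ H _] := G_keeps Gg xP; apply: H.
have [||_ H _] := @G_keeps g^-1 _ (x ^ g); rewrite ?groupV ?PJ //.
by have := H _ qx; rewrite cpairK conjgK.
Qed.

Lemma wnbJ g x q : g \in G -> x \in P -> (cpair g q \in wnb (x ^ g)) = (q \in wnb x).
Proof.
move=> Gg xP; apply/idP/idP => qx; last by have [_ _ H] := G_keeps Gg xP; apply: H.
have [||_ _ H] := @G_keeps g^-1 _ (x ^ g); rewrite ?groupV ?PJ //.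
by have := H _ qx; rewrite cpairK conjgK.
Qed.

Definition z0 := eps x0.
Lemma z0P : z0 \in P. Proof. exact/eps_P/x0X. Qed.

Lemma P_trans x : x \in P -> exists2 g, g \in G & z0 ^ g = x.
Proof.
case/PP=> l /X_conj[_ [g gG eg]] ->; exists g => //.
exact: (subsetP Gam_sub).
Qed.

Lemma P_class : P = z0 ^: G.
Proof.
apply/setP=> x; apply/idP/imsetP => [/P_trans[g Gg <-]|[g Gg ->]]; first by exists g.
by rewrite PJ // z0P.
Qed.

Lemma z0_neq1 : z0 != 1.
Proof.
apply/eqP=> z1; have := act_eps x0X v1; rewrite -/z0 z1 act1; apply/eqP.
by rewrite /epsf; compute_bool.
Qed.

Lemma eltM_act l m x : l \in X -> m \in X ->
  act (eps l * eps m) x = epsf m (epsf l x).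
Proof. by move=> lX mX; rewrite actM !act_eps. Qed.

Lemma order_P x : x \in P -> #[x] = 2.
Proof.
case/P_trans=> g Gg <-; rewrite orderJ; apply: nt_prime_order z0_neq1 => //.
apply: act_inj => v; rewrite expgS expg1 eltM_act ?x0X // act1.
exact: (epsf_invol (proj1 x0_good)).
Qed.

Lemma nbrs_X l m : l \in X -> m \in nbrs l -> m.1 \in X /\ m.2 \in X.
Proof.
move=> lX; have [_ [Hs Hw]] := preserves_nbrsP kapf_nbrs lX.
by rewrite nbrs_cat mem_cat => /orP[/Hs|/Hw] [].
Qed.

Lemma lines_checkP l : l \in X ->
  [/\ size (nbrs l) = 22, uniq (l :: [seq m.1 | m <- nbrs l]),
      (forall m, m \in snbrs l -> (m.2, m.1) \in snbrs l /\ (l, m.2) \in snbrs m.1) &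
      (forall m, m \in wnbrs l -> (m.2, m.1) \in wnbrs l /\ (l, m.2) \in wnbrs m.1)].
Proof.
rewrite mem_X => /inXP[e ep <-]; have /and4P[] := allP lines_check e ep.
rewrite -(nbrsE ep) => /eqnP-> /nodup_keysP u Hs Hw.
have aux (nb : seq (lab * lab)) (sel : seq (lab * lab) -> seq (lab * lab)) :
   all (fun m => has (peqb (m.2, m.1)) (sel nb) &&
     has (peqb (eself e, m.2)) (sel (nbrsT m.1))) (sel nb) ->
   forall m, m \in sel nb -> (m.2, m.1) \in sel nb /\ (eself e, m.2) \in sel (nbrs m.1).
  move=> /allP H m /H /andP[/hasP[m' ? /peqbP->] /hasP[m'' ? /peqbP->]].
  by rewrite /nbrs -lock.
split; [by [] | | exact: (aux _ (take 2)) | exact: (aux _ (drop 2))].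
by apply: (@map_uniq _ _ lkey); rewrite /= -map_comp.
Qed.

Lemma nbx_map x : nbx x = [seq epair m | m <- nbrs (lbl x)].
Proof. by rewrite /nbx /snb /wnb -map_cat -nbrs_cat. Qed.

Lemma size_nbx x : x \in P -> size (nbx x) = 22.
Proof. by case/PP=> l lX ->; rewrite nbx_map size_map lblK //; case: (lines_checkP lX). Qed.

Lemma size_snb x : x \in P -> size (snb x) = 2.
Proof.
case/PP=> l lX ->; rewrite size_map lblK // /snbrs size_take.
by case: (lines_checkP lX) => ->.
Qed.

Lemma size_wnb x : x \in P -> size (wnb x) = 20.
Proof.
case/PP=> l lX ->; rewrite size_map lblK // /wnbrs size_drop.
by case: (lines_checkP lX) => ->.
Qed.

Lemma nbxP x q : x \in P -> q \in nbx x -> q.1 \in P /\ q.2 \in P.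
Proof.
case/PP=> l lX ->; rewrite nbx_map lblK // => /mapP[m /(nbrs_X lX)[m1 m2] ->].
by rewrite !eps_P.
Qed.

Lemma uniq_nbx x : x \in P -> uniq (x :: [seq q.1 | q <- nbx x]).
Proof.
case/PP=> l lX ->; rewrite nbx_map lblK // -map_comp.
have [_ u _ _] := lines_checkP lX.
rewrite (map_comp eps (fun m => m.1)) -(map_cons eps) map_inj_in_uniq //.
have sub : {subset l :: [seq m.1 | m <- nbrs l] <= X}.
  move=> m; rewrite inE => /predU1P[-> //|/mapP[n nl ->]].
  by case: (nbrs_X lX nl).
by move=> m n /sub mX /sub nX; apply: eps_inj.
Qed.

Lemma snb_sym x q : x \in P -> q \in snb x -> (q.2, q.1) \in snb x /\ (x, q.2) \in snb q.1.
Proof.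
case/PP=> l lX ->; rewrite /snb lblK // => /mapP[m ml ->].
have [_ _ /(_ m ml)[m21 lm] _] := lines_checkP lX.
have [m1 m2] : m.1 \in X /\ m.2 \in X.
  by apply: (nbrs_X lX); rewrite nbrs_cat mem_cat ml.
rewrite /= lblK //; split; apply/mapP; first by exists (m.2, m.1).
by exists (l, m.2).
Qed.

Lemma wnb_sym x q : x \in P -> q \in wnb x -> (q.2, q.1) \in wnb x /\ (x, q.2) \in wnb q.1.
Proof.
case/PP=> l lX ->; rewrite /wnb lblK // => /mapP[m ml ->].
have [_ _ _ /(_ m ml)[m21 lm]] := lines_checkP lX.
have [m1 m2] : m.1 \in X /\ m.2 \in X.
  by apply: (nbrs_X lX); rewrite nbrs_cat mem_cat ml orbT.
rewrite /= lblK //; split; apply/mapP; first by exists (m.2, m.1).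
by exists (l, m.2).
Qed.

Lemma nbx_sym x q : x \in P -> q \in nbx x -> (q.2, q.1) \in nbx x /\ (x, q.2) \in nbx q.1.
Proof.
move=> xP; rewrite !mem_cat => /orP[/(snb_sym xP)[-> ->]|/(wnb_sym xP)[-> ->]];
  by rewrite ?orbT.
Qed.

Lemma nbxJ g x q : g \in G -> x \in P -> (cpair g q \in nbx (x ^ g)) = (q \in nbx x).
Proof. by move=> Gg xP; rewrite !mem_cat snbJ // wnbJ. Qed.

Lemma nbx_mul x q : x \in P -> q \in nbx x -> x * q.1 = q.2.
Proof.
case/P_trans=> g Gg <- qx; have qz : cpair g^-1 q \in nbx z0.
  by rewrite -(nbxJ _ Gg z0P) -[g in cpair g]invgK cpairK.
suff: z0 * (cpair g^-1 q).1 = (cpair g^-1 q).2.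
  by move/(congr1 (conjg^~ g)); rewrite /= conjMg !conjgKV.
move: (cpair _ q) qz => {qx}q; rewrite nbx_map lblK ?x0X // => /mapP[m mx ->].
have [m1X m2X] := nbrs_X x0X mx; apply: act_inj => v.
rewrite eltM_act ?x0X // act_eps //.
have : m \in nbrsT x0 by move: mx; rewrite /nbrs -lock.
move/(allP x0_products)/agreeP => /= H; apply: H; last exact: epsf_additive.
by move=> y y'; cbv beta; rewrite !epsfD.
Qed.

(** * The centralizer of the base point *)

Lemma linf_invol f : oadditive f -> (forall k x, f (oscale k x) = oscale k (f x)) ->
  mulcheck f -> agree (fun x => f (f x)) id -> realizable f.
Proof.
move=> fD fZ fM ff; apply: (@semi_realizable f f); first exact: linear_semi.
move=> x; have /agreeP H := ff; apply: H => // y y'; by rewrite !fD.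
Qed.

Lemma stab_x0 f : realizable f -> leqb (lact f x0) x0 -> elt f \in 'C_G[z0].
Proof.
move=> fr /leqbP fx; apply/setIP; split; first by case: fr.
apply/cent1P/commute_sym/commgP/conjg_fixP.
have [_] := good_act x0_good (proj1 fr).
by rewrite -(act_elt_lact _ fr) fx.
Qed.

Lemma A5_real : [/\ realizable h1, realizable h2 & realizable h3].
Proof.
have /and5P[m1 m2 m3 i1 /andP[i2 i3]] := A5gens_check.
split.
- by apply: linf_invol m1 i1; [apply: linf_additive | apply: linf_linear].
- by apply: linf_invol m2 i2; [apply: linf_additive | apply: linf_linear].
by apply: linf_invol m3 i3; [apply: linf_additive | apply: linf_linear].
Qed.

Lemma C_step l0 f l : realizable f -> leqb (lact f x0) x0 ->
  conj_from l0 'C_G[z0] l -> conj_from l0 'C_G[z0] (lact f l).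
Proof. by move=> fr fx; apply: conj_from_step (stab_x0 fr fx). Qed.

Lemma stabx0_step l0 l : conj_from l0 'C_G[z0] l ->
  foldr (fun f Q => conj_from l0 'C_G[z0] (f l) /\ Q) True [seq lact f | f <- stabx0].
Proof.
have /andP[lqX /and5P[f1 f2 f3 f4 /andP[f5 _]]] := stabx0_fix.
have [r1 r2 r3] := A5_real; have r5 : realizable (epsf lq) by case: (X_good (_ : lq \in X)) => //; rewrite mem_X.
move=> Rl; split; first exact: C_step r1 f1 Rl.
split; first exact: C_step r2 f2 Rl.
split; first exact: C_step r3 f3 Rl.
split; first exact: C_step ofrob_real f4 Rl.
split; last by [].
exact: C_step r5 f5 Rl.
Qed.

Lemma conj_from_refl l0 (H : {group gT}) : l0 \in X -> conj_from l0 H l0.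
Proof. by move=> l0X; split; [apply: X_good | exists 1; rewrite ?conjg1]. Qed.

Lemma C_reach n l0 k l : l0 \in X ->
  tfind k (reach lkey [seq lact f | f <- stabx0] n l0) = Some l ->
  conj_from l0 'C_G[z0] l /\ k = lkey l.
Proof.
move=> l0X /(reachP (@stabx0_step l0)) H.
by have [|? <-] := H; first exact: conj_from_refl.
Qed.

Lemma C_orbit r n l0 l : r = reach lkey [seq lact f | f <- stabx0] n l0 -> l0 \in X ->
  isome (tfind (lkey l) r) -> exists2 g, g \in 'C_G[z0] & eps l0 ^ g = eps l.
Proof.
move=> -> l0X; case eT: tfind => [m|//] _.
by have [[_ Cl] /lkey_inj ->] := C_reach l0X eT; move: Cl {eT}.
Qed.

Definition distx x := dist (lbl x).

Lemma distE e : e \in pts -> dist (eself e) = edist e.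
Proof. by rewrite /dist -lock /dist0 => /pts_find->. Qed.

Lemma XP l : l \in X -> exists2 e, e \in pts & eself e = l.
Proof. by rewrite mem_X => /inXP. Qed.

Lemma x1_trans x : x \in P -> distx x = 4 -> exists2 g, g \in 'C_G[z0] & eps x1 ^ g = x.
Proof.
case/PP=> l lX ->; rewrite /distx lblK // => l4.
have x1X : x1 \in X by rewrite mem_X; compute_bool.
have [e ep el] := XP lX; rewrite -el distE // in l4.
by have := C_orbit x1_orbitE x1X (x1_reached ep l4); rewrite el.
Qed.

Lemma m20X : m20 \in X. Proof. by rewrite mem_X; compute_bool. Qed.

Lemma wnb_trans q : q \in wnb z0 -> exists2 g, g \in 'C_G[z0] & eps m20 ^ g = q.1.
Proof.
rewrite /wnb lblK ?x0X // => /mapP[m].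
rewrite /wnbrs /nbrs -lock => /m20_reached H ->.
exact: C_orbit m20_orbitE m20X H.
Qed.

Lemma lqX : lq \in X. Proof. by rewrite mem_X; case/andP: stabx0_fix. Qed.
Definition zq := eps lq.
Lemma lq_neq : lq != x0. Proof. by []. Qed.

Lemma commute_cases x : x \in P -> commute z0 x -> [\/ x = z0,
  exists2 q, q \in nbx z0 & x = q.1 | exists2 g, g \in 'C_G[z0] & zq ^ g = x].
Proof.
case/PP=> l lX -> c; have [e ep el] := XP lX.
have ce : commute_with (epsf x0) (epsf (eself e)).
  have fD f h : oadditive (fun x => epsf f (epsf h x)) by move=> y y'; rewrite !epsfD.
  by apply/agreeP => // v; rewrite el -!eltM_act ?x0X // -/z0 c.
have /or3P[/eqP e0|/hasP[m mx /leqbP me]|] := commuting_reached ep ce.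
- by constructor 1; rewrite -el e0.
- constructor 2; exists (epair m); last by rewrite /= me el.
  by rewrite nbx_map lblK ?x0X // map_f // /nbrs -lock.
by move=> H; constructor 3; have := C_orbit lq_orbitE lqX H; rewrite el.
Qed.

Definition C40 : {set gT} := [set zq ^ g | g in 'C_G[z0]].

Lemma card_C40 : 40 <= #|C40|.
Proof.
have inC l : l \in telems lq_orbit -> good l /\ eps l \in C40.
  case/telemsP=> k; rewrite lq_orbitE => /(C_reach lqX)[[gl [g gC eg]] _].
  by split=> //; apply/imsetP; exists g.
have /andP[/eqnP s40 /nodup_keysP u] := lq_orbit_size.
rewrite -s40 -(size_map eps); move: u inC {s40}; move: (telems _) => s u inC.
have us : uniq [seq eps l | l <- s].
  rewrite map_inj_in_uniq ?(map_uniq u) // => l m ls ms lm.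
  apply: (uniq_map_inj u) => //.
  have e x : epsf l x = epsf m x.
    by rewrite -(proj2 (proj2 (inC _ ls).1)) -(proj2 (proj2 (inC _ ms).1)) -/(eps _) lm.
  by rewrite /sig !e.
rewrite -(card_uniqP us); apply: subset_leq_card; apply/subsetP=> _ /mapP[l ls ->].
by case: (inC _ ls).
Qed.

Lemma oddP : odd #|P|. Proof. by rewrite card_P. Qed.

(** * The central involutions of G *)

Lemma lin_ext f h : oadditive f -> oadditive h ->
    (forall k x, f (oscale k x) = oscale k (f x)) ->
    (forall k x, h (oscale k x) = oscale k (h x)) ->
  {in obasis, f =1 h} -> f =1 h.
Proof.
move=> fD hD fZ hZ fh; apply: oct_ind_add => [|x y fx fy|x].
- by rewrite !oadditive0.
- by rewrite fD hD fx fy.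
rewrite mem_cat => /orP[/fh //|/mapP[y /fh fy ->]].
by rewrite fZ hZ fy.
Qed.

Definition centralizes z l := commute z (eps l).

Lemma centralizes_act z l x : z \in G -> l \in X -> centralizes z l ->
  act z (epsf l x) = epsf l (act z x).
Proof. by move=> Gz lX c; rewrite -!act_eps // -!actM c. Qed.

(** Commuting with the root element of ([u1], b) means commuting with x -> u1(bx), which sends [v1]
    to b for b = [v2] and for b = [v3]. So the image of [v1] determines those of [v2] and [v3], and
    products give the rest. *)
Lemma lin_of_act z : z \in G -> {in [:: Lab u1 v2; x0; Lab u1 (oscale qw v2)], forall l,
  l \in X /\ centralizes z l} -> act z =1 lin_of (act z v1).
Proof.
move=> Gz H; have [zD [s zZ] zM] := act_semi Gz.
have cD b x : Lab u1 b \in [:: Lab u1 v2; x0; Lab u1 (oscale qw v2)] ->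
    act z (omul8 u1 (omul8 b x)) = omul8 u1 (omul8 b (act z x)).
  case/H=> lX c; apply: (@oaddI (act z x)).
  by rewrite -zD; apply: (centralizes_act x Gz lX c).
set w := act z v1.
have e2 : act z v2 = omul8 u1 (omul8 v2 w) by rewrite -cD // inE eqxx.
have e3 : act z v3 = omul8 u1 (omul8 v3 w) by rewrite -cD // !inE eqxx orbT.
have e2w : act z (oscale qw v2) = oscale qw (act z v2).
  rewrite e2 -omulZr -omulZl -cD; last by rewrite !inE eqxx ?orbT.
  by congr (act z _).
(* The third label excludes the field automorphism: with a twist, [e2w] would equate the multiples
   of the image of [v2] by [qv] and by [qw], forcing that image to be 0. *)
have s0 : s = false.
  case: s zZ => // zZ; have := e2w; rewrite zZ /= => e.
  have : act z v2 = ozero.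
    case: (act z v2) e => a1 a2 a3 a4 a5 a6 a7 a8 [].
    have k a : fmul qv a = fmul qw a -> a = q0 by case: a.
    by do 8![move/k->].
  by move/eqP; rewrite act_eq0.
rewrite {s}s0 in zZ.
apply: lin_ext => //; first exact: linf_additive.
  by move=> k x; apply: linf_linear.
have eu1 : act z u1 = omul8 (act z v2) (act z v3) by rewrite -zM.
have eu2 : act z u2 = omul8 (act z v3) w by rewrite -zM.
have eu3 : act z u3 = omul8 w (act z v2) by rewrite -zM.
have ee1 : act z e1 = omul8 (act z u1) w by rewrite -zM.
have ee8 : act z e8 = omul8 w (act z u1) by rewrite -zM.
have E : lin_of w = linf (act z e1) (act z u1) (act z u2) (act z u3) w (act z v2) (act z v3)
    (act z e8) by rewrite ee1 ee8 eu1 eu2 eu3 e2 e3.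
rewrite E /w; move: (act z) {E ee1 ee8 eu1 eu2 eu3 e2 e3 e2w cD zD zZ zM H w} => f.
have lk a b c d e g h k : [/\ linf a b c d e g h k e1 = a, linf a b c d e g h k u1 = b,
   linf a b c d e g h k u2 = c & linf a b c d e g h k u3 = d] /\
   [/\ linf a b c d e g h k v1 = e, linf a b c d e g h k v2 = g,
   linf a b c d e g h k v3 = h & linf a b c d e g h k e8 = k].
  have z0x x : oadd ozero x = x by rewrite oaddC oadd0.
  by split; split; rewrite /= !oscale0 oscale1 ?z0x ?oadd0.
have [[k1 k2 k3 k4] [k5 k6 k7 k8]] := lk (f e1) (f u1) (f u2) (f u3) (f v1) (f v2) (f v3) (f e8).
move=> x; rewrite !inE => /or4P[/eqP->|/eqP->|/eqP->|] //.
by case/or4P=> [/eqP->|/eqP->|/eqP->|] //; case/orP=> /eqP->.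
Qed.

Lemma commute_with_act z l : z \in G -> l \in X -> centralizes z l ->
  act z =1 lin_of (act z v1) -> commute_with (lin_of (act z v1)) (epsf l).
Proof.
move=> Gz lX c zE; have [zD _ _] := act_semi Gz.
apply/agreeP => [y y'|y y'|x].
- by rewrite epsfD -!zE zD.
- by rewrite -!zE zD epsfD.
by rewrite -!zE; apply: centralizes_act.
Qed.

Lemma lin_unital_act z : z \in G -> act z =1 lin_of (act z v1) -> lin_unital (act z v1).
Proof.
move=> Gz zE; apply/oeqbP; rewrite -!zE -(act_additive Gz).
exact: act_one.
Qed.

Lemma null_act z x : z \in G -> omul8 x x = ozero -> omul8 (act z x) (act z x) = ozero.
Proof. by move=> Gz xx; rewrite -act_omul // xx act0. Qed.

Lemma centlab_X l : l \in [:: Lab u1 v2; x0; Lab u1 (oscale qw v2)] -> l \in X.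
Proof.
by rewrite !inE => /or3P[]/eqP->; [exact: m20X | exact: x0X | exact: lqX].
Qed.

Lemma act_lin_eq z t : z \in G -> t \in G ->
    {in [:: Lab u1 v2; x0; Lab u1 (oscale qw v2)], forall l,
      centralizes z l /\ centralizes t l} ->
  act z v1 = act t v1 -> z = t.
Proof.
move=> Gz Gt H e; apply: act_inj => x.
rewrite (@lin_of_act z) //; last by move=> l lK; split; [apply: centlab_X | case: (H l lK)].
rewrite (@lin_of_act t) //; last by move=> l lK; split; [apply: centlab_X | case: (H l lK)].
by rewrite e.
Qed.

Lemma cent_P_trivial z : z \in G -> {in P, forall x, commute z x} -> z = 1.
Proof.
move=> Gz cz; have cl l : l \in X -> centralizes z l by move=> lX; apply/cz/eps_P.
have zE : act z =1 lin_of (act z v1).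
  by apply: lin_of_act => // l /centlab_X lX; split=> //; apply: cl.
have fX l : l \in flist -> l \in X by rewrite mem_X; apply/allP/flist_pts.
have w1 : act z v1 = act 1 v1.
  rewrite act1; apply: lin_of_trivial; [exact: null_act | exact: lin_unital_act |].
  by move=> l /fX lX; apply: commute_with_act => //; apply: cl.
apply: act_lin_eq w1 => // l /centlab_X/cl c; split=> //; exact/commute_sym/commute1.
Qed.

Definition phi := elt ofrob.
Definition Kl := locked (catrev Klist [::]).

Lemma mem_Kl l : (l \in Kl) = (l \in Klist).
Proof. by rewrite /Kl -lock catrevE cats0 mem_rev. Qed.

Definition Kgens := eps sl4 :: phi :: [seq eps l | l <- Kl].
(** The 2-group for the Sylow argument. The Frobenius map and [sl4] are adjoined to the involutions
    of [Klist] to cut the possible images of [v1] under its centralizer down to two. *)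
Definition K : {group gT} := <<[set x in Kgens]>>%G.

Lemma commute_conj (x y : gT) : commute x y -> x ^ y = x.
Proof. by move/commgP/conjg_fixP. Qed.

Lemma conj_commute (x y : gT) : x ^ y = x -> commute x y.
Proof. by move/conjg_fixP/commgP. Qed.

Lemma eps_lact l f : l \in X -> realizable f -> eps l ^ elt f = eps (lact f l).
Proof. by move=> lX fr; rewrite (act_elt_lact _ fr); apply: (good_act (X_good lX) (proj1 fr)).2. Qed.

Lemma Klist_X l : l \in Klist -> l \in X.
Proof. by rewrite mem_X; have /and4P[/allP H _ _ _] := Klist_check; apply: H. Qed.

Lemma sl4X : sl4 \in X.
Proof. by rewrite mem_X; compute_bool. Qed.

Lemma phi_v1 : act phi v1 = v1.
Proof. by case: ofrob_real => _ ->; have /and4P[_ /oeqbP-> _ _] := Klist_fix. Qed.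

Lemma phi2 : phi * phi = 1.
Proof.
apply: act_inj => x; rewrite actM act1; case: ofrob_real => _ E; rewrite /phi !E.
case: x => a1 a2 a3 a4 a5 a6 a7 a8; rewrite /=.
by congr Oct; [move: a1|move: a2|move: a3|move: a4|move: a5|move: a6|move: a7|move: a8]; case.
Qed.

Lemma K_G : K \subset G.
Proof.
rewrite gen_subG; apply/subsetP => x.
rewrite !inE => /or3P[/eqP->|/eqP->|/mapP[l]]; first exact/eps_G/sl4X.
  by case: ofrob_real.
by rewrite mem_Kl => /Klist_X/eps_G lG ->.
Qed.

Lemma eps_pelt l : l \in X -> 2.-elt (eps l).
Proof. by move=> lX; rewrite /p_elt order_P ?eps_P. Qed.

Lemma chain_pgroup rest prefix : chain_check prefix rest -> {subset rest <= X} ->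
    {subset prefix <= X} -> 2.-group <<[set x in [seq eps l | l <- prefix]]>> ->
  2.-group <<[set x in [seq eps l | l <- catrev rest prefix]]>>.
Proof.
elim: rest prefix => [|l rest IH] prefix // /andP[/allP cl cr] rX pX pp.
have lX := rX l (mem_head _ _).
apply: IH => // [m mr|m|].
- by apply: rX; rewrite inE mr orbT.
- by rewrite inE => /predU1P[->|/pX].
rewrite map_cons; apply: pgroup_cons; [exact: pp | exact: eps_pelt |].
move=> _ /mapP[m mp ->]; rewrite eps_lact ?pX //; last by case: (X_good lX).
by case/hasP: (cl m mp) => n np /leqbP->; apply: map_f.
Qed.

Lemma K_pgroup : 2.-group K.
Proof.
have pK : 2.-group <<[set x in [seq eps l | l <- Kl]]>>.
  rewrite /Kl -lock; apply: chain_pgroup Klist_chain Klist_X _ _ => //.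
  by rewrite (_ : [set x in _] = set0) ?gen0 ?pgroup1 //; apply/setP=> y; rewrite !inE.
have {}pK : 2.-group <<[set x in phi :: [seq eps l | l <- Kl]]>>.
  apply: pgroup_cons; first exact: pK.
    rewrite /p_elt; case: (eqVneq phi 1) => [->|n1]; first by rewrite order1.
    by rewrite (@nt_prime_order _ 2 phi) //; apply: phi2.
  move=> x /mapP[l]; rewrite mem_Kl => lK ->.
  rewrite eps_lact ?Klist_X //; last exact: ofrob_real.
  by rewrite map_f // mem_Kl Klist_ofrob.
apply: pgroup_cons pK _ _; first exact/eps_pelt/sl4X.
move=> x; rewrite inE => /predU1P[->|/mapP[l]].
  rewrite inE commute_conj ?eqxx //; apply/commute_sym/conj_commute.
  rewrite eps_lact ?sl4X //; last exact: ofrob_real.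
rewrite mem_Kl => lK ->; rewrite eps_lact ?Klist_X //; last by case: (X_good sl4X).
by rewrite inE map_f ?orbT // mem_Kl Klist_sl4.
Qed.

Lemma cent_K t : t \in 'C_G(K) -> #[t] = 2 -> t = z0.
Proof.
case/setIP=> Gt /centP ct t2.
have cl l : l \in Klist -> centralizes t l.
  move=> lK; apply/ct/mem_gen; rewrite !inE map_f ?orbT //.
  by rewrite mem_Kl.
have clabK l : l \in [:: Lab u1 v2; x0; Lab u1 (oscale qw v2)] -> l \in Klist.
  by move=> lc; apply: Klist_memP; move: lc; rewrite !inE => /or3P[]->; rewrite ?orbT.
have tE : act t =1 lin_of (act t v1).
  by apply: lin_of_act => // l lc; split; [apply: centlab_X | apply/cl/clabK].
have /and4P[_ /oeqbP fv1 /oeqbP sv1 cx0] := Klist_fix.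
have c_sl4 : centralizes t sl4 by apply/ct/mem_gen; rewrite !inE eqxx.
have c_phi : commute t phi by apply/ct/mem_gen; rewrite !inE eqxx orbT.
(* Two images of [v1] survive; they belong to 1 and to [z0]. *)
have := @lin_of_central (act t v1) _ _ _ _ _; case.
- exact: null_act.
- by case: ofrob_real => _ <-; rewrite -actM c_phi actM phi_v1.
- by rewrite -(centralizes_act _ Gt sl4X c_sl4) sv1.
- exact: lin_unital_act.
- have lkK : lk \in Klist by apply: Klist_memP; rewrite !inE eqxx !orbT.
  by apply: commute_with_act => //; [apply: Klist_X | apply: cl].
- move=> w1; have t1 : t = 1.
    apply: act_lin_eq => //; last by rewrite act1.
    by move=> l lc; split; [apply/cl/clabK | exact/commute_sym/commute1].
  by rewrite t1 order1 in t2.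
move=> w1; apply: act_lin_eq => //; first exact/eps_G/x0X; last by rewrite /z0 act_eps ?x0X.
move=> l lc; split; first exact/cl/clabK.
apply: act_inj => x; rewrite !eltM_act ?x0X ?centlab_X //.
case/and3P: cx0 => cm cq _; move: lc; rewrite !inE => /or3P[]/eqP->; last 1 first.
- by rewrite (commute_withP cq).
- by rewrite (commute_withP cm).
by [].
Qed.

Lemma central_involutions_P : central_involutions G = P.
Proof.
rewrite P_class; apply: (@central_involutions_class gT G z0 _ _ K).
- exact/eps_G/x0X.
- exact/order_P/z0P.
- by rewrite -P_class oddP.
- exact: K_G.
- exact: K_pgroup.
exact: cent_K.
Qed.

(** * Lines and their normalizer indices *)

Definition lset (x : gT) (q : gT * gT) : {set gT} := [set x; q.1; q.2].

Lemma in_lset (y x : gT) (q : gT * gT) : (y \in lset x q) = [|| y == x, y == q.1 | y == q.2].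
Proof. by rewrite !inE -orbA. Qed.

Lemma in_triple (y a b : gT) : (y \in triple a b) = [|| y == a, y == b | y == a * b].
Proof. by rewrite !inE -orbA. Qed.

Lemma lset_triple x q : x \in P -> q \in nbx x -> lset x q = triple x q.1.
Proof. by move=> xP qx; rewrite /triple nbx_mul. Qed.

Lemma lset_at (nb : gT -> seq (gT * gT)) x q y :
    (forall x q, x \in P -> q \in nb x -> q.1 \in P /\ q.2 \in P) ->
    (forall x q, x \in P -> q \in nb x -> (q.2, q.1) \in nb x /\ (x, q.2) \in nb q.1) ->
    x \in P -> q \in nb x -> y \in lset x q ->
  exists2 q', q' \in nb y & lset x q = lset y q'.
Proof.
move=> nbP sym xP qx; have [q1P q2P] := nbP _ _ xP qx.
have [q21 x2] := sym _ _ xP qx; have [_ x1] := sym _ _ xP q21.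
rewrite in_lset => /or3P[]/eqP->.
- by exists q.
- by exists (x, q.2); rewrite // /lset /= [[set x; _]]setUC.
by exists (x, q.1); rewrite // /lset /= setUC setUA [[set _; x]]setUC.
Qed.

Lemma snbP x q : x \in P -> q \in snb x -> q.1 \in P /\ q.2 \in P.
Proof. by move=> xP qx; apply: (nbxP xP); rewrite mem_cat qx. Qed.

Lemma commute_nbx x q : x \in P -> q \in nbx x -> commute x q.1.
Proof.
move=> xP qx; have [q1P q2P] := nbxP xP qx; have [_ x1] := nbx_sym xP qx.
have [q21 _] := nbx_sym xP qx; have [_ x2] := nbx_sym xP q21.
by rewrite /commute (nbx_mul xP qx) (nbx_mul q1P x1).
Qed.

Lemma nbx_neq x q : x \in P -> q \in nbx x -> [/\ x != q.1, x != q.2 & q.1 != q.2].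
Proof.
have main y q' : y \in P -> q' \in nbx y -> y != q'.1.
  move=> yP qy; apply: contraTneq (uniq_nbx yP) => e.
  by rewrite /= {1}e map_f.
move=> xP qx; have [q21 x2] := nbx_sym xP qx; have [q1P q2P] := nbxP xP qx.
split; [exact: main | exact: (main x (q.2, q.1)) |].
have [_ x1] := nbx_sym xP q21; have [x1' _] := nbx_sym q2P x1.
by rewrite eq_sym; apply: (main q.2 (q.1, x)).
Qed.

Lemma card_lset x q : x \in P -> q \in nbx x -> #|lset x q| = 3.
Proof.
move=> xP qx; have [n1 n2 n3] := nbx_neq xP qx.
by rewrite /lset setUC cardsU1 !inE negb_or cards2 n1 (eq_sym q.2) n2 (eq_sym q.2) n3.
Qed.

Lemma lset_sub x q : x \in P -> q \in nbx x -> lset x q \subset P.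
Proof.
move=> xP qx; have [q1P q2P] := nbxP xP qx; apply/subsetP => y.
by rewrite in_lset => /or3P[]/eqP->.
Qed.

Lemma lsetJ x q g : lset x q :^ g = lset (x ^ g) (cpair g q).
Proof. by rewrite /lset !conjUg !conjg_set1. Qed.

Lemma P_2trans : {in P &, forall a b, exists2 g, g \in G & a ^ g = b}.
Proof.
move=> a b /P_trans[g Gg <-] /P_trans[h Gh <-].
by exists (g^-1 * h); rewrite ?groupM ?groupV // conjgM conjgK.
Qed.

Definition idx (x y : gT) := #|G : 'N_G(<<[set x; y]>>)|.

Lemma idxJ g x y : g \in G -> idx (x ^ g) (y ^ g) = idx x y.
Proof.
move=> Gg; rewrite /idx -!card_conjugates.
have -> : <<[set x ^ g; y ^ g]>> = <<[set x; y]>> :^ g.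
  by rewrite -genJ conjUg !conjg_set1.
congr #|pred_of_set _|; apply/setP=> A; apply/imsetP/imsetP => [[h Gh ->]|[h Gh ->]].
  by exists (g * h); rewrite ?groupM // conjsgM.
by exists (g^-1 * h); rewrite ?groupM ?groupV // conjsgM conjsgK.
Qed.

(** 1365 is 4095 / 3: this is [card_triple_class] with three points on each triple. *)
Lemma idx_through y : y \in P -> commute z0 y -> z0 != y -> z0 * y \in P ->
  idx z0 y = (1365 * #|[set t in triple z0 y :^: G | z0 \in t]|)%N.
Proof.
move=> yP c n zyP; rewrite /idx index_triple ?order_P ?z0P //.
have T3 : #|triple z0 y| = 3.
  have y1 : y != 1 by apply/eqP=> e; have := order_P yP; rewrite e order1.
  have e1 : (z0 * y == z0) = false.
    by apply/negP=> /eqP e; case/eqP: y1; apply: (mulgI z0); rewrite e mulg1.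
  have e2 : (z0 * y == y) = false.
    by apply/negP=> /eqP e; case/eqP: z0_neq1; apply: (mulIg y); rewrite e mul1g.
  by rewrite /triple setUC cardsU1 !inE negb_or cards2 n e1 e2.
have : (3 * #|triple z0 y :^: G| = #|P| * #|[set t in triple z0 y :^: G | z0 \in t]|)%N.
  apply: card_triple_class; [exact: P_G | exact: P_2trans | | exact: z0P | | exact: T3].
    by move=> g a Gg aP; rewrite PJ.
  by apply/subsetP=> a; rewrite in_triple => /or3P[]/eqP-> //; apply: z0P.
rewrite card_P; set a := #|_|; set b := #|_| => e.
by apply/eqP; rewrite -(eqn_pmul2l (isT : 0 < 3)) e mulnA.
Qed.

(** Here [nb] is [snb] or [wnb]. G preserves each kind of line, so the conjugates through [z0] are
    lines of the same kind; this bounds the index from above. *)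
Lemma class_through (nb : gT -> seq (gT * gT)) q :
    (forall x q, x \in P -> q \in nb x -> q \in nbx x) ->
    (forall x q, x \in P -> q \in nb x -> (q.2, q.1) \in nb x /\ (x, q.2) \in nb q.1) ->
    (forall g x q, g \in G -> x \in P -> (cpair g q \in nb (x ^ g)) = (q \in nb x)) ->
    q \in nb z0 ->
  [set t in triple z0 q.1 :^: G | z0 \in t] \subset [set triple z0 y | y in [seq q.1 | q <- nb z0]].
Proof.
move=> sub sym nJ qz; apply/subsetP => t; rewrite inE => /andP[/imsetP[g Gg ->]].
have qx := sub _ _ z0P qz; rewrite -(lset_triple z0P qx) lsetJ => zt.
have zgP : z0 ^ g \in P by rewrite PJ ?z0P.
have [|||||q' q'z ->] := @lset_at nb (z0 ^ g) (cpair g q) z0.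
- by move=> x r xP /(sub _ _ xP); apply: nbxP.
- exact: sym.
- exact: zgP.
- by rewrite nJ ?z0P.
- exact: zt.
apply/imsetP; exists q'.1; first exact: map_f.
by rewrite lset_triple ?z0P //; apply: sub q'z; apply: z0P.
Qed.

Lemma z0z0 : z0 * z0 = 1.
Proof. by rewrite -[_ * _]/(z0 ^+ 2) -(order_P z0P) expg_order. Qed.

Lemma PxX x : x \in P -> x * x = 1.
Proof. by move=> xP; rewrite -[_ * _]/(x ^+ 2) -(order_P xP) expg_order. Qed.

Lemma P_neq1 x : x \in P -> x != 1.
Proof. by move/order_P => o; apply/eqP=> e; rewrite e order1 in o. Qed.

Lemma card_firsts (nb : gT -> seq (gT * gT)) x : x \in P ->
    subseq (nb x) (nbx x) ->
    (forall x q, x \in P -> q \in nb x -> (q.2, q.1) \in nb x /\ (x, q.2) \in nb q.1) ->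
  size (nb x) = (2 * #|[set triple x y | y in [seq q.1 | q <- nb x]]|)%N.
Proof.
move=> xP ss sym; have sub := mem_subseq ss.
have us : uniq [seq q.1 | q <- nb x].
  by apply: subseq_uniq (map_subseq _ ss) _; have /andP[] := uniq_nbx xP.
pose A := [set y in [seq q.1 | q <- nb x]].
have -> : [set triple x y | y in [seq q.1 | q <- nb x]] = [set triple x y | y in A].
  by apply/setP=> t; apply/imsetP/imsetP => [] [y yA ->]; exists y => //; rewrite inE in yA *.
rewrite -(size_map fst) -(card_uniqP us) -(cardsE [in [seq q.1 | q <- nb x]]) -/A.
apply: (proj2 (card_triples_through (P_neq1 xP) _ _)).
- by move=> y _; apply: PxX.
- rewrite inE; apply/mapP => [[q /sub qz e]].
  by have [] := nbx_neq xP qz; rewrite e eqxx.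
move=> y; rewrite !inE => /mapP[q qz ->]; rewrite (nbx_mul xP (sub _ qz)).
by have [q21 _] := sym _ _ xP qz; apply: (map_f fst q21).
Qed.

Lemma mem_triple_class y : triple z0 y \in [set t in triple z0 y :^: G | z0 \in t].
Proof. by rewrite inE in_triple eqxx andbT; apply/imsetP; exists 1; rewrite ?conjsg1. Qed.

Lemma idx_snb q : q \in snb z0 -> idx z0 q.1 = 1365.
Proof.
move=> qz; have qx : q \in nbx z0 by rewrite mem_cat qz.
have [q1P q2P] := nbxP z0P qx; have [n1 _ _] := nbx_neq z0P qx.
rewrite idx_through //; [|exact: (commute_nbx z0P qx)|by rewrite (nbx_mul z0P qx)].
have snbx x r : x \in P -> r \in snb x -> r \in nbx x by rewrite mem_cat => _ ->.
have sub := class_through snbx snb_sym snbJ qz.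
have ss : subseq (snb z0) (nbx z0) by apply: prefix_subseq.
have := card_firsts z0P ss snb_sym; rewrite (size_snb z0P).
case/esym/eqP; rewrite -[X in _ == X]/(2 * 1)%N eqn_pmul2l // => /eqP c1.
apply/eqP; rewrite -[X in _ == X]muln1 eqn_pmul2l // eqn_leq -{1}c1 subset_leq_card //=.
by apply/card_gt0P; exists (triple z0 q.1); apply: mem_triple_class.
Qed.

(** The ten lines of this kind through [z0] are conjugate under its centralizer, so the upper bound
    1365 * 10 is attained. *)
Lemma idx_wnb q : q \in wnb z0 -> idx z0 q.1 = 13650.
Proof.
move=> qz; have qx : q \in nbx z0 by rewrite mem_cat qz orbT.
have [q1P q2P] := nbxP z0P qx; have [n1 _ _] := nbx_neq z0P qx.
rewrite idx_through //; [|exact: (commute_nbx z0P qx)|by rewrite (nbx_mul z0P qx)].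
have wnbx x r : x \in P -> r \in wnb x -> r \in nbx x by rewrite mem_cat => _ ->; rewrite orbT.
have ss : subseq (wnb z0) (nbx z0) by apply: suffix_subseq.
have := card_firsts z0P ss wnb_sym; rewrite (size_wnb z0P).
case/esym/eqP; rewrite -[X in _ == X]/(2 * 10)%N eqn_pmul2l // => /eqP c10.
apply/eqP; rewrite -[X in _ == X]/(1365 * 10)%N eqn_pmul2l // -c10; apply/eqP/eq_card.
apply/subset_eqP/andP; split; first exact: class_through wnbx wnb_sym wnbJ qz.
apply/subsetP=> _ /imsetP[_ /mapP[r rz ->] ->].
rewrite inE in_triple eqxx andbT.
have [g /setIP[Gg /cent1P cg] <-] := wnb_trans qz.
have [h /setIP[Gh /cent1P ch] <-] := wnb_trans rz.
apply/imsetP; exists (g^-1 * h); first by rewrite groupM ?groupV.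
rewrite tripleJ !conjgM conjgK; congr (triple _ _).
by rewrite (commute_conj (commuteV (commute_sym cg))) commute_conj //; apply: commute_sym.
Qed.

(** The 40 elements of the orbit lie on at least 20 triples through [z0], all conjugate under its
    centralizer. *)
Lemma idx_C40 y : y \in C40 -> y \in P -> commute z0 y -> z0 != y -> z0 * y \in P ->
  27300 <= idx z0 y.
Proof.
move=> y40 yP c n zyP; rewrite idx_through // -[27300]/(1365 * 20)%N leq_pmul2l //.
have sub : [set triple z0 y | y in C40] \subset [set t in triple z0 y :^: G | z0 \in t].
  apply/subsetP=> _ /imsetP[_ /imsetP[g gC ->] ->]; rewrite inE in_triple eqxx andbT.
  case/imsetP: y40 => h hC ->.
  case/setIP: gC => Gg /cent1P cg; case/setIP: hC => Gh /cent1P ch.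
  apply/imsetP; exists (h^-1 * g); first by rewrite groupM ?groupV.
  rewrite tripleJ !conjgM conjgK; congr (triple _ _).
  by rewrite (commute_conj (commuteV (commute_sym ch))) commute_conj //; apply: commute_sym.
apply: leq_trans (subset_leq_card sub).
have zqn : zq != z0 by apply: contraNneq lq_neq => /eps_inj->; rewrite ?lqX ?x0X.
have z40 : z0 \notin C40.
  apply/imsetP=> [[g /setIP[_ /cent1P cg] zE]]; case/eqP: zqn.
  by apply: (conjg_inj g); rewrite -zE commute_conj //; apply: commute_sym.
have [H _] := card_triples_through z0_neq1 (fun y (_ : y \in C40) => z0z0) z40.
by rewrite -(leq_pmul2l (isT : 0 < 2)); apply: leq_trans card_C40 H.
Qed.

Lemma linesP (ii : seq nat) t : reflect (exists x y, [/\ (x \in P) && (y \in P), t = triple x y,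
    (x != y) && (x * y \in P), commute x y & idx x y \in ii])
  (t \in involution_lines G P ii).
Proof.
apply: (iffP imset2P) => [[x y xP yS ->]|].
  move: yS; rewrite in_set => /and3P[yP n /and3P[/eqP c zP i]].
  by exists x, y; rewrite xP yP n zP.
case=> x [y [/andP[xP yP] -> /andP[n zP] c i]]; exists x y => //.
by rewrite in_set yP n zP c eqxx.
Qed.

(** The bound on the index excludes the commuting pairs that are not collinear, by [idx_C40]. *)
Lemma nbx_cases x y : x \in P -> y \in P -> x != y -> x * y \in P -> commute x y ->
  idx x y <= 13650 -> exists2 q, q \in nbx x & y = q.1.
Proof.
move=> /P_trans[g Gg <-].
have -> : y = (y ^ g^-1) ^ g by rewrite conjgKV.
move: (y ^ g^-1) => {}y; rewrite PJ // -conjMg PJ // idxJ // (inj_eq (@conjg_inj _ g)).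
move=> yP n zP c; have {}c : commute z0 y.
  by apply: (conjg_inj g); rewrite !conjMg.
case: (commute_cases yP c) => [e|[q qz ->] _|[h hC hy]]; first by rewrite e eqxx in n.
  by exists (cpair g q); rewrite ?nbxJ ?z0P.
by rewrite leqNgt (leq_trans _ (idx_C40 _ yP c n zP)) //; apply/imsetP; exists h.
Qed.

Lemma idx_nb (nb : gT -> seq (gT * gT)) i x q :
  (forall g x q, g \in G -> x \in P -> (cpair g q \in nb (x ^ g)) = (q \in nb x)) ->
  (forall q, q \in nb z0 -> idx z0 q.1 = i) ->
  x \in P -> q \in nb x -> idx x q.1 = i.
Proof.
move=> nbJ H /P_trans[g Gg <-].
have -> : q = cpair g (cpair g^-1 q) by rewrite -{1}[g]invgK cpairK.
by rewrite nbJ ?z0P //; move: (cpair g^-1 q) => r rz; rewrite idxJ // H.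
Qed.

Definition L := involution_lines G P [:: 1365; 13650].
Definition Sp := involution_lines G P [:: 1365].

Lemma nbx_line ii x q : x \in P -> q \in nbx x -> idx x q.1 \in ii ->
  lset x q \in involution_lines G P ii.
Proof.
move=> xP qx i; have [q1P q2P] := nbxP xP qx; have [n _ _] := nbx_neq xP qx.
by apply/linesP; exists x, q.1; rewrite (nbx_mul xP qx) (lset_triple xP qx) n q1P q2P xP;
  split=> //; apply: (commute_nbx xP qx).
Qed.

Lemma LP t : reflect (exists2 x, x \in P & exists2 q, q \in nbx x & t = lset x q) (t \in L).
Proof.
apply: (iffP (linesP _ _)) => [[x [y [/andP[xP yP] -> /andP[n zP] c i]]]|[x xP [q qx ->]]].
  have [|q qx e] := nbx_cases xP yP n zP c; first by move: i; rewrite !inE => /orP[]/eqP->.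
  by exists x => //; exists q; rewrite // e (lset_triple xP qx).
have i : idx x q.1 \in [:: 1365; 13650].
  move: qx; rewrite mem_cat => /orP[] qx.
    by rewrite (idx_nb snbJ idx_snb xP qx).
  by rewrite (idx_nb wnbJ idx_wnb xP qx).
exact/linesP/(nbx_line xP qx i).
Qed.

Lemma SP t : reflect (exists2 x, x \in P & exists2 q, q \in snb x & t = lset x q) (t \in Sp).
Proof.
apply: (iffP (linesP _ _)) => [[x [y [/andP[xP yP] -> /andP[n zP] c]]]|[x xP [q qx ->]]].
  rewrite inE => /eqP i; have [|q qx e] := nbx_cases xP yP n zP c; first by rewrite i.
  exists x => //; exists q; last by rewrite e (lset_triple xP qx).
  move: qx; rewrite mem_cat => /orP[] // qx.
  by rewrite e (idx_nb wnbJ idx_wnb xP qx) in i.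
have qx' : q \in nbx x by rewrite mem_cat qx.
by apply/linesP/(nbx_line xP qx'); rewrite (idx_nb snbJ idx_snb xP qx).
Qed.

(** * The near octagon and its spread *)

Definition geo : geometry gT := (P, L).

Lemma L_at l x : l \in L -> x \in l -> exists2 q, q \in nbx x & l = lset x q.
Proof.
case/LP=> a aP [q qa ->] xl.
by apply: (lset_at nbxP nbx_sym aP qa xl).
Qed.

Lemma L_P l : l \in L -> l \subset P.
Proof. by case/LP=> a aP [q qa ->]; apply: lset_sub. Qed.

Lemma L_lset x q : x \in P -> q \in nbx x -> lset x q \in L.
Proof. by move=> xP qx; apply/LP; exists x => //; exists q. Qed.

Definition adj x := [seq q.1 | q <- nbx x].

Lemma adjP x y : reflect (exists z, (y, z) \in nbx x) (y \in adj x).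
Proof.
by apply: (iffP mapP) => [[[y' z] yx ->]|[z yx]]; [exists z | exists (y, z)].
Qed.

Lemma colE x y : collinear geo x y = (x \in P) && (y \in adj x).
Proof.
rewrite /collinear /=; apply/andP/andP => [[n /existsP[l /and3P[lL xl yl]]]|[xP /adjP[z qx]]].
  have xP : x \in P by apply: subsetP xl; apply: L_P.
  split=> //; have [q qx e] := L_at lL xl.
  move: yl; rewrite e in_lset eq_sym (negbTE n) /= => /orP[] /eqP->; first exact: map_f.
  by have [q21 _] := nbx_sym xP qx; apply: (map_f fst q21).
have [n _ _] := nbx_neq xP qx; split=> //; apply/existsP; exists (lset x (y, z)).
by rewrite L_lset // !in_lset !eqxx !orbT.
Qed.

Lemma geo_lines_sub : {in lines geo, forall l : {set gT}, l \subset points geo}.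
Proof. exact: L_P. Qed.

Lemma potentialX D b l : potential D b -> l \in X ->
  [&& all (fun m => near3 (D l) (D m.1) (D m.2)) (nbrs l), leq (D l) 4 &
      if D l is 0 then leqb l b else has (fun m => eqn (D l) (D m.1).+1) (nbrs l)].
Proof.
by case/andP=> _ /allP H; rewrite mem_X => /inXP[e ep <-]; rewrite (nbrsE ep); apply: H.
Qed.

Lemma nbxE x q : x \in P -> q \in nbx x ->
  exists2 m, m \in nbrs (lbl x) & [/\ q = epair m, lbl q.1 = m.1 & lbl q.2 = m.2].
Proof.
rewrite nbx_map => xP /mapP[m mx ->]; have [m1 m2] := nbrs_X (lbl_X xP) mx.
by exists m; rewrite // /epair !lblK.
Qed.

Lemma potentialP D b : potential D b ->
  D b = 0 /\ {in P, forall y, [/\ D (lbl y) <= 4,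
    (forall q, q \in nbx y -> near3 (D (lbl y)) (D (lbl q.1)) (D (lbl q.2))) &
    y != eps b -> exists2 q, q \in nbx y & D (lbl y) = (D (lbl q.1)).+1]}.
Proof.
move=> pD; split; first by case/andP: pD => /eqP.
move=> y yP; have /and3P[/allP near le4 dec] := potentialX pD (lbl_X yP); split=> //.
  by move=> q /(nbxE yP)[m my [_ -> ->]]; apply: near.
move=> yb; case e: (D (lbl y)) dec => [|d] => [/leqbP lb|/hasP[m my /eqP dm]].
  by rewrite -lb epsK // eqxx in yb.
have [m1 _] := nbrs_X (lbl_X yP) my.
by exists (epair m); [rewrite nbx_map map_f | rewrite /epair lblK].
Qed.

Lemma near3P d d1 d2 : near3 d d1 d2 -> [/\ d1 <= d.+1, d <= d1.+1 &
  [\/ d1 = d.+1 /\ d2 = d.+1, d = d1.+1 /\ d2 = d1.+1 | d = d2.+1 /\ d1 = d2.+1]].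
Proof.
case/or3P=> /andP[/eqP e1 /eqP e2]; subst; split=> //; try exact: leqW.
- by constructor 1.
- by constructor 2.
- by constructor 3.
Qed.

Lemma ltn4_gT : 4 < #|gT|.
Proof. by apply: leq_trans (max_card P); rewrite card_P. Qed.

Lemma distance_pot D b : potential D b -> b \in X ->
  {in P, forall y, distance geo (eps b) y = D (lbl y)}.
Proof.
move=> pD bX; have [Db H] := potentialP pD.
apply: (distance_potential geo_lines_sub (d := fun y => D (lbl y))).
- exact: eps_P.
- by rewrite lblK.
- by move=> y /H[/leq_ltn_trans-> //]; apply: ltn4_gT.
- move=> y z; rewrite colE => /andP[/H[_ near _] /mapP[q /near/near3P[le _ _] ->]].
  exact: le.
move=> y yP; have [_ _ dec] := H _ yP => /dec[q qy e]; exists q.1 => //.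
rewrite (collinear_sym geo) colE; apply/andP; split; [exact: yP | exact: map_f].
Qed.

Lemma distxE : {in P, forall y, distance geo z0 y = distx y}.
Proof.
move=> y yP; rewrite (distance_pot dist0_check x0X yP).
by rewrite /distx /dist -lock.
Qed.

Definition cperm g : {perm gT} := actperm 'J g.

Lemma cpermE g x : cperm g x = x ^ g.
Proof. by rewrite actpermE. Qed.

Lemma cperm_lset g x q : [set cperm g y | y in lset x q] = lset (x ^ g) (cpair g q).
Proof. by rewrite -lsetJ; apply: eq_imset => y; rewrite cpermE. Qed.

Lemma LJ g l : g \in G -> l \in L -> [set cperm g y | y in l] \in L.
Proof.
move=> Gg /LP[x xP [q qx ->]]; rewrite cperm_lset; apply: L_lset; first by rewrite PJ.
by rewrite nbxJ.
Qed.

Lemma cperm_L g : g \in G -> [set [set cperm g x | x in l] | l : {set gT} in lines geo] = lines geo.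
Proof.
move=> Gg; apply/setP=> l; apply/imsetP/idP => [[m mL ->]|lL]; first exact: LJ.
exists [set cperm g^-1 y | y in l]; first by apply: LJ; rewrite ?groupV.
rewrite -imset_comp -[LHS]imset_id; apply: eq_imset => y /=.
by rewrite !cpermE conjgKV.
Qed.

Lemma distJ g x y : g \in G -> distance geo (x ^ g) (y ^ g) = distance geo x y.
Proof. by move/cperm_L/aut_distance => H; rewrite -!cpermE. Qed.

Lemma geo_near x y q : x \in P -> y \in P -> q \in nbx y ->
  near3 (distance geo x y) (distance geo x q.1) (distance geo x q.2).
Proof.
case/P_trans=> g Gg <-; move: y q.
suff main y q : y \in P -> q \in nbx y ->
    near3 (distance geo z0 y) (distance geo z0 q.1) (distance geo z0 q.2).
  move=> y q yP qy; rewrite -[y](conjgKV g) -[q.1](conjgKV g) -[q.2](conjgKV g) !distJ //.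
  apply: (main _ (cpair g^-1 q)); first by rewrite PJ ?groupV.
  by rewrite nbxJ ?groupV.
move=> yP qy; have [q1P q2P] := nbxP yP qy; rewrite !distxE //.
have [_ /(_ y yP)[_ H _]] := potentialP dist0_check.
by have := H q qy; rewrite /distx /dist -lock.
Qed.

Lemma geo_dist4 : {in P &, forall x y, distance geo x y <= 4}.
Proof.
move=> x y /P_trans[g Gg <-] yP; rewrite -[y](conjgKV g) distJ //.
have {}yP : y ^ g^-1 \in P by rewrite PJ ?groupV.
rewrite distxE //; have [_ /(_ _ yP)[H _ _]] := potentialP dist0_check.
by move: H; rewrite /distx /dist -lock.
Qed.

Lemma x1X : x1 \in X. Proof. by rewrite mem_X; compute_bool. Qed.
Definition zz1 := eps x1.
Lemma distx_zz1 : distx zz1 = 4.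
Proof. by rewrite /distx lblK ?x1X //; apply/eqP; rewrite /dist -lock; compute_bool. Qed.

Lemma geo_pls : partial_linear_space geo.
Proof.
split; [exact: L_P | by move=> l /LP[x xP [q qx ->]]; rewrite card_lset |].
move=> x y xP yP n; apply/card_le1_eqP => l m; rewrite !in_set.
suff main l' : [&& l' \in lines geo, x \in l' & y \in l'] ->
    exists2 q, q \in nbx x & q.1 = y /\ l' = lset x q.
  move=> /main[q qx [qy ->]] /main[r rx [ry ->]]; suff -> : q = r by [].
  have e : q.1 = r.1 by rewrite qy.
  have e2 : q.2 = r.2 by rewrite -(nbx_mul xP qx) -(nbx_mul xP rx) e.
  by rewrite [q]surjective_pairing [r]surjective_pairing e e2.
case/and3P=> lL xl; have [q qx ->] := L_at lL xl.
have [q21 _] := nbx_sym xP qx.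
rewrite in_lset eq_sym (negbTE n) /= => /orP[]/eqP->; first by exists q.
by exists (q.2, q.1); rewrite // /lset setUAC.
Qed.

Lemma geo_near_octagon : near_octagon geo.
Proof.
split; first exact: geo_pls.
- by move=> x y xP yP; apply: distance_connect => //; rewrite (leq_ltn_trans (geo_dist4 xP yP)) ?ltn4_gT.
- split; first exact: geo_dist4.
  exists z0, zz1; split; [exact: z0P | exact/eps_P/x1X|].
  by rewrite distxE ?distx_zz1 //; apply/eps_P/x1X.
move=> x l xP lL; have [a aP [q qa lE]] := LP _ lL.
have /near3P[_ _ H] := geo_near xP aP qa.
have [n1 n2 n3] := nbx_neq aP qa.
rewrite {l lL}lE; case: H => -[e1 e2]; [exists a|exists q.1|exists q.2]; split.
all: try by split; [rewrite in_lset eqxx ?orbT | move=> z; rewrite in_lset => /or3P[]/eqP->;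
  rewrite ?e1 ?e2].
all: move=> z [zl /(_ _) H]; move: zl (H a) (H q.1) (H q.2); rewrite !in_lset !eqxx ?orbT.
all: by case/or3P=> /eqP-> // K1 K2 K3; have := K1 isT; have := K2 isT; have := K3 isT;
  rewrite ?e1 ?e2 ?ltnn.
Qed.

Lemma geo_order : has_order 2 10 geo.
Proof.
split=> [l /LP[x xP [q qx ->]]|x xP]; first by rewrite card_lset.
have H := card_firsts xP (subseq_refl _) nbx_sym.
rewrite (size_nbx xP) in H; apply/eqP; rewrite -(eqn_pmul2l (isT : 0 < 2)) -[(2 * 11)%N]/22 H.
apply/eqP; congr (_ * _)%N; apply: eq_card => l; rewrite !inE; apply/andP/imsetP.
  case=> lL xl; have [q qx ->] := L_at lL xl; exists q.1; first exact: map_f.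
  exact: lset_triple.
case=> _ /mapP[q qx ->] ->; rewrite -(lset_triple xP qx) in_lset eqxx; split=> //.
exact: L_lset.
Qed.

Lemma snb_lset x q r : x \in P -> q \in snb x -> r \in snb x -> lset x q = lset x r.
Proof.
move=> xP qx rx; have [q21 _] := snb_sym xP qx.
have qn : q.1 != q.2 by case: (nbx_neq xP (_ : q \in nbx x)); rewrite ?mem_cat ?qx.
have := @uniq_min_size _ [:: q; (q.2, q.1)] (snb x) _ _ _.
case.
- by rewrite /= inE andbT; apply: contraNneq qn => {1}->.
- by move=> s; rewrite !inE => /orP[]/eqP->.
- by rewrite (size_snb xP).
move=> _ /(_ r); rewrite rx !inE => /orP[]/eqP-> //.
by rewrite /lset setUAC.
Qed.

Lemma geo_spread : line_spread geo Sp.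
Proof.
have snbx x q : q \in snb x -> q \in nbx x by rewrite mem_cat => ->.
split.
- by apply/subsetP=> l /SP[x xP [q /snbx qx ->]]; apply: L_lset.
- apply/trivIsetP => l m /SP[a aP [q qa ->]] /SP[b bP [r rb ->]].
  apply: contraNT => /pred0Pn[x /andP[/= xl xm]].
  have [q' q'x ->] := lset_at snbP snb_sym aP qa xl.
  have [r' r'x ->] := lset_at snbP snb_sym bP rb xm.
  apply/eqP/snb_lset => //.
  by apply: subsetP xl; apply: lset_sub => //; apply: snbx.
apply/setP=> x; apply/bigcupP/idP => [[l /SP[a aP [q qa ->]]]|xP].
  by apply: subsetP; apply: lset_sub => //; apply: snbx.
case e: (snb x) (size_snb xP) => [|q s] // _; have qx : q \in snb x by rewrite e mem_head.
exists (lset x q); last by rewrite in_lset eqxx.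
by apply/SP; exists x => //; exists q.
Qed.

Lemma nbrsTE : nbrsT = nbrs. Proof. by rewrite /nbrs -lock. Qed.
Lemma dist0E : dist0 = dist. Proof. by rewrite /dist -lock. Qed.

Lemma dist0_pot : potential dist x0.
Proof. by rewrite -dist0E; apply: dist0_check. Qed.

Lemma distance_lbl D b l : potential D b -> b \in X -> l \in X ->
  distance geo (eps b) (eps l) = D l.
Proof. by move=> pD bX lX; rewrite (distance_pot pD bX) ?eps_P ?lblK. Qed.

Lemma in_adj l y : l \in X -> reflect (exists2 m, m \in nbrs l & y = eps m.1) (y \in adj (eps l)).
Proof.
move=> lX; rewrite /adj nbx_map lblK // -map_comp.
by apply: (iffP mapP) => -[m ml ->]; exists m.
Qed.

Lemma base_X b : b \in rcons base5 n4 -> b \in X.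
Proof. by rewrite mem_X; apply/allP/base_pts. Qed.

(** * Rigidity and the automorphism group *)

Section Rigidity.

Variable s : {perm gT}.
Hypothesis sA : s \in geom_aut geo.

Lemma sP x : (s x \in P) = (x \in P).
Proof. by have := sA; rewrite inE => /andP[/perm_closed]. Qed.

Lemma sL : [set [set s x | x in l] | l : {set gT} in lines geo] = lines geo.
Proof. by have := sA; rewrite inE => /andP[_ /eqP]. Qed.

Lemma s_adj x y : x \in P -> (s y \in adj (s x)) = (y \in adj x).
Proof. by move=> xP; have := aut_collinear sL x y; rewrite !colE sP xP. Qed.

Definition fixed l := l \in X /\ s (eps l) = eps l.

Definition fixed_tables (ts : seq (lab -> nat)) :=
  foldr (fun D Q => (exists2 b, fixed b & potential D b) /\ Q) True ts.

Lemma profile_fixed ts l m : fixed_tables ts -> l \in X -> m \in X -> s (eps l) = eps m ->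
  profile ts l = profile ts m.
Proof.
move=> + lX mX lm; elim: ts => //= D ts IH [[b [bX sb] pD] /IH->].
congr (code4 _ :: _); rewrite -(distance_lbl pD bX lX) -(distance_lbl pD bX mX) -lm -{2}sb.
exact/esym/(aut_distance sL).
Qed.

(** An automorphism fixing [l] and the reference points permutes the neighbours of [l] and preserves
    their profiles, so it fixes every neighbour whose profile is unique. *)
Lemma rigid_nbrs_fixed ts l m : fixed_tables ts -> fixed l -> m \in rigid_nbrs ts l -> fixed m.
Proof.
move=> tsF [lX sl] /rigid_nbrsP; rewrite nbrsTE => -[H [k kl mE]].
have [kX _] := nbrs_X lX kl; rewrite -mE in kX; split=> //.
have : s (eps m) \in adj (eps l).
  by rewrite -sl s_adj ?eps_P //; apply/(in_adj _ lX); exists k; rewrite ?mE.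
case/(in_adj _ lX)=> k' k'l e; have [k'X _] := nbrs_X lX k'l.
by rewrite e -(H k' k'l) //; apply: profile_fixed e.
Qed.

Lemma rigid_step ts base l : fixed_tables ts -> {in base, forall b, fixed b} -> fixed l ->
  foldr (fun f Q => fixed (f l) /\ Q) True (rigid_steps (rigid_table ts) base).
Proof.
move=> tsF bF lF; rewrite /rigid_steps foldr_cat.
have: foldr (fun f Q => fixed (f l) /\ Q) True
    [seq (fun l => nth l (odflt [::] (tfind (lkey l) (rigid_table ts))) i) | i <- iota 0 22].
  elim: (iota 0 22) => //= i r IH; split=> {IH}//.
  case tE: tfind => [u|] /=; last by rewrite nth_nil.
  have [e _ [/lkey_inj le uE]] := rigid_tableP tE; rewrite -{}le in uE.
  move: (rigid_table ts) tE uE => t _ uE.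
  case: (ltnP i (size u)) => iu; last by rewrite nth_default.
  by apply: (rigid_nbrs_fixed tsF lF); rewrite -uE mem_nth.
move: (foldr _ True (map _ (iota _ _))) => Q q.
elim: base bF => //= b base IH bF; split; first by apply: bF; rewrite mem_head.
by apply: IH => c cb; apply: bF; rewrite inE cb orbT.
Qed.

Lemma closure_fixed ts base l :
    fixed_tables ts -> {in base, forall b, fixed b} -> fixed x0 ->
    isome (tfind (lkey l) (reach lkey (rigid_steps (rigid_table ts) base) 100 x0)) ->
  fixed l.
Proof.
move=> tsF bF x0F; case tE: tfind => [m|//] _.
have [] := reachP (R := fixed) _ x0F tE; first by move=> k; apply: rigid_step.
by move=> mF /lkey_inj <-.
Qed.

Lemma fixed_tables_cons D b ts : fixed b -> potential D b -> fixed_tables ts ->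
  fixed_tables (D :: ts).
Proof. by move=> bF pD tsF; split=> //; exists b. Qed.

Lemma fixed_ts5 : [/\ fixed x0, fixed x1, fixed n1, fixed n2 & fixed n3] -> fixed_tables ts5.
Proof.
case=> f0 f1 f2 f3 f4; have [p1 p2 p3 p4 _] := tabs_check.
exact: (fixed_tables_cons f0 dist0_check (fixed_tables_cons f1 p1 (fixed_tables_cons f2 p2
  (fixed_tables_cons f3 p3 (@fixed_tables_cons _ _ [::] f4 p4 I))))).
Qed.

Lemma fixed_ts6 : [/\ fixed x0, fixed x1, fixed n1, fixed n2 & fixed n3] -> fixed n4 ->
  fixed_tables ts6.
Proof.
case=> f0 f1 f2 f3 f4 f5; have [p1 p2 p3 p4 p5] := tabs_check.
exact: (fixed_tables_cons f0 dist0_check (fixed_tables_cons f1 p1 (fixed_tables_cons f2 p2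
  (fixed_tables_cons f3 p3 (fixed_tables_cons f4 p4 (@fixed_tables_cons _ _ [::] f5 p5 I)))))).
Qed.

Lemma rigid : {in base5, forall b, s (eps b) = eps b} -> {in P, forall x, s x = x}.
Proof.
move=> sb; have bF b : b \in base5 -> fixed b.
  by move=> b5; split; [apply: base_X; rewrite mem_rcons inE b5 orbT | apply: sb].
have bF' : forall b, b \in [:: x0; x1; n1; n2; n3] -> fixed b by exact: bF.
have F : [/\ fixed x0, fixed x1, fixed n1, fixed n2 & fixed n3].
  by split; apply: bF'; rewrite !(inE, eqxx, orbT).
have F4 : fixed n4.
  apply: closure_fixed (fixed_ts5 F) bF _ _; first by case: F.
  by rewrite -closure5E; apply: n4_closure.
have {}bF b : b \in rcons base5 n4 -> fixed b.
  by rewrite mem_rcons inE => /predU1P[->|/bF].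
move=> x /PP[l lX ->]; suff [] : fixed l by [].
apply: closure_fixed (fixed_ts6 F F4) bF _ _; first by case: F.
by rewrite -closure6E; have [e ep <-] := XP lX; move: e ep; apply/allP/closure6_check.
Qed.

End Rigidity.

Lemma stab_lab f l : realizable f -> l \in X -> leqb (lact f l) l -> elt f \in 'C_G[eps l].
Proof.
move=> fr lX /leqbP fx; apply/setIP; split; first by case: fr.
apply/cent1P/commute_sym/commgP/conjg_fixP.
have [_] := good_act (X_good lX) (proj1 fr).
by rewrite -(act_elt_lact _ fr) fx.
Qed.

Lemma n_nbrs : [/\ n1 \in X, n2 \in X & n3 \in X].
Proof. by split; apply: base_X. Qed.

Definition triple_from (t : lab * lab * lab) :=
  [/\ good t.1.1, good t.1.2, good t.2 &
  exists2 g, g \in 'C_G[z0] :&: 'C_G[zz1] &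
    [/\ eps n1 ^ g = eps t.1.1, eps n2 ^ g = eps t.1.2 & eps n3 ^ g = eps t.2]].

Lemma triple_from_step f t : realizable f -> leqb (lact f x0) x0 -> leqb (lact f x1) x1 ->
  triple_from t -> triple_from (lact3 f t).
Proof.
move=> fr f0 f1 [g1 g2 g3 [g gC [e1 e2 e3]]].
have fG := proj1 fr; rewrite /triple_from /lact3 /= !(act_elt_lact _ fr).
have [h1' k1] := good_act g1 fG; have [h2' k2] := good_act g2 fG.
have [h3' k3] := good_act g3 fG; split=> //; exists (g * elt f).
  by rewrite groupM // inE stab_x0 ?stab_lab ?x1X.
by rewrite !conjgM e1 e2 e3.
Qed.

Lemma triple_trans a b c : a \in N5 -> b \in N5 -> c \in N5 -> a != b -> a != c -> b != c ->
  exists2 g, g \in 'C_G[z0] :&: 'C_G[zz1] &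
    [/\ eps n1 ^ g = eps a, eps n2 ^ g = eps b & eps n3 ^ g = eps c].
Proof.
move=> aN bN cN ab ac bc.
have := triple_orbit_reached aN bN cN ab ac bc; rewrite triple_orbitE.
case tE: tfind => [t|//] _.
have {tE}H := reachP (R := triple_from) _ _ tE; case: H.
- move=> {}t Rt; have /andP[_ /and5P[i1 i2 i3 _ _]] := stabx0_fix.
  have /and4P[j1 j2 j3 _] := A5gens_fix; have [r1 r2 r3] := A5_real.
  split; first exact: triple_from_step r1 i1 j1 Rt.
  split; first exact: triple_from_step r2 i2 j2 Rt.
  by split; first exact: triple_from_step r3 i3 j3 Rt.
- by have [/X_good ? /X_good ? /X_good ?] := n_nbrs; split=> //; exists 1; rewrite ?conjg1.
by move=> [_ _ _ R] /lkey3_inj e; rewrite e in R.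
Qed.

(** With distance 3 from [z0], this describes the neighbours of [zz1] in [N5] by distances only,
    hence invariantly under automorphisms that fix [z0] and [zz1]. *)
Definition typeB y := #|[set z in adj y | distance geo z0 z == 2]| == 3.

Lemma typeBE l : l \in X -> typeB (eps l) = eqn (count (fun k => eqn (dist k.1) 2) (nbrs l)) 3.
Proof.
move=> lX; congr (_ == 3).
have [_ u] := andP (uniq_nbx (eps_P lX)); rewrite -/(adj _) in u.
have e : [set z in adj (eps l) | distance geo z0 z == 2] =i
    [seq z <- adj (eps l) | distance geo z0 z == 2].
  by move=> z; rewrite in_set mem_filter andbC.
rewrite (eq_card e) (card_uniqP (filter_uniq _ u)) size_filter /adj nbx_map lblK // -map_comp count_map.
apply: eq_in_count => m /(nbrs_X lX)[m1 _] /=.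
by rewrite distxE ?eps_P // /distx lblK.
Qed.

Lemma N5P y : y \in adj zz1 -> distance geo z0 y = 3 -> typeB y ->
  exists2 n, n \in N5 & y = eps n.
Proof.
case/(in_adj _ x1X) => m mx ->; have [m1 _] := nbrs_X x1X mx.
rewrite (distance_lbl dist0_pot x0X m1) typeBE // => d3 tB.
have /andP[/allP/(_ m) H _] := N5_check; exists m.1 => //.
move: H; rewrite nbrsTE dist0E mx d3 tB => /(_ isT)/hasP[n nN /leqbP e].
by rewrite e.
Qed.

Lemma n_typeB n : n \in [:: n1; n2; n3] ->
  [/\ eps n \in adj zz1, distance geo z0 (eps n) = 3 & typeB (eps n)].
Proof.
move=> nn; have nX : n \in X.
  by have [? ? ?] := n_nbrs; move: nn; rewrite !inE => /or3P[]/eqP->.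
have /andP[_ /allP/(_ n nn)] := N5_check.
rewrite nbrsTE dist0E => /andP[/andP[/hasP[m mx /leqbP mn] /eqP d3] tB].
rewrite typeBE // (distance_lbl dist0_pot x0X nX) d3; split=> //.
by apply/(in_adj _ x1X); exists m; rewrite ?mn.
Qed.

(** Conjugation moves elements of the whole group type, while a geometric automorphism is the
    identity outside the points; hence the restriction. *)
Definition aut_of g := restr_perm P (cperm g).

Lemma cperm_norm g : g \in G -> cperm g \in 'N(P | 'P).
Proof.
by move=> Gg; apply/astabsP=> x; rewrite /= apermE cpermE PJ.
Qed.

Lemma aut_ofE g x : g \in G -> x \in P -> aut_of g x = x ^ g.
Proof. by move=> Gg xP; rewrite -cpermE; apply: restr_permE xP; apply: cperm_norm. Qed.

Lemma aut_of_aut g : g \in G -> aut_of g \in geom_aut geo.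
Proof.
move=> Gg; rewrite inE restr_perm_on /=.
apply/eqP; rewrite -[RHS](cperm_L Gg); apply: eq_in_imset => l lL.
by apply: eq_in_imset => x /(subsetP (L_P lL)) xP; rewrite aut_ofE ?cpermE.
Qed.

Lemma aut_ofM : {in G &, {morph aut_of : g h / g * h}}.
Proof.
move=> g h Gg Gh; rewrite /aut_of /cperm.
by rewrite -morphM ?cperm_norm //= morphM ?inE.
Qed.

Canonical aut_of_morphism := Morphism aut_ofM.

Lemma aut_of_inj : 'injm aut_of.
Proof.
apply/subsetP=> g /morphpreP[Gg /set1P g1]; apply/set1P.
apply: cent_P_trivial => // x xP; apply: commute_sym; apply: commute_sym; apply/commute_sym/conj_commute.
by rewrite -aut_ofE // g1 perm1.
Qed.

Lemma distz0_trans x : x \in P -> distance geo z0 x = 4 -> exists2 g, g \in 'C_G[z0] & zz1 ^ g = x.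
Proof. by move=> xP; rewrite distxE //; apply: x1_trans. Qed.

Lemma aut_of_surj s : s \in geom_aut geo -> exists2 g, g \in G & s = aut_of g.
Proof.
move=> sA.
(* Three corrections by elements of G make s fix [z0], then [zz1], then three elements of [N5];
   [reduce] undoes one of them. *)
have reduce g t : g \in G -> t \in geom_aut geo ->
    (exists2 h, h \in G & t * aut_of g^-1 = aut_of h) -> exists2 h, h \in G & t = aut_of h.
  move=> Gg tA [h Gh e]; exists (h * g); rewrite ?groupM // aut_ofM // -e.
  by rewrite -mulgA -aut_ofM ?groupV // mulVg (morph1 aut_of_morphism) mulg1.
have zz1P : zz1 \in P by apply/eps_P/x1X.
have mulE g t x : g \in G -> t \in geom_aut geo -> x \in P -> (t * aut_of g^-1) x = t x ^ g^-1.
  by move=> Gg tA xP; rewrite permM aut_ofE ?groupV ?sP.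
have mulA g t : g \in G -> t \in geom_aut geo -> t * aut_of g^-1 \in geom_aut geo.
  by move=> Gg tA; rewrite groupM ?aut_of_aut ?groupV.
have [g0 Gg0 e0] : exists2 g, g \in G & z0 ^ g = s z0 by apply: P_trans; rewrite sP ?z0P.
apply: (reduce g0) => //; move: (mulA g0 s Gg0 sA) (mulE g0 s z0 Gg0 sA z0P).
rewrite -e0 conjgK; move: (s * _) => {e0 sA}s sA s0.
have [||g1 /setIP[Gg1 /cent1P c1] e1] := @distz0_trans (s zz1).
- by rewrite sP.
- by rewrite -{1}s0 (aut_distance (sL sA)) distxE // distx_zz1.
apply: (reduce g1) => //; move: (mulA g1 s Gg1 sA) (mulE g1 s z0 Gg1 sA z0P) (mulE g1 s zz1 Gg1 sA zz1P).
rewrite -e1 conjgK s0 (commute_conj (commuteV (commute_sym c1))).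
move: (s * _) => {e1 sA s0}s sA s0 s1.
have sn n : n \in [:: n1; n2; n3] -> exists2 a, a \in N5 & s (eps n) = eps a.
  move=> /n_typeB[na nd nB]; apply: N5P.
  - by rewrite -{1}s1 s_adj.
  - by rewrite -{1}s0 (aut_distance (sL sA)).
  move: nB; rewrite /typeB -{1}(card_imset _ (@perm_inj _ s)).
  set A := imset _ _; suff -> : A = [set z in adj (s (eps n)) | distance geo z0 z == 2] by [].
  have nP : eps n \in P.
    have : collinear geo zz1 (eps n) by rewrite colE zz1P.
    by case/(collinear_points geo_lines_sub).
  apply/setP=> z; apply/imsetP/idP => [[y]|].
    by rewrite !in_set => /andP[ya yd] ->; rewrite s_adj // ya -{1}s0 (aut_distance (sL sA)).
  rewrite !in_set -{1 2}(permKV s z) s_adj // -{1}s0 (aut_distance (sL sA)) => H.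
  by exists (s^-1 z); rewrite ?permKV // in_set.
have [|a aN ae] := sn n1; first by rewrite !inE eqxx.
have [|b bN be] := sn n2; first by rewrite !inE eqxx orbT.
have [|c cN ce] := sn n3; first by rewrite !inE eqxx !orbT.
have [n1X n2X n3X] := n_nbrs.
have neq n m a' b' : n \in X -> m \in X -> s (eps n) = eps a' -> s (eps m) = eps b' -> n != m -> a' != b'.
  move=> nX mX na mb; apply: contraNneq => e; apply/eqP/(eps_inj nX mX)/(@perm_inj _ s).
  by rewrite na mb e.
have [g2 gC [f1 f2 f3]] := triple_trans aN bN cN (neq _ _ _ _ n1X n2X ae be isT)
  (neq _ _ _ _ n1X n3X ae ce isT) (neq _ _ _ _ n2X n3X be ce isT).
case/setIP: gC => /setIP[Gg2 /cent1P c0] /setIP[_ /cent1P c1'].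
apply: (reduce g2) => //; exists 1 => //; rewrite (morph1 aut_of_morphism).
have tA := mulA _ _ Gg2 sA.
apply/permP=> x; rewrite perm1; case: (boolP (x \in P)) => xP; last first.
  by move: tA; rewrite inE => /andP[/out_perm-> ].
apply: (rigid tA) xP => d; rewrite !inE.
have nP n : n \in X -> eps n \in P by apply: eps_P.
case/or4P=> [/eqP->|/eqP->|/eqP->|/orP[]/eqP->]; rewrite mulE ?nP ?x0X ?x1X //.
- by rewrite -/z0 s0 (commute_conj (commuteV (commute_sym c0))).
- by rewrite -/zz1 s1 (commute_conj (commuteV (commute_sym c1'))).
- by rewrite ae -f1 conjgK.
- by rewrite be -f2 conjgK.
- by rewrite ce -f3 conjgK.
Qed.

Lemma geo_aut_isog : geom_aut geo \isog G.
Proof.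
rewrite isog_sym; apply/isogP; exists aut_of_morphism; first exact: aut_of_inj.
apply/setP=> s; apply/imsetP/idP => [[g]|/aut_of_surj[g Gg ->]].
  by rewrite setIid => Gg ->; apply: aut_of_aut.
by exists g; rewrite ?setIid.
Qed.

Lemma lab_prod_real ls : all inX ls -> realizable (lab_prod ls).
Proof.
move=> lsX; suff [g Gg gE] : exists2 g, g \in G & act g =1 lab_prod ls by apply: realizableP gE.
elim/last_ind: ls lsX => [|ls l IH]; first by exists 1; rewrite ?act1.
rewrite all_rcons -mem_X => /andP[lX /IH[g Gg gE]].
exists (g * eps l); first by rewrite groupM ?eps_G.
by move=> x; rewrite actM gE act_eps // /lab_prod foldl_rcons.
Qed.

Definition ga := elt hata.
Definition gb := elt hatb.

Lemma hat_real : realizable hata /\ realizable hatb.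
Proof. by have := gens_labels; rewrite all_cat => /andP[??]; split; apply: lab_prod_real. Qed.

(** * Full subgeometries *)

(* The graph of a homomorphism from [J2] to [G]. *)
Definition Delta : {group 'S_100 * gT} := <<[set (J2_a, ga); (J2_b, gb)]>>%G.

Lemma Delta_JG d : d \in Delta -> d.1 \in J2 /\ d.2 \in G.
Proof.
elim/gen_ind=> {d}[|d e [d1 d2] eg]; first by rewrite !group1.
have [[_ _] [ra rb]] := (J2_gens_inv, hat_real).
have aJ : J2_a \in J2 by rewrite mem_gen ?inE ?eqxx.
have bJ : J2_b \in J2 by rewrite mem_gen ?inE ?eqxx ?orbT.
have gaG : ga \in G by case: ra.
have gbG : gb \in G by case: rb.
by case/set2P: eg => ->; split; rewrite /= groupM.
Qed.

Lemma J2_Delta s : s \in J2 -> exists g, (s, g) \in Delta.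
Proof.
elim/gen_ind=> {s}[|s t [g sg] tg]; first by exists 1; apply: group1.
have aD : (J2_a, ga) \in Delta by rewrite mem_gen ?inE ?eqxx.
have bD : (J2_b, gb) \in Delta by rewrite mem_gen ?inE ?eqxx ?orbT.
by case/set2P: tg => ->; [exists (g * ga); apply: (groupM sg aD) | exists (g * gb); apply: (groupM sg bD)].
Qed.

Definition related (p : ptab * lab) := good p.2 /\
  exists2 d, d \in Delta & reprs p.1 (zS ^ d.1) /\ z0 ^ d.2 = eps p.2.

Lemma related_step s t t' f p : realizable f -> (s, elt f) \in Delta -> reprs t s -> reprs t' s^-1 ->
  related p -> related (tconj p.1 t t', lact f p.2).
Proof.
move=> fr sD ts ts' [gp [d dD [rp ep]]].
have [gp' e'] := good_act gp (proj1 fr); rewrite /related /= (act_elt_lact _ fr); split=> //.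
exists (d * (s, elt f)); first exact: groupM.
by split; rewrite /= conjgM; [apply: repr_conj | rewrite ep].
Qed.

Lemma hj_related k p : tfind k hj_reach = Some p -> related p /\ lkey p.2 = k.
Proof.
rewrite hj_reachE; apply: reachP.
  move=> q Rq; have [aV bV] := J2_gens_inv; have [ra rb] := hat_real.
  have aD : (J2_a, ga) \in Delta by rewrite mem_gen ?inE ?eqxx.
  have bD : (J2_b, gb) \in Delta by rewrite mem_gen ?inE ?eqxx ?orbT.
  split; first by apply: (related_step ra aD repr_tA _ Rq); rewrite aV; apply: repr_tA.
  by split=> //; apply: (related_step rb bD repr_tB _ Rq); rewrite bV; apply: repr_tBV.
split; first exact: x0_good.
by exists 1; rewrite ?group1 // !conjg1; split=> //; apply: repr_tz.
Qed.

Definition hjl : seq (ptab * lab) := locked (telems hj_reach).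

Lemma hjlP p : p \in hjl -> related p /\ tfind (lkey p.2) hj_reach = Some p.
Proof.
rewrite /hjl -lock => /telemsP[k kE]; have [R kk] := hj_related kE; rewrite kk.
exact: (conj R kE).
Qed.

Definition inh : lab -> bool := locked in_hj.

Lemma inhP l : reflect (exists2 p, p \in hjl & p.2 = l) (inh l).
Proof.
rewrite /inh -lock /in_hj; apply: (iffP idP) => [|[p /hjlP[_ e] <-]]; last by rewrite e.
case pT: tfind => [p|//] _; have [_ /lkey_inj pl] := hj_related pT.
by exists p; [rewrite /hjl -lock; exact: mem_telems pT | exact: pl].
Qed.

Lemma hj_tabE p : p \in hjl -> hj_tab p.2 = p.1.
Proof. by case/hjlP=> _; rewrite hj_tab_find => ->. Qed.

Definition hnb := locked (hj_nbrs x0).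
Definition firsts0 := [seq eps m.1 | m <- hnb].

Lemma hjl_facts p : p \in hjl -> [/\ p.2 \in X, Bool.eqb (teqb p.1 tz) (leqb p.2 x0) &
  tcommb p.1 tz = leqb p.2 x0 || has_fst p.2 hnb].
Proof.
rewrite /hjl /hnb -!lock => /(allP hj_commute_checked)/and3P[pX e c]; rewrite mem_X; split=> //.
by case: ifP c => // _ /negbTE.
Qed.

Lemma nbrs_hj m : m \in hnb = [&& m \in nbrs x0, inh m.1 & inh m.2].
Proof. rewrite /hnb /inh -lock -[locked in_hj]lock -nbrsTE; exact: mem_sub_nbrs. Qed.

Transparent step_ok.
Lemma hj_find_step (f : ptab * lab -> ptab * lab) p : step_ok hj_reach f p ->
  exists2 q, q \in hjl & q.2 = (f p).2 /\ teqb q.1 (f p).1.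
Proof.
rewrite /step_ok; case qT: tfind => [q|//] e; have [_ /lkey_inj ql] := hj_related qT.
by exists q; [rewrite /hjl -lock; exact: mem_telems qT | exact: conj ql e].
Qed.

Lemma reprs_teqb t u s : teqb t u -> reprs u s -> reprs t s.
Proof. by move=> /allP e us i; rewrite -us; apply/eqfP/e/pc_codes. Qed.

Lemma hj_closed_at p : p \in hjl -> step_ok hj_reach stepa p /\ step_ok hj_reach stepb p.
Proof. rewrite /hjl -lock => /(allP hj_closed_checked); exact: step_okP. Qed.

Lemma hjl_step p : p \in hjl ->
  (exists2 q, q \in hjl & q.2 = lact hata p.2 /\
     forall s, reprs (tconj p.1 tA tA) s -> reprs q.1 s) /\
  (exists2 q, q \in hjl & q.2 = lact hatb p.2 /\
     forall s, reprs (tconj p.1 tB tBV) s -> reprs q.1 s).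
Proof.
move=> pH; have [pa pb] := hj_closed_at pH.
have [q qH [q2 q1]] := hj_find_step pa.
have [r rH [r2 r1]] := hj_find_step pb.
split; [exists q; [exact: qH | split; [exact: q2 | move=> s; exact: reprs_teqb q1]] |
  exists r; [exact: rH | split; [exact: r2 | move=> s; exact: reprs_teqb r1]]].
Qed.

(** The table contains the base pair and is closed under both generators, so it contains every
    conjugate of the base pair under [Delta]. *)
Lemma hjl_complete d : d \in Delta ->
  exists2 p, p \in hjl & reprs p.1 (zS ^ d.1) /\ z0 ^ d.2 = eps p.2.
Proof.
elim/gen_ind=> {d}[|d e [p pH [rp ep]] eg].
  have [p pH p2] : exists2 p, p \in hjl & p.2 = x0.
    by apply/inhP; rewrite /inh -lock; apply: hj_base.
  have [_ e _] := hjl_facts pH; exists p => {pH}//.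
  rewrite !conjg1 p2; split=> //; apply: reprs_teqb repr_tz.
  by rewrite (beqP e) p2; apply/leqbP.
have [aV bV] := J2_gens_inv; have [ra rb] := hat_real; have [[gp _] _] := hjlP pH.
have [[q qH [q2 qr]] [r rH [r2 rr]]] := hjl_step pH.
case/set2P: eg => ->; [exists q => // | exists r => //]; rewrite ?q2 ?r2 /= !conjgM ep; split.
- by apply: qr; apply: repr_conj rp repr_tA _; rewrite aV; apply: repr_tA.
- by rewrite (act_elt_lact _ ra); apply: (good_act gp (proj1 ra)).2.
- by apply: rr; apply: repr_conj rp repr_tB _; rewrite bV; apply: repr_tBV.
- by rewrite (act_elt_lact _ rb); apply: (good_act gp (proj1 rb)).2.
Qed.

Lemma Delta_fix d : d \in Delta -> (zS ^ d.1 == zS) = (z0 ^ d.2 == z0).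
Proof.
case/hjl_complete=> p pH [rp ep]; have [pX /beqP e _] := hjl_facts pH.
by rewrite -(repr_eq rp repr_tz) e ep (inj_in_eq eps_inj) ?x0X.
Qed.

Lemma Delta_comm d : d \in Delta ->
  (zS ^ d.1 * zS == zS * zS ^ d.1) = (z0 ^ d.2 == z0) || (z0 ^ d.2 \in firsts0).
Proof.
case/hjl_complete=> p pH [rp ep]; have [pX _ e] := hjl_facts pH.
rewrite -(repr_comm rp repr_tz) e ep (inj_in_eq eps_inj) ?x0X //; congr (_ || _).
apply/hasP/mapP => [[m mn /leqbP <-]|[m mn]]; first by exists m.
have m1 : m.1 \in X by move: mn; rewrite nbrs_hj => /and3P[/(nbrs_X x0X)[]].
by move/(eps_inj pX m1) => pm; exists m; rewrite // pm; apply/leqbP.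
Qed.

(** By [W_eq] this is the graph of a bijection from the class of [zS] in J_2 to a set of points of
    the octagon, obtained without showing that [Delta] is single-valued. *)
Definition W : {set 'S_100 * gT} := [set (zS ^ d.1, z0 ^ d.2) | d in Delta].

Lemma WP w : reflect (exists2 d, d \in Delta & w = (zS ^ d.1, z0 ^ d.2)) (w \in W).
Proof. exact: imsetP. Qed.

(** After conjugation by the inverse of the second witness, the two equations say that an element of
    [Delta] fixes [zS], respectively [z0]; [Delta_fix] equates these. *)
Lemma W_eq w v : w \in W -> v \in W -> (w.1 == v.1) = (w.2 == v.2).
Proof.
case/WP=> d dD -> /WP[e eD ->] /=; have := Delta_fix (groupM dD (groupVr eD)).
by rewrite /= !conjgM -!(canF_eq (conjgKV _)) // !(can2_eq (conjgKV _) (conjgK _)).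
Qed.

Lemma hj_product_at m : m \in hnb -> teqb (tcomp tz (hj_tab m.1)) (hj_tab m.2).
Proof. rewrite /hnb -lock => mn; exact: (allP hj_product_checked m mn). Qed.

Definition H0 : {set gT} := [set w.2 | w in W].

Lemma H0P y : reflect (exists2 d, d \in Delta & y = z0 ^ d.2) (y \in H0).
Proof.
apply: (iffP imsetP) => [[w /WP[d dD ->] ->]|[d dD ->]]; first by exists d.
by exists (zS ^ d.1, z0 ^ d.2) => //; apply/WP; exists d.
Qed.

Lemma H0_P y : y \in H0 -> y \in P.
Proof. by case/H0P=> d /Delta_JG[_ dG] ->; rewrite PJ ?z0P. Qed.

Lemma H0J d y : d \in Delta -> (y ^ d.2 \in H0) = (y \in H0).
Proof.
move=> dD; apply/H0P/H0P => [[e eD ey]|[e eD ->]].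
  exists (e * d^-1); first by rewrite groupM ?groupV.
  by rewrite /= conjgM -ey conjgK.
by exists (e * d); rewrite ?groupM //= conjgM.
Qed.

Lemma z0H : z0 \in H0.
Proof. by apply/H0P; exists 1; rewrite ?group1 ?conjg1. Qed.

Lemma H0_inh l : l \in X -> (eps l \in H0) = inh l.
Proof.
move=> lX; apply/H0P/inhP => [[d dD e]|[p pH <-]].
  have [p pH [_ ep]] := hjl_complete dD; exists p => //.
  by have [pX _ _] := hjl_facts pH; apply: eps_inj => //; rewrite -ep -e.
by have [[_ [d dD [_ e]]] _] := hjlP pH; exists d.
Qed.

Definition hn y := [seq q <- nbx y | (q.1 \in H0) && (q.2 \in H0)].

Lemma mem_hn y q : (q \in hn y) = [&& q \in nbx y, q.1 \in H0 & q.2 \in H0].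
Proof. by rewrite mem_filter andbC. Qed.

Lemma hnJ d y q : d \in Delta -> y \in P -> (cpair d.2 q \in hn (y ^ d.2)) = (q \in hn y).
Proof.
by move=> dD yP; have [_ dG] := Delta_JG dD; rewrite !mem_hn nbxJ // !H0J.
Qed.

Lemma hn_z0 q : q \in hn z0 -> exists2 m, m \in hnb & q = epair m.
Proof.
rewrite mem_hn nbx_map lblK ?x0X // => /and3P[/mapP[m mn ->]].
have [m1 m2] := nbrs_X x0X mn; rewrite !H0_inh // => h1 h2.
exists m; last by []; rewrite nbrs_hj mn h1; exact: h2.
Qed.

Lemma hnb_hn m : m \in hnb -> epair m \in hn z0.
Proof.
rewrite nbrs_hj => /and3P[mn h1 h2]; have [m1 m2] := nbrs_X x0X mn.
by rewrite mem_hn nbx_map lblK ?x0X // map_f // !H0_inh // h1.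
Qed.

Lemma firsts0_hn y : (y \in firsts0) = (y \in [seq q.1 | q <- hn z0]).
Proof.
apply/mapP/mapP => [[m mn ->]|[q /hn_z0[m mn ->] ->]]; last by exists m.
by exists (epair m); first exact: hnb_hn.
Qed.

Lemma W_base w d : d \in Delta -> w \in W -> (w.1 ^ d.1, w.2 ^ d.2) \in W.
Proof. by move=> dD /WP[e eD ->]; apply/WP; exists (e * d); rewrite ?groupM //= !conjgM. Qed.

Lemma W_comm w v : w \in W -> v \in W ->
  (w.1 * v.1 == v.1 * w.1) = (v.2 == w.2) || (v.2 \in [seq q.1 | q <- hn w.2]).
Proof.
case/WP=> d dD -> vW /=; have dV := groupVr dD.
have /WP[e eD [e1 e2]] := W_base dV vW; have [_ dG] := Delta_JG dD.
have -> : v = ((zS ^ e.1) ^ d.1, (z0 ^ e.2) ^ d.2) by move: e1 e2 => /= <- <-; rewrite !conjgKV -surjective_pairing.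
rewrite /= -!conjMg !(inj_eq (@conjg_inj _ _)) eq_sym Delta_comm // firsts0_hn; congr (_ || _).
apply/mapP/mapP => [[q qz qe]|[q qz qe]].
  by exists (cpair d.2 q); rewrite ?hnJ ?z0P //= qe.
exists (cpair d.2^-1 q); last by rewrite /= -qe conjgK.
by rewrite -(hnJ _ dD z0P) -{1}[d.2]invgK cpairK.
Qed.

Definition rho y : 'S_100 := odflt 1 [pick x | (x, y) \in W].

Lemma rhoP y : y \in H0 -> (rho y, y) \in W.
Proof.
case/imsetP=> w wW ->; rewrite /rho; case: pickP => [x //|/(_ w.1)].
by rewrite -surjective_pairing wW.
Qed.

Lemma rho_eq x y : (x, y) \in W -> rho y = x.
Proof.
move=> xyW; have yH : y \in H0 by apply/imsetP; exists (x, y).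
by apply/eqP; rewrite (W_eq (rhoP yH) xyW).
Qed.

Lemma rho_reprs p : p \in hjl -> eps p.2 \in H0 /\ reprs p.1 (rho (eps p.2)).
Proof.
move=> pH; have [[_ [d dD [rp e]]] _] := hjlP pH.
have wW : (zS ^ d.1, eps p.2) \in W by apply/WP; exists d; rewrite // e.
by split; [apply/imsetP; exists (zS ^ d.1, eps p.2) | rewrite (rho_eq wW)].
Qed.

Lemma rho_tab l : inh l -> reprs (hj_tab l) (rho (eps l)).
Proof. by case/inhP=> p pH <-; rewrite hj_tabE //; case: (rho_reprs pH). Qed.

Lemma rho_z0 : rho z0 = zS.
Proof. by apply: rho_eq; apply/WP; exists 1; rewrite ?group1 ?conjg1. Qed.

Lemma rho_class y : y \in H0 -> rho y \in zS ^: J2.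
Proof. by move/rhoP/WP=> [d /Delta_JG[dJ _] [-> _]]; apply: imset_f. Qed.

Lemma rho_inj : {in H0 &, injective rho}.
Proof. by move=> y y' /rhoP yW /rhoP y'W e; apply/eqP; rewrite -(W_eq yW y'W) /= e. Qed.

Lemma rho_H0 : [set rho y | y in H0] = zS ^: J2.
Proof.
apply/setP=> x; apply/imsetP/imsetP => [[y /rho_class/imsetP[s sJ ->] ->]|[s sJ ->]].
  by exists s.
have [g gD] := J2_Delta sJ.
have wW : (zS ^ s, z0 ^ g) \in W by apply/WP; exists (s, g).
exists (z0 ^ g); last by rewrite (rho_eq wW).
by apply/imsetP; exists (zS ^ s, z0 ^ g).
Qed.

Lemma card_H0 : #|H0| = 315.
Proof.
have u : uniq [seq p.2 | p <- hjl] by rewrite /hjl -lock; apply: hj_labels_uniq.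
have -> : #|H0| = #|[seq eps l | l <- [seq p.2 | p <- hjl]]|.
  apply: eq_card => y; apply/idP/mapP => [yH|[l /mapP[p pH ->] ->]]; last by case: (rho_reprs pH).
  have [d dD e] := H0P _ yH; have [p pH [_ ep]] := hjl_complete dD.
  by exists p.2; rewrite ?map_f // e ep.
rewrite (card_uniqP _) ?size_map; first by rewrite /hjl -lock; apply: hj_labels_size.
rewrite map_inj_in_uniq // => l m /mapP[p pH ->] /mapP[q qH ->].
by have [pX _ _] := hjl_facts pH; have [qX _ _] := hjl_facts qH; apply: eps_inj.
Qed.

Lemma rho_comm y y' : y \in H0 -> y' \in H0 ->
  (rho y * rho y' == rho y' * rho y) = (y' == y) || (y' \in [seq q.1 | q <- hn y]).
Proof. by move=> /rhoP yW /rhoP y'W; rewrite (W_comm yW y'W). Qed.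

Lemma rho_mul y q : y \in H0 -> q \in hn y -> rho y * rho q.1 = rho q.2.
Proof.
case/H0P=> d dD -> qd; have [dJ dG] := Delta_JG dD.
have {qd} : cpair d.2^-1 q \in hn z0 by rewrite -(hnJ _ dD z0P) -{1}[d.2]invgK cpairK.
case/hn_z0=> m mn e; have -> : q = cpair d.2 (epair m) by rewrite -e -{1}[d.2]invgK cpairK.
have rhoJ x : x \in H0 -> rho (x ^ d.2) = rho x ^ d.1.
  by move=> /rhoP yW; apply: rho_eq; apply: (W_base dD yW).
have := hnb_hn mn; rewrite mem_hn => /and3P[_ m1 m2].
rewrite !rhoJ ?z0H // -conjMg rho_z0 /=; congr (_ ^ _).
have := mn; rewrite nbrs_hj => /and3P[_ i1 i2].
apply/eqP; rewrite -(repr_eq (repr_comp repr_tz (rho_tab i1)) (rho_tab i2)).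
exact: hj_product_at mn.
Qed.

Lemma rho_invol y : y \in H0 -> rho y * rho y = 1.
Proof.
move/rho_class/imsetP=> [s sJ ->]; rewrite -conjMg.
have -> : zS * zS = 1 by have := expg_order zS; rewrite zS_order.
exact: conj1g.
Qed.

Definition qlabs := [seq m.1 | m <- hnb].

Lemma qlabs_tab : [seq hj_tab l | l <- qlabs] = qtabs.
Proof. rewrite /qlabs -map_comp /hnb -lock; exact: qtabsE. Qed.

Lemma qlabsP l : l \in qlabs -> [/\ inh l, l \in X & eps l \in [seq q.1 | q <- hn z0]].
Proof.
case/mapP=> m mn ->; split.
- by move: mn; rewrite nbrs_hj => /and3P[].
- by move: mn; rewrite nbrs_hj => /and3P[/(nbrs_X x0X)[]].
exact: (map_f fst (hnb_hn mn)).
Qed.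

(** Generated by [zS] and the ten involutions collinear with it; it plays for J_2 the part that [K]
    plays for G. *)
Definition KJ : {group 'S_100} :=
  <<[set x in [seq rho (eps l) | l <- catrev qlabs [:: x0]]]>>%G.

Lemma mem_KJ l : l \in qlabs -> rho (eps l) \in KJ.
Proof. move=> lq; apply: mem_gen; rewrite in_set; apply: (map_f (fun l => rho (eps l))).
by rewrite catrevE mem_cat mem_rev lq. Qed.

Lemma inh_H0 l : inh l -> eps l \in H0.
Proof. by case/inhP=> p pH <-; case: (rho_reprs pH). Qed.

Lemma inh_x0 : inh x0.
Proof. by rewrite /inh -lock; apply: hj_base. Qed.

Lemma KJ_pgroup : 2.-group KJ.
Proof.
apply: (@tchain_pgroup _ hj_tab (fun l => rho (eps l))).
- move=> l; rewrite mem_cat inE => /orP[/eqP->|/qlabsP[lh _ _]].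
    by split; [apply/rho_tab/inh_x0 | apply/rho_invol/z0H].
  by split; [apply: rho_tab | apply/rho_invol/inh_H0].
- rewrite qlabs_tab; exact: tchain_check.
have -> : [set x in [seq rho (eps l) | l <- [:: x0]]] = [set zS].
  by apply/setP=> x; rewrite !inE rho_z0.
by rewrite /pgroup -[#|_|]/(#[zS]) zS_order.
Qed.

Lemma KJ_cent t : t \in 'C_J2(KJ) -> #[t] = 2 -> t = zS.
Proof.
case/setIP=> tJ /centP ct t2.
have [|||t1|//] := @cent_qs _ qlabs hj_tab (fun l => rho (eps l)) t _ tJ.
- move=> l lq; have [lh _ _] := qlabsP lq; split; first exact: rho_tab.
  exact/commute_sym/ct/mem_KJ.
- move=> l /qlabsP[lh _ lz]; rewrite -rho_z0; apply/commute_sym/eqP.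
  by rewrite rho_comm ?z0H ?inh_H0 // lz orbT.
- exact: qlabs_tab.
by rewrite t1 order1 in t2.
Qed.

Lemma central_involutions_J2 : central_involutions J2 = zS ^: J2.
Proof.
apply: (@central_involutions_class _ J2 zS zS_J2 zS_order KJ).
- by rewrite -rho_H0 card_in_imset ?card_H0 //; apply: rho_inj.
- rewrite gen_subG; apply/subsetP=> x; rewrite in_set => /mapP[l + ->].
  rewrite catrevE mem_cat mem_rev inE => lq.
  have : eps l \in H0 by case/orP: lq => [/qlabsP[/inh_H0]|/eqP->] //; apply: z0H.
  by move/rho_class/imsetP=> [s sJ ->]; rewrite groupJ ?zS_J2.
- exact: KJ_pgroup.
exact: KJ_cent.
Qed.

Definition h0 : geometry gT := (H0, [set l in L | l \subset H0]).

Lemma HJ_iso : geom_isomorphic h0 HJ.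
Proof.
have HJE : points HJ = zS ^: J2 by rewrite -central_involutions_J2.
apply/geom_isomorphicP; exists rho; split.
- exact: rho_inj.
- by rewrite HJE; apply: rho_H0.
have image y q : y \in H0 -> q \in hn y ->
    [set rho x | x in lset y q] = triple (rho y) (rho q.1).
  by move=> yH qy; rewrite /lset !imsetU !imset_set1 /triple rho_mul.
apply/setP=> t; apply/imsetP/imset2P => [[l]|[x x']].
  rewrite inE => /andP[/LP[y yP [q qy ->]] /subsetP sub].
  have yH : y \in H0 by apply: sub; rewrite in_lset eqxx.
  have q1H : q.1 \in H0 by apply: sub; rewrite in_lset eqxx orbT.
  have q2H : q.2 \in H0 by apply: sub; rewrite in_lset eqxx !orbT.
  have qh : q \in hn y by rewrite mem_hn qy q1H.
  rewrite (image _ _ yH qh) => ->; exists (rho y) (rho q.1) => //.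
    by rewrite central_involutions_J2 rho_class.
  have [n _ _] := nbx_neq yP qy.
  rewrite in_set central_involutions_J2 rho_class //= (inj_in_eq rho_inj) // n /=.
  by rewrite rho_comm // map_f ?orbT.
rewrite in_set central_involutions_J2 -rho_H0 => /imsetP[y yH ->] /andP[/imsetP[y' yH' ->]].
rewrite (inj_in_eq rho_inj) // => /andP[n]; rewrite rho_comm // eq_sym (negbTE n) /=.
case/mapP=> q qy e ->; exists (lset y q); last by rewrite (image _ _ yH qy) e.
move: qy; rewrite mem_hn => /and3P[qy q1H q2H]; rewrite inE L_lset ?H0_P //=.
by apply/subsetP=> u; rewrite in_lset => /or3P[]/eqP->.
Qed.

(** * Transport of distances and of near lines by G *)

Local Notation dd := (distance geo).

Lemma ddJ g x y : g \in G -> dd (x ^ g) (y ^ g) = dd x y.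
Proof. exact: distJ. Qed.

Lemma dd_dec x y : x \in P -> y \in P -> x != y ->
  exists2 q, q \in nbx y & dd x y = (dd x q.1).+1.
Proof.
case/P_trans=> g Gg <- yP n; have yP' : y ^ g^-1 \in P by rewrite PJ ?groupV.
have [_ /(_ _ yP')[_ _ dec]] := potentialP dist0_pot.
have [|q qy e] := dec; first by apply: contraNneq n => e; rewrite -[y](conjgKV g) e.
have [q1P _] := nbxP yP' qy.
exists (cpair g q); first by rewrite -[y](conjgKV g) nbxJ.
by rewrite -{1}[y](conjgKV g) !ddJ // !distxE.
Qed.

Lemma dd0 x y : x \in P -> y \in P -> (dd x y == 0) = (x == y).
Proof.
move=> xP yP; case: (eqVneq x y) => [<-|n]; last by have [q _ ->] := dd_dec xP yP n.
case/P_trans: xP => g Gg <-; rewrite ddJ // distxE ?z0P // /distx /z0 lblK ?x0X //.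
by have [-> _] := potentialP dist0_pot.
Qed.

Lemma dd1 x q : x \in P -> q \in nbx x -> dd x q.1 = 1%N.
Proof.
move=> xP qx; have [q1P _] := nbxP xP qx; have [n _ _] := nbx_neq xP qx.
have /near3P[le _ _] := geo_near xP xP qx.
have /eqP x0' : dd x x == 0 by rewrite dd0.
have := dd0 xP q1P; rewrite (negbTE n); move: le; rewrite x0'.
by case: (dd x q.1) => [|[]].
Qed.

Lemma dd1_adj x y : x \in P -> y \in P -> dd x y = 1%N -> exists2 q, q \in nbx y & q.1 = x.
Proof.
move=> xP yP e; have n : x != y by rewrite -dd0 // e.
have [q qy] := dd_dec xP yP n; rewrite e => -[/esym/eqP]; rewrite dd0 //; last by case: (nbxP yP qy).
by move/eqP=> qe; exists q.
Qed.

Lemma dd_sym x y : dd x y = dd y x. Proof. exact: distance_sym. Qed.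

Lemma uniq_nb x : x \in P -> uniq (nbx x).
Proof. by move/uniq_nbx/andP=> [_ /map_uniq]. Qed.

Lemma nbJ_perm (nb : gT -> seq (gT * gT)) g x : uniq (nb x) -> uniq (nb (x ^ g)) ->
    (forall q, (cpair g q \in nb (x ^ g)) = (q \in nb x)) ->
  perm_eq (nb (x ^ g)) [seq cpair g q | q <- nb x].
Proof.
move=> u u' H; apply: uniq_perm => //.
  by rewrite map_inj_uniq //; apply: (can_inj (cpairK g)).
have KV q : cpair g (cpair g^-1 q) = q by rewrite -{1}[g]invgK cpairK.
move=> q; apply/idP/mapP => [qx|[r rx ->]]; last by rewrite H.
by exists (cpair g^-1 q); rewrite ?KV // -H KV.
Qed.

Lemma nbx_perm g x : g \in G -> x \in P -> perm_eq (nbx (x ^ g)) [seq cpair g q | q <- nbx x].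
Proof.
by move=> Gg xP; apply: nbJ_perm => [||q]; rewrite ?uniq_nb ?PJ // nbxJ.
Qed.

Lemma uniq_hn x : x \in P -> uniq (hn x).
Proof. by move=> xP; apply/filter_uniq/uniq_nb. Qed.

Lemma hn_perm d x : d \in Delta -> x \in P -> perm_eq (hn (x ^ d.2)) [seq cpair d.2 q | q <- hn x].
Proof.
move=> dD xP; have [_ dG] := Delta_JG dD.
by apply: nbJ_perm => [||q]; rewrite ?uniq_hn ?PJ // hnJ.
Qed.

Lemma hnE l : l \in X -> hn (eps l) = [seq epair m | m <- sub_nbrs inh (nbrs l)].
Proof.
move=> lX; rewrite /hn nbx_map lblK // filter_map; congr map.
apply: eq_in_filter => m /(nbrs_X lX)[m1 m2] /=.
by rewrite !H0_inh //; case: (inh m.1).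
Qed.

Lemma hj_local_at l : inh l -> hj_local dist (sub_nbrs inh (nbrs l)) (dist l).
Proof.
case/inhP=> p; rewrite /hjl -lock => ph <-; rewrite -nbrsTE -dist0E /inh -lock.
exact: (allP hj_local_checked _ (map_f snd ph)).
Qed.

Lemma H0_local x y : x \in H0 -> y \in H0 -> hj_local (dd x) (hn y) (dd x y).
Proof.
case/H0P=> d dD -> yH; have [_ dG] := Delta_JG dD.
have dV : d^-1 \in Delta by rewrite groupV.
have {yH} : y ^ d.2^-1 \in H0 by rewrite (H0J y dV).
rewrite -{2 3}[y](conjgKV d.2); move: (y ^ d.2^-1) => {}y yH; have yP := H0_P yH.
rewrite (hj_local_perm _ _ (hn_perm dD yP)) ddJ // (hj_local_map (fun u => u ^ d.2)).
rewrite (@eq_in_hj_local _ _ (dd z0)) => [|m _]; last by rewrite !ddJ.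
have [l lX e] := PP _ yP; rewrite e in yH *.
have {yH}lh : inh l by rewrite -H0_inh.
rewrite hnE // hj_local_map (@eq_in_hj_local _ _ dist) => [|m]; last first.
  rewrite mem_sub_nbrs => /and3P[/(nbrs_X lX)[m1 m2] _ _].
  by rewrite !(distance_lbl dist0_pot x0X).
rewrite (distance_lbl dist0_pot x0X) //; exact: hj_local_at.
Qed.

Lemma XjP y g : g \in G -> y \in P -> exists2 l, l \in X & y = eps l ^ g.
Proof.
move=> Gg yP; have /PP[l lX e] : y ^ g^-1 \in P by rewrite PJ ?groupV.
by exists l; rewrite // -e conjgKV.
Qed.

Lemma dist_lbl l : l \in X -> dd z0 (eps l) = dist l.
Proof. exact: distance_lbl dist0_pot x0X. Qed.

Lemma count_nbxJ g x p : g \in G -> x \in P ->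
  count p (nbx (x ^ g)) = count (fun q => p (cpair g q)) (nbx x).
Proof. by move=> Gg xP; rewrite (seq.permP (nbx_perm Gg xP)) count_map. Qed.

Lemma count_nbx l p : l \in X -> count p (nbx (eps l)) = count (fun m => p (epair m)) (nbrs l).
Proof. by move=> lX; rewrite nbx_map lblK // count_map. Qed.

Lemma common_at l : l \in X -> dist l = 2 -> count (at_dist dist 1) (nbrs l) <= 3.
Proof.
move/XP=> [e ep <-]; rewrite distE // nbrsE // -dist0E => e2.
by have := allP common_check e ep; rewrite e2.
Qed.

Lemma common_nbrs x w : x \in P -> w \in P -> dd x w = 2 -> count (at_dist (dd x) 1) (nbx w) <= 3.
Proof.
case/P_trans=> g Gg <- /(XjP Gg)[l lX ->]; rewrite ddJ // dist_lbl // => l2.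
rewrite count_nbxJ ?eps_P // count_nbx //; apply: leq_trans (common_at lX l2).
apply: eq_leq; apply: eq_in_count => m /(nbrs_X lX)[m1 _].
by rewrite /at_dist /= ddJ // dist_lbl.
Qed.

Definition typeA x y := (dd x y == 3) && (4 <= count (at_dist (dd x) 2) (nbx y)).

Lemma typeAJ g x y : g \in G -> y \in P -> typeA (x ^ g) (y ^ g) = typeA x y.
Proof.
move=> Gg yP; rewrite /typeA ddJ // count_nbxJ //; congr (_ && (_ <= _)).
by apply: eq_count => q; rewrite /at_dist /= ddJ.
Qed.

Lemma typeA_lbl l : l \in X -> typeA z0 (eps l) = typeA_lab dist l.
Proof.
move=> lX; rewrite /typeA /typeA_lab dist_lbl // nbrsTE count_nbx //.
have -> : count (fun m => at_dist (dd z0) 2 (epair m)) (nbrs l) = count (at_dist dist 2) (nbrs l).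
  by apply: eq_in_count => m /(nbrs_X lX)[m1 _]; rewrite /at_dist /= dist_lbl.
by [].
Qed.

Lemma spread_at s u k : s \in snbrs x0 -> u \in nbrs s.1 -> dist u.1 = 2 -> k \in nbrs u.1 ->
  ~~ typeA_lab dist k.1.
Proof.
rewrite /snbrs -nbrsTE -dist0E => sn un u2 kn.
have /allP/(_ u un) := allP spread_check s sn.
by rewrite /at_dist u2 => /allP/(_ k kn).
Qed.

Lemma near_at : count (fun m => typeA_lab dist m.1) (wnbrs x1) = 5.
Proof. by rewrite /wnbrs -nbrsTE -dist0E; apply/eqP; apply: near_check. Qed.

Lemma antipodes_count : count (fun l => dist l == 4) X = 2048.
Proof.
rewrite /X -lock count_map; rewrite -(eqnP antipodes_check); apply: eq_in_count => e ep /=.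
by rewrite distE.
Qed.

Lemma no_spread x s u k : x \in P -> s \in snb x -> u \in nbx s.1 -> dd x u.1 = 2 ->
  k \in nbx u.1 -> ~~ typeA x k.1.
Proof.
case/P_trans=> g Gg <-; have KV q : q = cpair g (cpair g^-1 q) by rewrite -{1}[g]invgK cpairK.
rewrite [s]KV [u]KV [k]KV snbJ ?z0P //; move: (cpair g^-1 s) (cpair g^-1 u) (cpair g^-1 k).
move=> {}s {}u {}k sz; have sx : s \in nbx z0 by rewrite mem_cat sz.
have [s1P _] := nbxP z0P sx; rewrite nbxJ // => us; have [u1P _] := nbxP s1P us.
rewrite ddJ // nbxJ // => du ku; have [k1P _] := nbxP u1P ku.
rewrite typeAJ //; move: sz; rewrite /snb lblK ?x0X // => /mapP[ms msn se].
have msx : ms \in nbrs x0 by rewrite nbrs_cat mem_cat msn.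
have [ms1 _] := nbrs_X x0X msx.
move: us; rewrite se nbx_map lblK // => /mapP[mu mun ue]; have [mu1 _] := nbrs_X ms1 mun.
move: ku; rewrite ue nbx_map lblK // => /mapP[mk mkn ->]; have [mk1 _] := nbrs_X mu1 mkn.
rewrite typeA_lbl //; rewrite ue dist_lbl // in du.
exact: (spread_at msn mun du mkn).
Qed.

Lemma near_five z x : z \in P -> x \in P -> dd z x = 4 -> count (fun q => typeA z q.1) (wnb x) = 5.
Proof.
case/P_trans=> g Gg <- /(XjP Gg)[l lX ->]; rewrite ddJ // distxE ?eps_P //.
move/(x1_trans (eps_P lX)) => [h /setIP[Gh /cent1P ch] <-]; rewrite -conjgM.
have -> : z0 ^ g = z0 ^ (h * g) by rewrite conjgM (commute_conj (commute_sym ch)).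
have Ghg : h * g \in G by rewrite groupM.
have wp : perm_eq (wnb (zz1 ^ (h * g))) [seq cpair (h * g) q | q <- wnb zz1].
  have zP : zz1 \in P by apply/eps_P/x1X.
  have uw y : y \in P -> uniq (wnb y) by move/uniq_nb; rewrite cat_uniq => /and3P[].
  by apply: nbJ_perm => [||q]; rewrite ?uw ?PJ // wnbJ.
rewrite (seq.permP wp) count_map -near_at /wnb lblK ?x1X // count_map.
apply: eq_in_count => m mw /=.
have [m1 _] := nbrs_X x1X (mem_drop mw).
by rewrite typeAJ ?eps_P // typeA_lbl.
Qed.

Lemma card_X_pred (p : lab -> bool) : #|[set y in P | p (lbl y)]| = count p X.
Proof.
have u : uniq [seq eps l | l <- X & p l].
  rewrite map_inj_in_uniq ?filter_uniq ?uniq_X // => l m.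
  by rewrite !mem_filter => /andP[_ lX] /andP[_ mX]; apply: eps_inj.
rewrite -size_filter -(size_map eps) -(card_uniqP u); apply: eq_card => y.
rewrite in_set; apply/andP/mapP => [[yP pl]|[l]].
  by exists (lbl y); rewrite ?epsK // mem_filter pl lbl_X.
by rewrite mem_filter => /andP[pl lX] ->; rewrite eps_P // lblK.
Qed.

Lemma card_antipodes x : x \in P -> #|[set y in P | dd x y == 4]| = 2048.
Proof.
case/P_trans=> g Gg <-.
have -> : [set y in P | dd (z0 ^ g) y == 4] = [set y in P | dd z0 y == 4] :^ g.
  apply/setP=> y; rewrite mem_conjg [LHS]in_set [RHS]in_set PJ ?groupV //.
  by rewrite -{2}[y](conjgKV g) ddJ.
rewrite cardJg -antipodes_count -card_X_pred; apply: eq_card => y; rewrite [LHS]in_set [RHS]in_set.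
by case: (boolP (y \in P)) => // yP; rewrite distxE.
Qed.

Definition bit Y (q : gT * gT) := (dd Y q.1 == 2) || (dd Y q.2 == 2).

Lemma has_leqb a s : has (leqb a) s = (a \in s).
Proof.
apply/hasP/idP => [[b bs /leqbP->] //|as_]; exists a => //; exact/leqbP.
Qed.

Lemma adj_sym x y : x \in P -> y \in P -> (x \in adj y) = (y \in adj x).
Proof.
by move=> xP yP; have := collinear_sym geo y x; rewrite !colE xP yP.
Qed.

Lemma dd_adj x y u : x \in P -> y \in P -> u \in adj y -> dd x u <= (dd x y).+1 /\ dd x y <= (dd x u).+1.
Proof. by move=> xP yP /mapP[q qy ->]; have /near3P[? ? _] := geo_near xP yP qy. Qed.

Lemma dd1_adjE x y : x \in P -> y \in P -> (dd x y == 1%N) = (y \in adj x).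
Proof.
move=> xP yP; apply/eqP/idP => [/(dd1_adj xP yP)[q qy <-]|/mapP[q qx ->]]; last exact: dd1.
by rewrite adj_sym //; [apply: map_f | case: (nbxP yP qy)].
Qed.

Lemma mid_point x y : x \in P -> y \in P -> dd x y = 2 ->
  exists2 w, w \in adj x & (w \in P) && (y \in adj w).
Proof.
move=> xP yP e; have n : x != y by rewrite -dd0 // e.
have [q qy] := dd_dec xP yP n; rewrite e => -[/esym/eqP]; have [q1P _] := nbxP yP qy.
rewrite dd1_adjE // => qx; exists q.1 => //; rewrite q1P adj_sym //; exact: map_f.
Qed.

(** A common neighbour has distance at least 2 from [z0] because [l] has 3, and at most 2 because
    [u] has 1, so filtering by distance 2 loses nothing. *)
Lemma near_setP l u : l \in X -> u \in X -> dist l = 3 -> dist u = 1%N ->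
  (u \in near_set dist l) = (dd (eps l) (eps u) == 2).
Proof.
move=> lX uX l3 u1; have lP := eps_P lX; have uP := eps_P uX.
rewrite -(dist_lbl lX) in l3; rewrite -(dist_lbl uX) in u1.
rewrite /near_set nbrsTE; apply/flattenP/eqP => [[_ /mapP[w + ->] /mapP[k + e]]|d2].
  rewrite !mem_filter => /andP[_ wl] /andP[_ kw].
  have [w1 _] := nbrs_X lX wl; have [k1 _] := nbrs_X w1 kw.
  have wadj : eps w.1 \in adj (eps l) by apply/(in_adj _ lX); exists w.
  have uadj : eps u \in adj (eps w.1) by apply/(in_adj _ w1); exists k; rewrite ?e.
  have [le _] := dd_adj lP (eps_P w1) uadj; move: wadj; rewrite -dd1_adjE ?eps_P // => /eqP w1'.
  rewrite w1' in le; apply/eqP; rewrite eqn_leq le /= leqNgt ltnS leq_eqVlt ltnS leqn0.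
  rewrite dd1_adjE // dd0 //; apply/norP; split.
    by apply/negP=> /(dd_adj z0P lP)[_]; rewrite l3 u1.
  by apply: contra_eqN l3 => /eqP->; rewrite u1.
have [y yl /andP[yP uy]] := mid_point lP uP d2.
have [w wl ye] := in_adj _ lX yl; have [w1 _] := nbrs_X lX wl.
rewrite ye in yl yP uy; have [k kw ke] := in_adj _ w1 uy; have [k1 _] := nbrs_X w1 kw.
have uk : u = k.1 by apply: eps_inj.
exists [seq k.1 | k <- nbrs w.1 & at_dist dist 1 k].
  apply: map_f; rewrite mem_filter wl andbT /at_dist -dist_lbl //; apply/eqnP.
  have [_ g1] := dd_adj z0P lP yl; rewrite l3 in g1.
  have uy' : eps w.1 \in adj (eps u) by rewrite adj_sym.
  have [g2 _] := dd_adj z0P uP uy'; rewrite u1 in g2.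
  by apply/eqP; rewrite eqn_leq g2 -ltnS g1.
by apply/mapP; exists k; [rewrite mem_filter kw andbT /at_dist -uk -dist_lbl // u1 | exact: uk].
Qed.

Lemma near_bitsE l : l \in X -> dist l = 3 ->
  near_bits dist (nbrs x0) l = [seq bit (eps l) (epair m) | m <- nbrs x0].
Proof.
move=> lX l3; rewrite /near_bits; apply/eq_in_map => m mn; have [m1 m2] := nbrs_X x0X mn.
have mz : epair m \in nbx z0 by rewrite nbx_map lblK ?x0X // map_f.
have [mz' _] := nbx_sym z0P mz.
have d1 := dd1 z0P mz; have d2 := dd1 z0P mz'; rewrite !dist_lbl // in d1 d2.
by rewrite !has_leqb !near_setP.
Qed.

Lemma eqbitsP s t : reflect (s = t) (eqbits s t).
Proof.
elim: s t => [|a s IH] [|b t]; try by constructor.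
rewrite /=; case: (eqVneq a b) => [->|n].
  have -> : Bool.eqb b b by case: b.
  by apply: (iffP (IH t)) => [->|[]].
have -> : Bool.eqb a b = false by case: a b n => [] [].
by constructor=> -[e _]; rewrite e eqxx in n.
Qed.

Lemma heavyE : heavy = [seq b <- [seq near_bits dist (nbrs x0) l | l <- X & dist l == 3] | 8 <= ntrue b].
Proof.
have e : [seq l <- X | dist l == 3] = [seq eself e | e <- pts & eqn (edist e) 3].
  rewrite /X -lock filter_map; congr map; apply: eq_in_filter => e ep.
  by rewrite /= distE.
rewrite e -map_comp -nbrsTE -dist0E; exact: erefl.
Qed.

Lemma patterns_facts : [/\ {in heavy, forall b, b \in patterns},
  {in patterns &, forall b c, 8 <= ntrue (both b c) -> b = c} &
  {in patterns, forall c, count (eqbits c) heavy <= 64}].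
Proof.
have [pa pb pc'] := patterns_checked; split.
- by move=> b /(allP pa)/hasP[c cp] {pa pb pc'} /eqbitsP->.
- move=> b c bp cp; have := allP (allP pb b bp) c cp.
  by move=> {pa pb pc'} /orP[/eqbitsP|/negP].
move=> c cp; exact: (allP pc' c cp).
Qed.

Lemma mem_heavy l : l \in X -> dist l = 3 -> 8 <= ntrue (near_bits dist (nbrs x0) l) ->
  near_bits dist (nbrs x0) l \in heavy.
Proof.
move=> lX l3 h; rewrite heavyE mem_filter h; apply: (map_f (near_bits dist (nbrs x0))).
by rewrite mem_filter l3.
Qed.

(** Patterns with four lines in common coincide, by [patterns_facts]; the 8 counts four lines in
    both orders. *)
Lemma bits_common l m : l \in X -> m \in X -> dist l = 3 -> dist m = 3 ->
    8 <= count (fun q => bit (eps l) q && bit (eps m) q) (nbx z0) ->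
  {in nbx z0, bit (eps l) =1 bit (eps m)}.
Proof.
move=> lX mX l3 m3 h; have [p1 p2 _] := patterns_facts.
have nz : nbx z0 = [seq epair k | k <- nbrs x0] by rewrite nbx_map lblK ?x0X.
have le (a b : pred (gT * gT)) : 8 <= count (fun q => a q && b q) (nbx z0) -> 8 <= count a (nbx z0).
  by move/leq_trans; apply; apply: sub_count => q /andP[].
have hl : 8 <= ntrue (near_bits dist (nbrs x0) l).
  by rewrite near_bitsE // /ntrue count_map; move: (le _ _ h); rewrite nz count_map.
have h' : 8 <= count (fun q => bit (eps m) q && bit (eps l) q) (nbx z0).
  by apply: leq_trans h _; apply/eq_leq/eq_count => q; apply: andbC.
have hm : 8 <= ntrue (near_bits dist (nbrs x0) m).
  by rewrite near_bitsE // /ntrue count_map; move: (le _ _ h'); rewrite nz count_map.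
have e : near_bits dist (nbrs x0) l = near_bits dist (nbrs x0) m.
  apply: p2; [exact/p1/mem_heavy | exact/p1/mem_heavy |].
  rewrite !near_bitsE // /both zip_map -map_comp /ntrue count_map.
  by move: h; rewrite nz count_map.
move=> q; rewrite nz => /mapP[k kn ->].
by move: e; rewrite !near_bitsE // => /eq_in_map/(_ k kn).
Qed.

Lemma bits_class l : l \in X -> dist l = 3 -> 8 <= count (bit (eps l)) (nbx z0) ->
  #|[set y in P | (dd z0 y == 3) && all (fun q => bit (eps l) q == bit y q) (nbx z0)]| <= 64.
Proof.
move=> lX l3 h; have [p1 _ p3] := patterns_facts.
have nz : nbx z0 = [seq epair k | k <- nbrs x0] by rewrite nbx_map lblK ?x0X.
have hl : 8 <= ntrue (near_bits dist (nbrs x0) l).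
  by rewrite near_bitsE // /ntrue count_map; move: h; rewrite nz count_map.
apply: leq_trans (p3 _ (p1 _ (mem_heavy lX l3 hl))).
rewrite heavyE count_filter count_map count_filter -card_X_pred subset_leq_card //.
apply/subsetP=> y; rewrite in_set => /and3P[yP d3 /allP al].
have yX := lbl_X yP; have y3 : dist (lbl y) = 3.
  by rewrite -dist_lbl // epsK //; apply/eqP.
have e : near_bits dist (nbrs x0) l = near_bits dist (nbrs x0) (lbl y).
  rewrite !near_bitsE // epsK //; apply/eq_in_map => k kn; apply/eqP/al.
  by rewrite nz map_f.
by rewrite in_set yP /= y3 -e hl (introT (eqbitsP _ _)).
Qed.

Lemma bitJ g Y q : g \in G -> bit (Y ^ g) (cpair g q) = bit Y q.
Proof. by move=> Gg; rewrite /bit /= !ddJ. Qed.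

Lemma near_bits_eq x Y Y' : x \in P -> Y \in P -> Y' \in P -> dd x Y = 3 -> dd x Y' = 3 ->
    8 <= count (fun q => bit Y q && bit Y' q) (nbx x) ->
  {in nbx x, bit Y =1 bit Y'}.
Proof.
case/P_trans=> g Gg <- /(XjP Gg)[l lX ->] /(XjP Gg)[m mX ->]; rewrite !ddJ // !dist_lbl // => l3 m3.
rewrite count_nbxJ ?z0P // => h q qz.
have qE : q = cpair g (cpair g^-1 q) by rewrite -{1}[g]invgK cpairK.
move: qz; rewrite qE nbxJ ?z0P // => qz; rewrite !bitJ //; apply: bits_common qz => //.
by move: h; congr (_ <= _); apply: eq_count => r; rewrite !bitJ.
Qed.

Lemma near_bits_class x Y : x \in P -> Y \in P -> dd x Y = 3 -> 8 <= count (bit Y) (nbx x) ->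
  #|[set y in P | (dd x y == 3) && all (fun q => bit Y q == bit y q) (nbx x)]| <= 64.
Proof.
case/P_trans=> g Gg <- /(XjP Gg)[l lX ->]; rewrite ddJ // dist_lbl // => l3.
rewrite count_nbxJ ?z0P // => h; have {}h : 8 <= count (bit (eps l)) (nbx z0).
  by move: h; congr (_ <= _); apply: eq_count => r; rewrite bitJ.
apply: leq_trans (bits_class lX l3 h); rewrite -[X in _ <= X](cardJg _ g) subset_leq_card //.
apply/subsetP=> y; rewrite in_set => /and3P[yP d3 al]; rewrite mem_conjg in_set PJ ?groupV // yP.
rewrite -[y](conjgKV g) ddJ // in d3; rewrite d3; apply/allP=> q qz.
have /eqP := allP al (cpair g q) (etrans (nbxJ q Gg z0P) qz).
by rewrite bitJ // -{1}[y](conjgKV g) bitJ // => ->.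
Qed.

Lemma count_inj (A B : eqType) (f : A -> B) (s : seq A) (t : seq B) (p : pred A) (p' : pred B) :
    uniq s -> {in s &, injective f} -> {in s, forall a, p a -> f a \in t /\ p' (f a)} ->
  count p s <= count p' t.
Proof.
move=> us inj H; rewrite -!size_filter -(size_map f); apply: uniq_leq_size.
  rewrite map_inj_in_uniq ?filter_uniq // => a b.
  by rewrite !mem_filter => /andP[_ /inj] i /andP[_ /i].
move=> _ /mapP[a + ->]; rewrite !mem_filter => /andP[pa /H/(_ pa)[ft pf]].
by rewrite pf.
Qed.

Lemma hnH x q : x \in H0 -> q \in hn x -> [/\ q \in nbx x, q.1 \in H0 & q.2 \in H0].
Proof. by move=> xH; rewrite mem_hn => /and3P[]. Qed.

Lemma hn_sym x q : x \in H0 -> q \in hn x -> (q.2, q.1) \in hn x /\ (x, q.2) \in hn q.1.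
Proof.
move=> xH qx; have [qn q1 q2] := hnH xH qx; have [qs qt] := nbx_sym (H0_P xH) qn.
by rewrite !mem_hn qs qt /= q1 q2 xH.
Qed.

Lemma card_H0_dist x k : x \in H0 ->
  #|[set y in H0 | dd x y == k]| = count (fun l => eqn (dist l) k) [seq p.2 | p <- hjl].
Proof.
case/H0P=> d dD ->; have [_ dG] := Delta_JG dD.
have -> : [set y in H0 | dd (z0 ^ d.2) y == k] = [set y in H0 | dd z0 y == k] :^ d.2.
  apply/setP=> y; rewrite mem_conjg [LHS]in_set [RHS]in_set (H0J y (groupVr dD)).
  by rewrite -{2}[y](conjgKV d.2) ddJ.
rewrite cardJg -size_filter; set s := filter _ _.
have sX l : l \in s -> [/\ l \in X, inh l & dist l == k].
  rewrite mem_filter => /andP[dk /mapP[p pH e]]; have [pX _ _] := hjl_facts pH.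
  by rewrite e in dk *; split=> //; apply/inhP; exists p.
have us : uniq s by apply: filter_uniq; rewrite /hjl -lock; apply: hj_labels_uniq.
have u : uniq [seq eps l | l <- s].
  by rewrite map_inj_in_uniq // => l m /sX[lX _ _] /sX[mX _ _]; apply: eps_inj.
rewrite -(size_map eps) -(card_uniqP u); apply: eq_card => y; rewrite in_set.
apply/andP/mapP => [[yH dk]|[l /sX[lX lh dk] ->]]; last by rewrite H0_inh // dist_lbl.
have yP := H0_P yH; exists (lbl y); rewrite ?epsK // mem_filter.
rewrite -dist_lbl ?lbl_X // epsK // -[eqn _ _]/(dd z0 y == k) dk.
have /inhP[p pH e] : inh (lbl y) by rewrite -H0_inh ?lbl_X // epsK.
by rewrite -e map_f.
Qed.

Lemma card_H0_34 x : x \in H0 ->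
  #|[set y in H0 | dd x y == 3]| = 160 /\ #|[set y in H0 | dd x y == 4]| = 64.
Proof.
move=> xH; rewrite !card_H0_dist // /hjl -lock -dist0E.
have /andP[h3 h4] := hj_counts; exact: (conj (eqnP h3) (eqnP h4)).
Qed.

Lemma has_dist x k (nb : seq (gT * gT)) : has (at_dist (dd x) k) nb ->
  exists2 q, q \in nb & dd x q.1 = k.
Proof. by case/hasP=> q qn /eqnP; exists q. Qed.

Lemma H0_adj x y : x \in H0 -> y \in H0 -> dd x y = 1%N -> exists2 q, q \in hn y & q.1 = x.
Proof.
move=> xH yH e; have := H0_local xH yH; rewrite e => /andP[/has_dist[q qy /eqP]].
have [_ q1 _] := hnH yH qy.
by rewrite dd0 ?H0_P // => /eqP-> _; exists q.
Qed.

Lemma far_line x y : x \in H0 -> y \in H0 -> dd x y = 4 ->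
  exists2 q, q \in hn y & dd x q.1 = 3 /\ dd x q.2 = 4.
Proof.
move=> xH yH e; have := H0_local xH yH; rewrite e => /eqnP c5.
have : has (at_dist (dd x) 3) (hn y) by rewrite has_count c5.
case/has_dist=> q qy q3; exists q => //; split=> //; have [qn _ _] := hnH yH qy.
have /near3P[_ _ K] := geo_near (H0_P xH) (H0_P yH) qn; rewrite e q3 in K.
by case: K => -[h1 h2] //; move: h1; rewrite -h2.
Qed.

(** * Embeddings are isometric *)

Section Embedding.

Variable psi : gT -> gT.
Hypothesis psP : {in H0, forall x, psi x \in P}.
Hypothesis psI : {in H0 &, injective psi}.
Hypothesis psN : forall x q, x \in H0 -> q \in hn x -> (psi q.1, psi q.2) \in nbx (psi x).

Definition ppair (q : gT * gT) := (psi q.1, psi q.2).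

Lemma ppair_inj x : x \in H0 -> {in hn x &, injective ppair}.
Proof.
move=> xH q r /(hnH xH)[_ q1 q2] /(hnH xH)[_ r1 r2] [/(psI q1 r1) e1 /(psI q2 r2) e2].
by rewrite [q]surjective_pairing [r]surjective_pairing e1 e2.
Qed.

Lemma iso1 x y : x \in H0 -> y \in H0 -> dd x y = 1%N -> dd (psi x) (psi y) = 1%N.
Proof.
move=> xH yH /(H0_adj xH yH)[q qy <-]; rewrite dd_sym.
exact: (dd1 (psP yH) (psN yH qy)).
Qed.

(** For a common neighbour q.1, the images of y, q.1 and q.2 form a line. As q.1 is sent to distance
    1, the others go to distance 2 unless one of them meets the image of x, which injectivity
    forbids. *)
Lemma iso2 x y : x \in H0 -> y \in H0 -> dd x y = 2 -> dd (psi x) (psi y) = 2.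
Proof.
move=> xH yH e; have := H0_local xH yH; rewrite e => /andP[/has_dist[q qy qe] _].
have [qn q1 q2] := hnH yH qy; have u1 := iso1 xH q1 qe.
have [_ yq] := hn_sym yH qy; have yN := psN q1 yq.
have /near3P[_ _ H] := geo_near (psP xH) (psP q1) yN; rewrite /= u1 in H.
case: H => -[e1 e2].
- by [].
- case: e1 => /esym/eqP; rewrite dd0 ?psP // => /eqP/(psI xH yH) xy.
  by move: e; rewrite xy => /eqP; rewrite (_ : dd y y = 0) //; apply/eqP; rewrite dd0 ?H0_P.
case: e1 => /esym/eqP; rewrite dd0 ?psP // => /eqP/(psI xH q2) xq.
have [q21 _] := hn_sym yH qy; have [q21n _ _] := hnH yH q21.
by have := dd1 (H0_P yH) q21n; rewrite dd_sym /= -xq e.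
Qed.

Lemma not2 x y : x \in H0 -> y \in H0 -> dd x y = 3 -> dd (psi x) (psi y) <> 2.
Proof.
move=> xH yH e pe; have := H0_local xH yH; rewrite e => /and4P[/eqnP c4 _ _ _].
have := common_nbrs (psP xH) (psP yH) pe; apply/negP; rewrite -ltnNge -c4.
(* When y is sent to distance 2, a line through y with q.1 at distance 2 has its third point q.2
   sent to distance 1. The pairs are reversed to put q.2 first; four of them contradict the bound
   3. *)
apply: (@count_inj _ _ (fun q => ppair (q.2, q.1))); first exact/uniq_hn/H0_P.
  move=> q r qy ry; have [qs _] := hn_sym yH qy; have [rs _] := hn_sym yH ry.
  move/(ppair_inj yH qs rs) => [e2 e1].
  by rewrite [q]surjective_pairing [r]surjective_pairing e1 e2.
move=> q qy /eqnP q2; have [qs _] := hn_sym yH qy; have [_ q1H _] := hnH yH qy.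
split; first exact: (psN yH qs).
have /near3P[_ _ H] := geo_near (psP xH) (psP yH) (psN yH qy).
rewrite /= pe (iso2 xH q1H q2) in H; rewrite /at_dist /=; apply/eqnP.
by case: H => -[h1 h2]; [| | case: h1].
Qed.

(** A line through y leads to q.1 at distance 2. If the claim failed, y or q.2, both at distance 3
    from x, would be sent to distance 2. *)
Lemma iso3 x y : x \in H0 -> y \in H0 -> dd x y = 3 -> dd (psi x) (psi y) = 3.
Proof.
move=> xH yH e; have := H0_local xH yH; rewrite e => /and4P[/eqnP c4 _ _ _].
have : has (at_dist (dd x) 2) (hn y) by rewrite has_count c4.
case/has_dist=> q qy q2; have [qn q1H q2H] := hnH yH qy.
have /near3P[_ _ H] := geo_near (psP xH) (psP yH) (psN yH qy).
rewrite /= (iso2 xH q1H q2) in H.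
have /near3P[_ _ K] := geo_near (H0_P xH) (H0_P yH) qn; rewrite e q2 in K.
have q23 : dd x q.2 = 3 by case: K => -[h1 h2] //; move: h1; rewrite -h2.
case: H => -[h1 h2] //; last by case: (not2 xH yH e); rewrite h1 -h2.
by case: (not2 xH q2H q23); rewrite h2 -h1.
Qed.

Lemma typeA_emb x y : x \in H0 -> y \in H0 -> dd x y = 3 -> typeA (psi x) (psi y).
Proof.
move=> xH yH e; rewrite /typeA iso3 //=; have := H0_local xH yH; rewrite e => /and4P[/eqnP <- _ _ _].
apply: (@count_inj _ _ ppair); [exact/uniq_hn/H0_P | exact: ppair_inj |].
move=> q qy /eqnP q2; have [_ q1H _] := hnH yH qy.
by split; [apply: (psN yH qy) | apply/eqnP/(iso2 xH q1H)].
Qed.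

(** The image of each of the 160 points at distance 3 from x has four near lines among the five
    images, all near to Y too, hence has the pattern of Y; but at most 64 points share a pattern. *)
Lemma no_full_near x Y : x \in H0 -> Y \in P -> dd (psi x) Y = 3 ->
  ~ {in hn x, forall r, bit Y (ppair r)}.
Proof.
move=> xH YP Y3 al.
have h8 : 8 <= count (bit Y) (nbx (psi x)).
  apply: (@leq_trans (count predT (hn x))).
    have := H0_local xH xH; rewrite (_ : dd x x = 0); last by apply/eqP; rewrite dd0 ?H0_P.
    by move/eqnP; rewrite count_predT => ->.
  apply: (@count_inj _ _ ppair); [exact/uniq_hn/H0_P | exact: ppair_inj |].
  by move=> r rx _; split; [apply: psN | apply: al].
have := near_bits_class (psP xH) YP Y3 h8; apply/negP; rewrite -ltnNge.
have [c160 _] := card_H0_34 xH; apply: (@leq_trans 160) => //; rewrite -c160.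
rewrite -(card_in_imset (f := psi)); last first.
  by move=> y y'; rewrite !in_set => /andP[yH _] /andP[yH' _]; apply: psI.
apply/subset_leq_card/subsetP => _ /imsetP[y + ->]; rewrite [y \in _]in_set => /andP[yH /eqP y3].
have y3' := iso3 xH yH y3; rewrite in_set psP // y3' /=; apply/allP=> q qx; apply/eqP/esym.
apply: near_bits_eq qx; rewrite ?psP //.
rewrite dd_sym in y3; have := H0_local yH xH; rewrite y3 => /and4P[_ _ /eqnP <- _].
apply: (@count_inj _ _ ppair); [exact/uniq_hn/H0_P | exact: ppair_inj |].
move=> r rx; have [_ r1 r2] := hnH xH rx => d2; split; first exact: psN.
rewrite al // andbT /bit /=.
by case/orP: d2 => /eqnP /= d2; rewrite (iso2 yH _ d2) ?eqxx ?orbT.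
Qed.

(** Apply [no_full_near] at the point q.1 of a line through y with distances 4, 3, 4 from x. Four
    lines of [H0] through q.1 lead towards x and stay near to its image by [iso2]; the fifth is the
    line of y, near by assumption. *)
Lemma not24 x y : x \in H0 -> y \in H0 -> dd x y = 4 -> dd (psi x) (psi y) <> 2.
Proof.
move=> xH yH e pe; have [q qy [q3 q4]] := far_line xH yH e.
have [qn q1 q2] := hnH yH qy; have [_ yq] := hn_sym yH qy; have [qy' _] := hn_sym q1 yq.
apply: (@no_full_near q.1 (psi x)); rewrite ?psP //; first by rewrite dd_sym iso3.
move=> r rq; have [rn r1 r2] := hnH q1 rq.
have := H0_local xH q1; rewrite q3 => /and4P[_ /eqnP c2 _ /allP/(_ r rq)].
case/or3P=> /eqnP /= dr; rewrite /bit /=; try by rewrite (iso2 xH _ dr) ?eqxx ?orbT.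
have := @uniq_min_size _ [:: (y, q.2); (q.2, y)] [seq m <- hn q.1 | at_dist (dd x) 4 m] _ _ _.
case.
- rewrite /= inE andbT; apply/eqP=> -[e2 _].
  by have [_ n _] := nbx_neq (H0_P yH) qn; rewrite e2 eqxx in n.
- move=> m; rewrite !inE mem_filter /at_dist => /orP[]/eqP->; first by rewrite yq /= e.
  by rewrite qy' /= q4.
- by rewrite size_filter c2.
move=> _ /(_ r); rewrite mem_filter rq /at_dist dr /= !inE.
by move/orP=> [] /eqP->; rewrite /= pe eqxx ?orbT.
Qed.

Lemma iso4 x y : x \in H0 -> y \in H0 -> dd x y = 4 -> dd (psi x) (psi y) = 4.
Proof.
move=> xH yH e; have [q qy [q3 q4]] := far_line xH yH e; have [qn q1 q2] := hnH yH qy.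
have /near3P[_ _ H] := geo_near (psP xH) (psP yH) (psN yH qy).
rewrite /= (iso3 xH q1 q3) in H.
case: H => -[h1 h2] //; first by case: (not24 xH yH e); case: h1.
by case: (not24 xH q2 q4); case: h2.
Qed.

Lemma embedding_iso x y : x \in H0 -> y \in H0 -> dd (psi x) (psi y) = dd x y.
Proof.
move=> xH yH; have := geo_dist4 (H0_P xH) (H0_P yH).
case e: (dd x y) => [|[|[|[|[|k]]]]] // _; last 4 first.
- exact: iso1.
- exact: iso2.
- exact: iso3.
- exact: iso4.
move/eqP: e; rewrite dd0 ?H0_P // => /eqP->.
by apply/eqP; rewrite dd0 ?psP.
Qed.

End Embedding.

Definition emb psi := [/\ {in H0, forall x, psi x \in P}, {in H0 &, injective psi} &
  forall x q, x \in H0 -> q \in hn x -> ppair psi q \in nbx (psi x)].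

Lemma emb_dd psi x y : emb psi -> x \in H0 -> y \in H0 -> dd (psi x) (psi y) = dd x y.
Proof. by case=> e1 e2 e3; apply: embedding_iso. Qed.

Lemma H0_dec x y k : x \in H0 -> y \in H0 -> dd x y = k.+1 -> exists2 q, q \in hn y & dd x q.1 = k.
Proof.
move=> xH yH e; have := H0_local xH yH; have := geo_dist4 (H0_P xH) (H0_P yH); rewrite e.
case: k {e} => [|[|[|[|k]]]] // _.
- by case/andP=> /has_dist ? _.
- by case/andP=> /has_dist ? _.
- by case/and4P=> /eqnP c _ _ _; apply: has_dist; rewrite has_count c.
- by move/eqnP=> c; apply: has_dist; rewrite has_count c.
Qed.

Lemma H0_inc x y k : x \in H0 -> y \in H0 -> dd x y = k -> 0 < k < 4 ->
  exists2 q, q \in hn y & dd x q.1 = k.+1.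
Proof.
move=> xH yH e; have := H0_local xH yH; rewrite e; case: k {e} => [|[|[|[|k]]]] // H _.
- by case/andP: H => _ /has_dist ?.
- by case/andP: H => _ /has_dist ?.
by case/and4P: H => _ /eqnP c _ _; apply: has_dist; rewrite has_count c.
Qed.

(** The line extends to a path of length 3 away from x inside [H0]. Its end is sent to a point of
    type A, which [no_spread] excludes for paths starting along the spread line. *)
Lemma emb_nospread psi x q : emb psi -> x \in H0 -> q \in hn x -> ppair psi q \notin snb (psi x).
Proof.
move=> ep xH qx; have [e1 e2 e3] := ep; have [qn q1 _] := hnH xH qx.
have d1 : dd x q.1 = 1%N by apply: dd1 qn; apply: H0_P.
have [u uq d2] := H0_inc xH q1 d1 isT; have [un u1 _] := hnH q1 uq.
have [k ku d3] := H0_inc xH u1 d2 isT; have [kn k1 _] := hnH u1 ku.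
apply/negP=> sp; have := typeA_emb e1 e2 e3 xH k1 d3; apply/negP.
apply: (@no_spread (psi x) (ppair psi q) (ppair psi u) (ppair psi k)) => //.
- exact: e1.
- exact: e3.
- by rewrite /= emb_dd.
exact: e3.
Qed.

(** Both lists have five elements and the first is contained in the second, which depends on psi
    only through the images of x and z. This is how the lines of a copy are recovered from a pair at
    distance 4. *)
Lemma near_eq psi x z : emb psi -> x \in H0 -> z \in H0 -> dd z x = 4 ->
  [seq psi q.1 | q <- hn x & at_dist (dd z) 3 q] =i
  [seq q.1 | q <- wnb (psi x) & typeA (psi z) q.1].
Proof.
move=> ep xH zH d4; have [e1 e2 e3] := ep.
have := @uniq_min_size _ [seq psi q.1 | q <- hn x & at_dist (dd z) 3 q]
  [seq q.1 | q <- wnb (psi x) & typeA (psi z) q.1] _ _ _.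
case=> //.
- have u := uniq_hn (H0_P xH).
  rewrite map_inj_in_uniq; first exact: (filter_uniq _ u).
  move=> q r.
  rewrite mem_filter => /andP[_ qx]; rewrite mem_filter => /andP[_ rx].
  have [qn q1 q2] := hnH xH qx.
  have [rn r1 r2] := hnH xH rx; move/(e2 _ _ q1 r1) => e.
  have e' : q.2 = r.2 by rewrite -(nbx_mul (H0_P xH) qn) -(nbx_mul (H0_P xH) rn) e.
  by rewrite [q]surjective_pairing [r]surjective_pairing e e'.
- move=> _ /mapP[q + ->]; rewrite mem_filter => /andP[/eqnP d3 qx].
  have [_ q1 _] := hnH xH qx; apply: (@map_f _ _ fst _ (ppair psi q)).
  rewrite mem_filter /= (typeA_emb e1 e2 e3) //=.
  by have := e3 _ _ xH qx; rewrite mem_cat (negbTE (emb_nospread ep xH qx)).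
rewrite !size_map !size_filter near_five ?e1 ?emb_dd //.
by have := H0_local zH xH; rewrite d4 => /eqnP->.
Qed.

Lemma share psi psi' x z x' z' : emb psi -> emb psi' ->
    x \in H0 -> z \in H0 -> x' \in H0 -> z' \in H0 -> dd z x = 4 ->
    psi x = psi' x' -> psi z = psi' z' ->
  forall q, q \in hn x -> exists2 q', q' \in hn x' & psi' q'.1 = psi q.1 /\ psi' q'.2 = psi q.2.
Proof.
move=> ep ep' xH zH xH' zH' d4 ex ez; have [e1 e2 e3] := ep; have [f1 f2 f3] := ep'.
have d4' : dd z' x' = 4 by rewrite -(emb_dd ep') // -ex -ez emb_dd.
have main q : q \in hn x -> dd z q.1 = 3 ->
    exists2 q', q' \in hn x' & psi' q'.1 = psi q.1 /\ psi' q'.2 = psi q.2.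
  move=> qx d3; have : psi q.1 \in [seq psi q.1 | q <- hn x & at_dist (dd z) 3 q].
    by apply: (map_f (fun q => psi q.1)); rewrite mem_filter qx /at_dist d3.
  rewrite near_eq // ex ez -near_eq // => /mapP[q' + e].
  rewrite mem_filter => /andP[_ qx']; exists q' => //; split=> //.
  have := nbx_mul (e1 _ xH) (e3 _ _ xH qx); have := nbx_mul (f1 _ xH') (f3 _ _ xH' qx').
  by rewrite /= -ex -e => -> .
move=> q qx; have [qn _ _] := hnH xH qx; have [qs _] := hn_sym xH qx.
have /near3P[_ _ K] := geo_near (H0_P zH) (H0_P xH) qn; rewrite d4 in K.
(* No distance exceeds 4, so each line through x has a point nearer to z, and [main] covers q or its
   reversal. *)
have [d3|d3] : dd z q.1 = 3 \/ dd z q.2 = 3.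
- case: K => -[h1 h2]; [|by left; case: h1|by right; case: h1].
  have [q1P _] := nbxP (H0_P xH) qn.
  by have := geo_dist4 (H0_P zH) q1P; rewrite h1.
- exact: main.
have [q' qx' [a1 a2]] := main _ qs d3; exists (q'.2, q'.1); last by [].
by case: (hn_sym xH' qx').
Qed.

(** * Copies with a common pair at distance 4 *)

Definition shared (psi psi' : gT -> gT) x := x \in H0 /\ exists z x' z', [/\ z \in H0, x' \in H0, z' \in H0,
  dd z x = 4 & psi x = psi' x' /\ psi z = psi' z'].

(** If the neighbour q.1 of x is at distance 3 from z, the partner z is replaced by a neighbour of z
    at distance 4 from q.1; both copies contain it because they share the lines through z. *)
Lemma shared_step psi psi' x q : emb psi -> emb psi' -> shared psi psi' x -> q \in hn x ->
  shared psi psi' q.1.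
Proof.
move=> ep ep' [xH [z [x' [z' [zH xH' zH' d4 [ex ez]]]]]] qx; have [qn q1 _] := hnH xH qx.
have [q' qx' [a1 _]] := share ep ep' xH zH xH' zH' d4 ex ez qx.
have [_ q1' _] := hnH xH' qx'; split=> //.
have /near3P[_ _ K] := geo_near (H0_P zH) (H0_P xH) qn; rewrite d4 in K.
have [d|d] : dd z q.1 = 4 \/ dd z q.1 = 3.
- case: K => -[h1 h2]; [|by right; case: h1|by left; rewrite h2 -h1].
  have := geo_dist4 (H0_P zH) (H0_P q1); by rewrite h1.
- by exists z, q'.1, z'.
rewrite dd_sym in d; have [r rz d'] := H0_inc q1 zH d isT; have [rn r1 _] := hnH zH rz.
have d4s : dd x z = 4 by rewrite dd_sym.
have [r' rz' [b1 _]] := share ep ep' zH xH zH' xH' d4s ez ex rz.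
have [_ r1' _] := hnH zH' rz'; exists r.1, q'.1, r'.1; split=> //; by rewrite dd_sym.
Qed.

Lemma shared_all psi psi' x y : emb psi -> emb psi' -> shared psi psi' x -> y \in H0 ->
  shared psi psi' y.
Proof.
move=> ep ep' sx; have xH := sx.1; move e: (dd x y) => k; elim: k y e => [|k IH] y e yH.
  by move/eqP: e; rewrite dd0 ?H0_P // => /eqP<-.
have [q qy qk] := H0_dec xH yH e; have [_ q1 _] := hnH yH qy; have [_ yq] := hn_sym yH qy.
exact: (shared_step ep ep' (IH _ qk q1) yq).
Qed.

Definition imgeo (psi : gT -> gT) : geometry gT :=
  ([set psi x | x in H0], [set [set psi x | x in l] | l : {set gT} in lines h0]).

Lemma h0_lineP l : reflect (exists2 x, x \in H0 & exists2 q, q \in hn x & l = lset x q) (l \in lines h0).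
Proof.
rewrite inE; apply: (iffP andP) => [[/LP[x xP [q qx ->]] /subsetP sub]|[x xH [q qx ->]]].
  exists x; first by apply: sub; rewrite in_lset eqxx.
  exists q => //; rewrite mem_hn qx !sub // in_lset eqxx ?orbT //.
have [qn q1 q2] := hnH xH qx; split; first by apply: L_lset => //; apply: H0_P.
by apply/subsetP=> y; rewrite in_lset => /or3P[]/eqP->.
Qed.

Lemma imset_lset (psi : gT -> gT) x q : [set psi y | y in lset x q] = lset (psi x) (ppair psi q).
Proof. by rewrite /lset !imsetU !imset_set1. Qed.

Lemma imgeo_sub psi psi' x : emb psi -> emb psi' -> shared psi psi' x ->
  points (imgeo psi) \subset points (imgeo psi') /\ lines (imgeo psi) \subset lines (imgeo psi').
Proof.
move=> ep ep' sx; split; apply/subsetP.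
  move=> _ /imsetP[y yH ->]; have [_ [z [y' [z' [_ yH' _ _ [-> _]]]]]] := shared_all ep ep' sx yH.
  exact: imset_f.
move=> _ /imsetP[_ /h0_lineP[y yH [q qy ->]] ->].
have [_ [z [y' [z' [zH yH' zH' d4 [ey ez]]]]]] := shared_all ep ep' sx yH.
have [q' qy' [a1 a2]] := share ep ep' yH zH yH' zH' d4 ey ez qy.
apply/imsetP; exists (lset y' q'); first by apply/h0_lineP; exists y' => //; exists q'.
by rewrite !imset_lset /ppair ey a1 a2.
Qed.

Lemma imgeo_eq psi psi' x y x' y' : emb psi -> emb psi' ->
    x \in H0 -> y \in H0 -> x' \in H0 -> y' \in H0 -> dd x y = 4 ->
    psi x = psi' x' -> psi y = psi' y' -> imgeo psi = imgeo psi'.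
Proof.
move=> ep ep' xH yH xH' yH' d4 ex ey.
have d4' : dd x' y' = 4 by rewrite -(emb_dd ep') // -ex -ey emb_dd.
have sh : shared psi psi' y by split=> //; exists x, y', x'.
have sh' : shared psi' psi y' by split=> //; exists x', y, x.
have [s1 s2] := imgeo_sub ep ep' sh; have [t1 t2] := imgeo_sub ep' ep sh'.
rewrite [LHS]surjective_pairing [RHS]surjective_pairing; congr pair; apply/eqP.
  by rewrite eqEsubset s1.
by rewrite eqEsubset s2.
Qed.

(** * Counting the copies *)

Definition copies := [set h : geometry gT | full_subgeometry geo h && geom_isomorphic h HJ].

Lemma h0_lines_sub : {in lines h0, forall l : {set gT}, l \subset points h0}.
Proof. by move=> l; rewrite inE => /andP[]. Qed.

Lemma copyP h : h \in copies -> exists2 psi, emb psi & h = imgeo psi.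
Proof.
rewrite inE => /andP[/and3P[/subsetP sP /subsetP sL /forall_inP full] iso].
have i1 := geom_isomorphic_trans iso (geom_isomorphic_sym 1 h0_lines_sub HJ_iso).
have /geom_isomorphicP[psi [inj eqP' eqL]] := geom_isomorphic_sym 1 (full : {in lines h, forall l : {set gT}, l \subset points h}) i1.
exists psi; last by rewrite [LHS]surjective_pairing -[h.1]/(points h) -[h.2]/(lines h) -eqP' -eqL.
have psP x : x \in H0 -> psi x \in P by move=> xH; apply: sP; rewrite -eqP'; apply: imset_f.
split=> // x q xH qx; have [qn q1 q2] := hnH xH qx.
have lL : lset (psi x) (ppair psi q) \in L.
  apply: sL; rewrite -eqL -imset_lset; apply: imset_f; apply/h0_lineP; exists x => //.
  by exists q.
have xl : psi x \in lset (psi x) (ppair psi q) by rewrite in_lset eqxx.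
have [r rx e] := L_at lL xl.
have [n1 n2 n3] := nbx_neq (H0_P xH) qn.
have nq1 : psi q.1 != psi x by apply: contraNneq n1 => /(inj _ _ q1 xH)->.
have nq2 : psi q.2 != psi x by apply: contraNneq n2 => /(inj _ _ q2 xH)->.
have nq : psi q.1 != psi q.2 by apply: contraNneq n3 => /(inj _ _ q1 q2)->.
have : psi q.1 \in lset (psi x) r by rewrite -e in_lset /= eqxx orbT.
have : psi q.2 \in lset (psi x) r by rewrite -e in_lset /= eqxx !orbT.
rewrite !in_lset (negbTE nq1) (negbTE nq2) /=.
have [rs _] := nbx_sym (psP _ xH) rx.
case/orP=> /eqP a2 /orP[]/eqP a1; first by rewrite a1 a2 eqxx in nq.
- by rewrite /ppair a1 a2.
- by rewrite /ppair a1 a2 -surjective_pairing.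
by rewrite a1 a2 eqxx in nq.
Qed.

Lemma emb_copy psi : emb psi -> imgeo psi \in copies.
Proof.
move=> [psP psI psN]; rewrite inE; apply/andP; split.
  apply/and3P; split.
  - by apply/subsetP=> _ /imsetP[x xH ->]; apply: psP.
  - apply/subsetP=> _ /imsetP[_ /h0_lineP[x xH [q qx ->]] ->].
    by rewrite imset_lset; apply: L_lset; [apply: psP | apply: psN].
  apply/forall_inP=> _ /imsetP[l lh ->]; apply: imsetS; exact: h0_lines_sub.
apply: geom_isomorphic_trans HJ_iso; apply: (geom_isomorphic_sym 1 h0_lines_sub).
by apply/geom_isomorphicP; exists psi.
Qed.

Definition antipodal (A : {set gT}) := [set p : gT * gT | (p.1 \in A) && ((p.2 \in A) && (dd p.1 p.2 == 4))].

Lemma card_pairs (T : finType) (A : {set T}) (Q : T -> T -> bool) :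
  #|[set p : T * T | (p.1 \in A) && Q p.1 p.2]| = (\sum_(x in A) #|[set y | Q x y]|)%N.
Proof.
rewrite -sum1dep_card -(pair_big_dep (fun x => x \in A) Q (fun _ _ => 1%N)) /=.
by apply: eq_bigr => x _; rewrite sum1dep_card.
Qed.

Lemma card_antipodal (A : {set gT}) k : {in A, forall x, #|[set y in A | dd x y == 4]| = k} ->
  #|antipodal A| = (#|A| * k)%N.
Proof.
move=> H; rewrite [LHS](card_pairs A (fun x y => (y \in A) && (dd x y == 4))) -sum_nat_const; apply: eq_bigr => x xA.
by rewrite -(H x xA); apply: eq_card.
Qed.

Lemma card_antipodal_copy h : h \in copies -> #|antipodal (points h)| = (315 * 64)%N.
Proof.
case/copyP=> psi ep ->; have [psP psI psN] := ep.
rewrite -card_H0 -(card_in_imset psI); apply: card_antipodal => _ /imsetP[x xH ->].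
have [_ <-] := card_H0_34 xH.
have -> : [set y in points (imgeo psi) | dd (psi x) y == 4] = [set psi y | y in [set y in H0 | dd x y == 4]].
  apply/setP=> u; rewrite in_set; apply/andP/imsetP => [[/imsetP[y yH ->]]|[y]].
    by rewrite emb_dd // => d; exists y; rewrite // in_set yH.
  by rewrite in_set => /andP[yH d] ->; rewrite imset_f // emb_dd.
apply: card_in_imset => y y'; rewrite !in_set => /andP[yH _] /andP[yH' _]; exact: psI.
Qed.

Lemma copy_unique h h' p : h \in copies -> h' \in copies ->
  p \in antipodal (points h) -> p \in antipodal (points h') -> h = h'.
Proof.
case/copyP=> psi ep -> /copyP[psi' ep' ->]; rewrite !in_set.
case: p => x y /= /and3P[/imsetP[a aH ->] /imsetP[b bH ->] d] /and3P[/imsetP[a' aH' ea] /imsetP[b' bH' eb] _].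
apply: (imgeo_eq ep ep' aH bH aH' bH' _ ea eb).
by move/eqP: d; rewrite emb_dd.
Qed.

Lemma emb_conj g : g \in G -> emb (fun x => x ^ g).
Proof.
move=> Gg; split=> [x xH|x y _ _|x q xH qx]; first by rewrite PJ ?H0_P.
  exact: conjg_inj.
by have [qn _ _] := hnH xH qx; apply: etrans qn; apply: nbxJ => //; apply: H0_P.
Qed.

Lemma copy_exists p : p \in antipodal P -> exists2 h, h \in copies & p \in antipodal (points h).
Proof.
case: p => x y; rewrite in_set /= => /and3P[/P_trans[g Gg <-] yP d].
have [_ c64] := card_H0_34 z0H.
have /card_gt0P[w] : 0 < #|[set y in H0 | dd z0 y == 4]| by rewrite c64.
rewrite in_set => /andP[wH /eqP dw].
have yP' : y ^ g^-1 \in P by rewrite PJ ?groupV.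
have d' : dd z0 (y ^ g^-1) = 4 by rewrite -(ddJ _ _ Gg) conjgKV; apply/eqP.
have [c /setIP[Gc /cent1P cc] ec] := distz0_trans (H0_P wH) dw.
have [b /setIP[Gb /cent1P cb] eb] := distz0_trans yP' d'.
(* Both c and b fix [z0]; they move [zz1] to w and to the conjugate of y by g^-1. So k carries the
   pair ([z0], w) to the given pair. *)
pose k := c^-1 * (b * g); have Gk : k \in G by rewrite !groupM ?groupV.
have ek : z0 ^ k = z0 ^ g.
  rewrite /k !conjgM (commute_conj (commuteV (commute_sym cc))).
  by rewrite (commute_conj (commute_sym cb)).
have wk : w ^ k = y by rewrite /k !conjgM -ec conjgK eb conjgKV.
exists (imgeo (fun x => x ^ k)); first exact/emb_copy/emb_conj.
rewrite in_set /= -ek -wk ddJ // dw eqxx andbT.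
by apply/andP; split; apply/imsetP; [exists z0; rewrite ?z0H | exists w].
Qed.

(** Cancels 315 * 64 symbolically, using 4095 = 315 * 13, 2048 = 64 * 32 and 13 * 32 = 416, so that
    4095 * 2048 is never evaluated as a unary number. *)
Lemma count_factor a b c d m k n l : (a * b = m)%N -> (c * d = k)%N -> (b * d = l)%N ->
  0 < a -> 0 < c -> (m * k = n * (a * c))%N -> n = l.
Proof.
move=> <- <- <- a0 c0; rewrite mulnACA mulnC => /eqP.
by rewrite eqn_pmul2r ?muln_gt0 ?a0 // => /eqP.
Qed.

Lemma card_copies : #|copies| = 416.
Proof.
pose Q := [set antipodal (points h) | h in copies].
have ne h : h \in copies -> exists p, p \in antipodal (points h).
  by move=> hc; apply/card_gt0P; rewrite card_antipodal_copy.
have inj : {in copies &, injective (fun h => antipodal (points h))}.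
  move=> h h' hc hc' e; have [p ph] := ne h hc.
  by apply: (copy_unique hc hc' ph); rewrite -e.
have part : partition Q (antipodal P).
  apply/and3P; split.
  - apply/eqP/setP=> p; apply/bigcupP/idP => [[_ /imsetP[h hc ->]]|/copy_exists[h hc ph]].
      rewrite in_set => /and3P[p1 p2 d]; rewrite in_set d andbT.
      move: hc; rewrite inE => /andP[/and3P[/subsetP sP _ _] _].
      by apply/andP; split; apply: sP.
    by exists (antipodal (points h)) => //; apply/imsetP; exists h.
  - apply/trivIsetP=> _ _ /imsetP[h hc ->] /imsetP[h' hc' ->] n.
    apply/pred0P=> p /=; apply/negP=> /andP[ph ph'].
    by rewrite (copy_unique hc hc' ph ph') eqxx in n.
  by apply/imsetP=> -[h /ne[p ph] e]; rewrite -e inE in ph.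
have unif : {in Q, forall A : {set gT * gT}, #|A| = (315 * 64)%N}.
  by move=> _ /imsetP[h hc ->]; apply: card_antipodal_copy.
have := card_uniform_partition unif part.
rewrite (card_antipodal (k := 2048)); last exact: card_antipodes.
rewrite (card_in_imset inj) card_P.
exact: (@count_factor 315 13 64 32 4095 2048 #|copies| 416 erefl erefl erefl erefl erefl).
Qed.

Lemma group_main : let Pc := central_involutions G in
  let Lc := involution_lines G Pc [:: 1365; 13650] in
  [/\ Pc \in classes G /\ #|Pc| = 4095,
      near_octagon (Pc, Lc) /\ has_order 2 10 (Pc, Lc),
      geom_aut (Pc, Lc) \isog G,
      line_spread (Pc, Lc) (involution_lines G Pc [:: 1365]) &
      #|[set h : geometry gT | full_subgeometry (Pc, Lc) h && geom_isomorphic h HJ]| = 416].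
Proof.
rewrite /= central_involutions_P; split.
- by split; [rewrite P_class; apply/imsetP; exists z0; rewrite ?(subsetP P_G) ?z0P | exact: card_P].
- exact: (conj geo_near_octagon geo_order).
- exact: geo_aut_isog.
- exact: geo_spread.
exact: card_copies.
Qed.

End Group.

Theorem theorem1p1 (F : finFieldType) (hF : #|F| = 4) :
  let G : {group {perm octonion F}} := G2_semilinear F in
  let P : {set {perm octonion F}} := central_involutions G in
  let L : {set {set {perm octonion F}}} :=
    involution_lines G P [:: 1365; 13650] in
  let Sstar : {set {set {perm octonion F}}} :=
    involution_lines G P [:: 1365] in
  let geo : geometry {perm octonion F} := (P, L) in
  [/\ P \in classes G /\ #|P| = 4095,
      near_octagon geo /\ has_order 2 10 geo,
      geom_aut geo \isog G,
      line_spread geo Sstar &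
      #|[set h : geometry {perm octonion F} |
           full_subgeometry geo h && geom_isomorphic h HJ]| = 416].
Proof.
exact: (group_main (oct_act1 hF) (@oct_actM F hF) (@oct_act_inj F hF)
  (@oct_act_semi F hF) (@oct_act_surj F hF)).
Qed.
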